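(* Let $\mathcal R_W$ be the averaging reconstruction operator on $W_h^-$ defined in the context, and let $\mathcal R_U u_h=(\mathcal R_Wu_{\mathcal T},u_{\mathcal F})$ for $u_h=(u_{\mathcal T},u_{\mathcal F})\in U_h=W_h^-\times F_h$. Then: (1) $\mathcal R_Wv_{\mathcal T}\in W_h$ for all $v_{\mathcal T}\in W_h^-$; (2) $(\mathcal R_Wv_{\mathcal T}\cdot n,\varphi)_F=(v_{\mathcal T}\cdot n,\varphi)_F$ for all $\varphi\in\mathcal P^{k-1}(F)$, $v_{\mathcal T}\in W_h^-$, $F\in\mathcal F_h$; (3) $(\mathcal R_Wv_{\mathcal T},\varphi)_T=(v_T,\varphi)_T$ for all $\varphi\in[\mathcal P^{k-2}(T)]^d$, $v_{\mathcal T}\in W_h^-$, $T\in\mathcal T_h$; (4) $|\!|\!|\mathcal R_Uv_h|\!|\!|_1\lesssim|\!|\!|v_h|\!|\!|_1$ for all $v_h\in U_h$.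
   Context: **Mesh.** $d\in\{2,3\}$; $\Omega\subset\mathbb R^d$ is open, bounded, with Lipschitz boundary; $\mathcal T_h$ is a shape-regular triangulation of $\Omega$ into straight simplices; $\mathcal F_h$ is the set of facets, split into interior facets $\mathcal F_h^{\rm int}$ and exterior (boundary) facets $\mathcal F_h^{\rm ext}$. $h$ is the characteristic mesh size; it may be understood as a local quantity (inside sums over elements $h$ may be read as the diameter of $T$). $k\ge1$ is a fixed integer. $a\lesssim b$ means $a\le c\,b$ with $c$ independent of $h$ (and of the functions involved). **Notation.** $\mathcal P^m(T),\mathcal P^m(F)$: polynomials of degree $\le m$ ($\{0\}$ if $m<0$). $(\cdot,\cdot)_\omega$: $L^2(\omega)$ inner product. $n$: unit normal. $v^t=v-(v\cdot n)n$. $[\cdot]_F$: usual jump across an interior facet, identity on exterior facets. $\Pi_F^{k-1}$: $L^2(F)$-orthogonal projection onto polynomials of degree $\le k-1$ on $F$ (scalar- or vector-valued). **Spaces and norm.** $W_h=\{u_{\mathcal T}\in\prod_{T}[\mathcal P^k(T)]^d:\ [u_{\mathcal T}\cdot n]_F=0\ \forall F\in\mathcal F_h\}$; $W_h^-=\{u_{\mathcal T}\in\prod_{T}[\mathcal P^k(T)]^d:\ \Pi_F^{k-1}[u_{\mathcal T}\cdot n]_F=0\ \forall F\in\mathcal F_h\}$; $F_h=\{u_{\mathcal F}\in\prod_{F\in\mathcal F_h}[\mathcal P^{k-1}(F)]^d:\ u_F\cdot n=0\ \forall F\in\mathcal F_h^{\rm int},\ u_F=0\ \forall F\in\mathcal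 F_h^{\rm ext}\}$. $u_T=u_{\mathcal T}|_T$, $u_F=u_{\mathcal F}|_F$. On $F\subset\partial T$: $[\![u_h^t]\!]_F=(u_T)^t|_F-u_F$. $|\!|\!|u_h|\!|\!|_1^2=\sum_T\{\|\nabla u_T\|_T^2+\tfrac1h\|\Pi_F^{k-1}[\![u_h^t]\!]_F\|_{\partial T}^2\}$. **Facet basis functions.** Jacobi polynomials: $p_n^\alpha(x)=\frac{1}{2^nn!(1-x)^\alpha}\frac{d^n}{dx^n}\big((1-x)^\alpha(x^2-1)^n\big)$; integrated ones: $\hat p_n^\alpha(x)=\int_{-1}^xp_{n-1}^\alpha(\xi)\,d\xi$ $(n\ge1)$, $\hat p_0^\alpha=1$. Each facet $F$ is given a fixed ordering of its vertices, used by all elements containing $F$; let $\lambda_{f_1},\dots,\lambda_{f_d}$ be the barycentric coordinates of $T$ belonging to these vertices. The functions below are the Piola images of reference-element functions given by the same formulas. For $d=2$ ($\operatorname{curl}g=(\partial_yg,-\partial_xg)$): $\phi_0^{F,T}=\operatorname{curl}(\lambda_{f_1})\lambda_{f_2}-\lambda_{f_1}\operatorname{curl}(\lambda_{f_2})$ and $\phi_i^{F,T}=\operatorname{curl}\big(\hat p^0_{i+1}(\tfrac{\lambda_{f_2}-\lambda_{f_1}}{\lambda_{f_2}+\lambda_{f_1}})(\lambda_{f_2}+\lambda_{f_1})^{i+1}\big)$, $1\le i\le k$. For $d=3$: with $u_i^F=\hat p_i^0(\tfrac{\lambda_{f_2}-\lambda_{f_1}}{\lambda_{f_2}+\lambda_{f_1}})(\lambda_{f_2}+\lambda_{f_1})^i$,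 $v_{ij}^F=\hat p_j^{2i-1}(\tfrac{\lambda_{f_3}-\lambda_{f_2}-\lambda_{f_1}}{\lambda_{f_3}+\lambda_{f_2}+\lambda_{f_1}})(\lambda_{f_3}+\lambda_{f_2}+\lambda_{f_1})^j$, $\mathcal N_0=\nabla\lambda_{f_1}\lambda_{f_2}-\lambda_{f_1}\nabla\lambda_{f_2}$: $\phi_{00}^{F,T}=\lambda_{f_1}\nabla\lambda_{f_2}\times\nabla\lambda_{f_3}+\lambda_{f_2}\nabla\lambda_{f_3}\times\nabla\lambda_{f_1}+\lambda_{f_3}\nabla\lambda_{f_1}\times\nabla\lambda_{f_2}$; $\phi_{0l}^{F,T}=\nabla\times(\mathcal N_0v_{2l}^F)$, $1\le l\le k$; $\phi_{ij}^{F,T}=\nabla\times(\nabla u^F_{i+1}v^F_{(i+1)(j+1)})$, $i\ge1$, $j\ge0$, $i+j\le k$. For $F\subset\partial T$ the traces $\phi_{ij}^{F,T}\cdot n|_F$, $i+j\le k$, form a basis of $\mathcal P^k(F)$; the normal component of $\phi_{ij}^{F,T}$ vanishes on the other facets of $T$; and for $F=T\cap T'$ (with $n$ a fixed normal of $F$) $\phi_{ij}^{F,T}\cdot n=\phi_{ij}^{F,T'}\cdot n$ on $F$. (In 2D drop the index $j$; ''$i+j=k$'' means $i=k$.) **Averaging operator.** For $v_{\mathcal T}\in W_h^-$, $T\in\mathcal T_h$, $F\subset\partial T$ write $v_T\cdot n|_F=\sum_{i+j\le k}\alpha_{ij}^{F,T}\,\phi_{ij}^{F,T}\cdot n$ (for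 $i+j<k$ the coefficients agree from both sides of an interior facet). Set $\overline\alpha_{ij}^F=\tfrac12(\alpha_{ij}^{F,T}+\alpha_{ij}^{F,T'})$ for $F=T\cap T'$ interior and $\overline\alpha_{ij}^F=0$ for $F$ exterior $(i+j=k)$. The operator changes only the highest-order facet coefficients, replacing $\alpha_{ij}^{F,T}$ by $\overline\alpha_{ij}^F$: $$(\mathcal R_Wv_{\mathcal T})|_T=v_T+\sum_{F\subset\partial T}\ \sum_{i+j=k}\big(\overline\alpha_{ij}^F-\alpha_{ij}^{F,T}\big)\phi_{ij}^{F,T}.$$ *)

(* Defs.v *)
From HB Require Import structures.
From mathcomp Require Import all_boot all_order all_algebra.
From mathcomp Require Import all_classical all_reals all_analysis.
From mathcomp.multinomials Require mpoly.
(* the notations of mpoly clash with those of mathcomp-analysis *)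
Import -(notations) mpoly.

Set Implicit Arguments.
Unset Strict Implicit.
Unset Printing Implicit Defensive.

Import Order.TTheory GRing.Theory Num.Theory.
Import numFieldNormedType.Exports.

Local Open Scope classical_set_scope.
Local Open Scope ring_scope.

(** ** Euclidean space, polynomials and polynomial vector fields *)

(* The norm `|x| of mathcomp-analysis on row vectors is the sup norm, so the
   Euclidean norm is introduced separately. *)
Definition dot (R : realType) (d : nat) (x y : 'rV[R]_d) : R :=
  \sum_i x 0 i * y 0 i.

Definition enorm (R : realType) (d : nat) (x : 'rV[R]_d) : R :=
  Num.sqrt (dot x x).

Definition peval (R : realType) (d : nat) (p : mpoly d R) (x : 'rV[R]_d) : R :=
  meval (x 0) p.

Definition veval (R : realType) (d : nat) (u : 'rV[mpoly d R]_d)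
  (x : 'rV[R]_d) : 'rV[R]_d := \row_i peval (u 0 i) x.

(* [deg_lt m p] means that p has degree < m, so that P^k, P^(k-1), P^(k-2)
   are [deg_lt k.+1], [deg_lt k], [deg_lt k.-1] (k >= 1); [deg_lt 0 p] is
   p = 0. *)
Definition deg_lt (R : realType) (d m : nat) (p : mpoly d R) : Prop :=
  (msize p <= m)%N.

Definition vdeg_lt (R : realType) (d m : nat) (u : 'rV[mpoly d R]_d) : Prop :=
  forall i, deg_lt m (u 0 i).

Definition grad (R : realType) (d : nat) (p : mpoly d R) : 'rV[mpoly d R]_d :=
  \row_i mderiv i p.

Definition curl2 (R : realType) (g : mpoly 2 R) : 'rV[mpoly 2 R]_2 :=
  \row_i (if i == 0 then mderiv (1 : 'I_2) g else - mderiv (0 : 'I_2) g).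

(* the indices i + 1 and i + 2 are taken modulo 3 *)
Definition cross3 (A : comPzRingType) (a b : 'rV[A]_3) : 'rV[A]_3 :=
  \row_i (a 0 (i + 1) * b 0 (i + 2%:R) - a 0 (i + 2%:R) * b 0 (i + 1)).

Definition curl3 (R : realType) (u : 'rV[mpoly 3 R]_3) : 'rV[mpoly 3 R]_3 :=
  \row_i (mderiv (i + 1 : 'I_3) (u 0 (i + 2%:R))
          - mderiv (i + 2%:R : 'I_3) (u 0 (i + 1))).

(** ** Integrated Jacobi polynomials *)

(* Rodrigues' formula; the division by (1 - 'X) ^+ alpha is exact. *)
Definition jacobi (R : realType) (n alpha : nat) : {poly R} :=
  ((2 ^ n * n`!)%N%:R)^-1 *:
  (((1 - 'X) ^+ alpha * ('X ^+ 2 - 1) ^+ n)^`(n) %/ ((1 - 'X) ^+ alpha)).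

(* the primitive of p that vanishes at 0; its coefficient of index 0 is
   p`_0 / 0 = 0 *)
Definition primitive (R : realType) (p : {poly R}) : {poly R} :=
  \poly_(i < (size p).+1) (p`_i.-1 / i%:R).

Definition ijacobi (R : realType) (n alpha : nat) : {poly R} :=
  match n with
  | 0 => 1
  | n'.+1 => let q := primitive (jacobi R n' alpha) in q - (q.[-1])%:P
  end.

(* p(a / b) * b ^ i as a polynomial, for p of degree at most i *)
Definition scaled (R : realType) (d : nat) (p : {poly R}) (i : nat)
  (a b : mpoly d R) : mpoly d R :=
  \sum_(m < i.+1) mpolyC d p`_m * a ^+ m * b ^+ (i - m).

Lemma scaledE (R : realType) (d : nat) (p : {poly R}) (i : nat)
  (a b : mpoly d R) (x : 'rV[R]_d) :
  (size p <= i.+1)%N -> peval b x != 0 ->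
  peval (scaled p i a b) x = p.[peval a x / peval b x] * peval b x ^+ i.
Proof.
move=> sp b0; rewrite (horner_coef_wide _ sp) mulr_suml /peval /scaled raddf_sum.
apply: eq_bigr => m _; rewrite /= !mevalM !rmorphXn /= mevalC expr_div_n -!mulrA.
congr (_ * (_ * _)).
have mi : (m <= i)%N by rewrite -ltnS.
by rewrite -[X in _ = _ * _ ^+ X](subnKC mi) exprD mulKf // expf_neq0.
Qed.

(** ** Facet basis functions

   [lam] lists the barycentric coordinates of the element that belong to the
   vertices of the facet.  The formulas are those of the reference element,
   written with the barycentric coordinates of the physical element: gradients
   are covariant, and the (signed) Piola transform maps curls and cross
   products of covariant fields to curls and cross products, so these are
   exactly the Piola images. *)

Definition facet_fun2 (R : realType) (lam : 'I_2 -> mpoly 2 R) (i j : nat) :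
  'rV[mpoly 2 R]_2 :=
  let l1 := lam 0 in let l2 := lam 1 in
  match i with
  | 0 => l2 *: curl2 l1 - l1 *: curl2 l2
  | i'.+1 => curl2 (scaled (ijacobi R i.+1 0) i.+1 (l2 - l1) (l2 + l1))
  end.

Definition facet_fun3 (R : realType) (lam : 'I_3 -> mpoly 3 R) (i j : nat) :
  'rV[mpoly 3 R]_3 :=
  let l1 := lam 0 in let l2 := lam 1 in let l3 := lam 2%:R in
  let u n := scaled (ijacobi R n 0) n (l2 - l1) (l2 + l1) in
  let v n m := scaled (ijacobi R m (2 * n - 1)) m
                 (l3 - l2 - l1) (l3 + l2 + l1) in
  let N0 := l2 *: grad l1 - l1 *: grad l2 in
  match i, j with
  | 0, 0 => l1 *: cross3 (grad l2) (grad l3) + l2 *: cross3 (grad l3) (grad l1)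
            + l3 *: cross3 (grad l1) (grad l2)
  | 0, l.+1 => curl3 (v 2%N j *: N0)
  | i'.+1, _ => curl3 (v i.+1 j.+1 *: grad (u i.+1))
  end.

Definition facet_fun (R : realType) (d : nat) :
  ('I_d -> mpoly d R) -> nat -> nat -> 'rV[mpoly d R]_d :=
  match d return ('I_d -> mpoly d R) -> nat -> nat -> 'rV[mpoly d R]_d with
  | 2 => @facet_fun2 R
  | 3 => @facet_fun3 R
  | _ => fun _ _ _ => 0
  end.

(* the index set i + j <= k for d = 3, and i <= k (with j = 0) for d = 2 *)
Definition facet_index (d k : nat) (p : 'I_k.+1 * 'I_k.+1) : bool :=
  (p.1 + p.2 <= k)%N && ((d == 3) || (p.2 == 0 :> nat)).

Definition top_index (d k : nat) (p : 'I_k.+1 * 'I_k.+1) : bool :=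
  facet_index d p && (p.1 + p.2 == k)%N.

(** ** Domains and meshes *)

Definition bounded_domain (R : realType) (d : nat) (Om : set 'rV[R]_d) : Prop :=
  exists C : R, forall x, Om x -> enorm x <= C.

(* Near every boundary point, Om lies strictly above the graph of a Lipschitz
   function over the hyperplane orthogonal to some unit vector e. *)
Definition lipschitz_boundary (R : realType) (d : nat) (Om : set 'rV[R]_d) :
  Prop :=
  forall x, (closure Om `\` interior Om) x ->
  exists (e : 'rV[R]_d) (r L : R) (gamma : 'rV[R]_d -> R),
    [/\ dot e e = 1, 0 < r,
        forall y z, `|gamma y - gamma z| <= L * enorm (y - z) &
        forall y, enorm (y - x) < r ->
          (Om y <-> gamma (y - dot y e *: e) < dot y e)].

(* Simplices and facets are given by the set of their vertices; [forder F] is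
   the fixed ordering of the vertices of the facet F. *)
Record mesh (R : realType) (d : nat) := Mesh {
  nvert : nat;
  vert : 'I_nvert -> 'rV[R]_d;
  cells : {set {set 'I_nvert}};
  forder : {set 'I_nvert} -> d.-tuple 'I_nvert
}.

Definition simplex (R : realType) (d : nat) (M : mesh R d)
  (S : {set 'I_(nvert M)}) : set 'rV[R]_d :=
  [set x | exists c : 'I_(nvert M) -> R,
     [/\ forall v, v \in S -> 0 <= c v, \sum_(v in S) c v = 1 &
         x = \sum_(v in S) c v *: vert v]].

Definition affinely_independent (R : realType) (d : nat) (M : mesh R d)
  (S : {set 'I_(nvert M)}) : Prop :=
  forall c : 'I_(nvert M) -> R,
    \sum_(v in S) c v = 0 -> \sum_(v in S) c v *: vert v = 0 ->
    forall v, v \in S -> c v = 0.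

Definition facets (R : realType) (d : nat) (M : mesh R d) :
  {set {set 'I_(nvert M)}} :=
  [set F : {set 'I_(nvert M)} |
    (#|F| == d) && [exists T in cells M, F \subset T]].

Definition cells_at (R : realType) (d : nat) (M : mesh R d)
  (F : {set 'I_(nvert M)}) : {set {set 'I_(nvert M)}} :=
  [set T in cells M | F \subset T].

Definition interior_facet (R : realType) (d : nat) (M : mesh R d)
  (F : {set 'I_(nvert M)}) : bool := (1 < #|cells_at F|)%N.

Definition triangulation (R : realType) (d : nat) (Om : set 'rV[R]_d)
  (M : mesh R d) : Prop :=
  [/\ forall T, T \in cells M -> #|T| = d.+1 /\ affinely_independent T,
      forall T T', T \in cells M -> T' \in cells M ->
        simplex T `&` simplex T' = simplex (T :&: T'),
      closure Om = [set x | exists2 T, T \in cells M & simplex T x] &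
      forall F, F \in facets M -> [set v in forder F] = F].

Definition diameter (R : realType) (d : nat) (M : mesh R d)
  (T : {set 'I_(nvert M)}) : R :=
  sup [set r | exists x y, [/\ simplex T x, simplex T y & r = enorm (x - y)]].

Definition inradius (R : realType) (d : nat) (M : mesh R d)
  (T : {set 'I_(nvert M)}) : R :=
  sup [set r | 0 <= r /\
    exists x, forall y, enorm (y - x) <= r -> simplex T y].

Definition shape_regular (R : realType) (d : nat) (sigma : R) (M : mesh R d) :
  Prop :=
  forall T, T \in cells M -> diameter T <= sigma * inradius T.

(** ** Integration over simplices and facets *)

(* Integral of t |-> f (x + t_1 e_1 + ... + t_m e_m) over the simplex
   t_i >= 0, t_1 + ... + t_m <= r, as an iterated Lebesgue integral. *)
Fixpoint ref_integral (R : realType) (d : nat) (E : seq 'rV[R]_d) (r : R)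
  (x : 'rV[R]_d) (f : 'rV[R]_d -> R) : R :=
  match E with
  | [::] => f x
  | e :: E' => \int[@lebesgue_measure R]_(t in `[0, r])
                 ref_integral E' (r - t) (x + t *: e) f
  end.

(* Integral over the simplex with vertices S for the measure of its own
   dimension (volume on elements, surface measure on facets), by the affine
   parametrization and its volume element, the root of the Gram determinant. *)
Definition simplex_integral (R : realType) (d : nat) (M : mesh R d)
  (S : {set 'I_(nvert M)}) (f : 'rV[R]_d -> R) : R :=
  match [seq vert v | v <- enum S] with
  | [::] => 0
  | a :: s =>
    let E := [seq b - a | b <- s] in
    Num.sqrt (\det (\matrix_(i < size E, j < size E) dot E`_i E`_j))
    * ref_integral E 1 a f
  end.

(* L2-orthogonal projection onto the polynomials of degree < m on F; the
   representative is unique only as a function on F. *)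
Definition facet_proj (R : realType) (d : nat) (M : mesh R d)
  (F : {set 'I_(nvert M)}) (m : nat) (f : 'rV[R]_d -> R) : mpoly d R :=
  xget 0 [set p : mpoly d R | deg_lt m p /\
    forall q : mpoly d R, deg_lt m q ->
      simplex_integral F (fun x => (f x - peval p x) * peval q x) = 0].

Definition facet_vproj (R : realType) (d : nat) (M : mesh R d)
  (F : {set 'I_(nvert M)}) (m : nat) (f : 'rV[R]_d -> 'rV[R]_d) :
  'rV[mpoly d R]_d := \row_i facet_proj F m (fun x => f x 0 i).

(** ** Discrete spaces and norm

   Discrete functions assign a polynomial field to every element (facet); only
   the values at elements (facets) of the mesh matter. *)

Definition discrete_field (R : realType) (d : nat) (M : mesh R d) :=
  {set 'I_(nvert M)} -> 'rV[mpoly d R]_d.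

(* a unit normal of the facet F, fixed once and for all (its sign is
   arbitrary) *)
Definition facet_normal (R : realType) (d : nat) (M : mesh R d)
  (F : {set 'I_(nvert M)}) : 'rV[R]_d :=
  xget 0 [set n : 'rV[R]_d | dot n n = 1 /\
    forall v w, v \in F -> w \in F -> dot n (vert v - vert w) = 0].

Definition tangential (R : realType) (d : nat) (n w : 'rV[R]_d) : 'rV[R]_d :=
  w - dot w n *: n.

Definition normal_trace (R : realType) (d : nat) (M : mesh R d)
  (F : {set 'I_(nvert M)}) (u : 'rV[mpoly d R]_d) (x : 'rV[R]_d) : R :=
  dot (veval u x) (facet_normal F).

(* the normal jump of u across F, which is determined up to its sign on an
   interior facet *)
Definition normal_jump (R : realType) (d : nat) (M : mesh R d)
  (u : discrete_field M) (F : {set 'I_(nvert M)}) : set ('rV[R]_d -> R) :=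
  [set g | if interior_facet F then
      exists T T', [/\ T \in cells_at F, T' \in cells_at F, T != T' &
        g = fun x => normal_trace F (u T) x - normal_trace F (u T') x]
    else exists2 T, T \in cells_at F & g = normal_trace F (u T)].

Definition broken_poly (R : realType) (d : nat) (k : nat) (M : mesh R d)
  (u : discrete_field M) : Prop :=
  forall T, T \in cells M -> vdeg_lt k.+1 (u T).

Definition W_space (R : realType) (d : nat) (k : nat) (M : mesh R d)
  (u : discrete_field M) : Prop :=
  broken_poly k u /\
  forall F g, F \in facets M -> normal_jump u F g ->
    forall x, simplex F x -> g x = 0.

Definition Wminus_space (R : realType) (d : nat) (k : nat) (M : mesh R d)
  (u : discrete_field M) : Prop :=
  broken_poly k u /\
  forall F g, F \in facets M -> normal_jump u F g ->
    forall x, simplex F x -> peval (facet_proj F k g) x = 0.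

Definition F_space (R : realType) (d : nat) (k : nat) (M : mesh R d)
  (u : discrete_field M) : Prop :=
  forall F, F \in facets M ->
    vdeg_lt k (u F) /\
    forall x, simplex F x ->
      if interior_facet F then normal_trace F (u F) x = 0
      else veval (u F) x = 0.

Definition U_space (R : realType) (d : nat) (k : nat) (M : mesh R d)
  (u : discrete_field M * discrete_field M) : Prop :=
  Wminus_space k u.1 /\ F_space k u.2.

Definition tangential_jump (R : realType) (d : nat) (M : mesh R d)
  (u : discrete_field M * discrete_field M) (T F : {set 'I_(nvert M)})
  (x : 'rV[R]_d) : 'rV[R]_d :=
  tangential (facet_normal F) (veval (u.1 T) x) - veval (u.2 F) x.

Definition norm1 (R : realType) (d : nat) (k : nat) (M : mesh R d)
  (u : discrete_field M * discrete_field M) : R :=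
  Num.sqrt (\sum_(T in cells M)
    (simplex_integral T (fun x =>
         \sum_i \sum_j (peval (mderiv j (u.1 T 0 i)) x) ^+ 2)
     + (diameter T)^-1 * \sum_(F in facets M | F \subset T)
         simplex_integral F (fun x =>
           enorm (veval (facet_vproj F k (tangential_jump u T F)) x) ^+ 2))).

(** ** Averaging operator *)

Definition barycentric (R : realType) (d : nat) (M : mesh R d)
  (T : {set 'I_(nvert M)}) (v : 'I_(nvert M)) : mpoly d R :=
  xget 0 [set p : mpoly d R | deg_lt 2 p /\
    forall w, w \in T -> peval p (vert w) = (w == v)%:R].

Definition facet_basis (R : realType) (d : nat) (M : mesh R d)
  (T F : {set 'I_(nvert M)}) (i j : nat) : 'rV[mpoly d R]_d :=
  facet_fun (fun l => barycentric T (tnth (forder F) l)) i j.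

(* the coefficients of u_T . n on F; those outside [facet_index] are
   irrelevant *)
Definition facet_coef (R : realType) (d : nat) (k : nat) (M : mesh R d)
  (u : discrete_field M) (T F : {set 'I_(nvert M)}) :
  {ffun 'I_k.+1 * 'I_k.+1 -> R} :=
  xget [ffun=> 0] [set a : {ffun 'I_k.+1 * 'I_k.+1 -> R} |
    forall x, simplex F x -> normal_trace F (u T) x =
      \sum_(p | facet_index d p)
         a p * normal_trace F (facet_basis T F p.1 p.2) x].

Definition avg_coef (R : realType) (d : nat) (k : nat) (M : mesh R d)
  (u : discrete_field M) (F : {set 'I_(nvert M)}) (p : 'I_k.+1 * 'I_k.+1) : R :=
  if interior_facet F then 2^-1 * \sum_(T in cells_at F) facet_coef k u T F p
  else 0.

Definition RW (R : realType) (d : nat) (k : nat) (M : mesh R d)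
  (u : discrete_field M) : discrete_field M :=
  fun T => u T + \sum_(F in facets M | F \subset T) \sum_(p | top_index d p)
    mpolyC d (avg_coef u F p - facet_coef k u T F p)
      *: facet_basis T F p.1 p.2.

Definition RU (R : realType) (d : nat) (k : nat) (M : mesh R d)
  (u : discrete_field M * discrete_field M) :
  discrete_field M * discrete_field M := (RW k u.1, u.2).

(* Main.v *)
From HB Require Import structures.
Require Import Defs.
From mathcomp Require Import all_boot all_order all_algebra.
From mathcomp Require Import all_classical all_reals all_analysis.
From mathcomp Require Import perm.
From mathcomp.multinomials Require mpoly.
From mathcomp Require Import polyrcf ring lra zify.
Import -(notations) mpoly.

(** Written with the barycentric coordinates of the vertices of F, every facet
    function is [sum_l A_l w_l], where the [w_l] are dual to their gradients up
    to the factor [det]; hence its flux through F is a constant times the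
    trace polynomial [D = sum_l A_l], and its flux through the other facets
    vanishes because [A_l = 0] where the l-th coordinate does.  Integrals of
    products of barycentric coordinates are given by Dirichlet's formula, so
    integrals of homogeneous forms [P(b / a) a^n] reduce to integrals of
    Jacobi polynomials over [-1, 1].  This shows that the [D_ij] are orthogonal
    on F to all polynomials of degree less than [i + j] and to each other, hence
    form a basis of [P^k(F)], and that the facet functions with [i + j = k] are
    orthogonal on T to fields of degree at most [k - 2]; (1), (2), (3) follow.

    For (4), the functions with [i + j > 0] are divergence free, so the
    divergence theorem applied to [(v . n) phi_ij] on T expresses the coefficient
    of [v . n] along [D_ij] by the integral of [grad (v . n) . phi_ij].  Together
    with scaling estimates, Cauchy-Schwarz bounds the square of a coefficient of
    top degree by [C h^d ||grad v||_T^2].  Since at most two elements share a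
    facet, and neighbours have comparable diameters, summation over the elements
    gives the bound of both parts of the norm. *)

Set Implicit Arguments.
Unset Strict Implicit.
Unset Printing Implicit Defensive.

Import Order.TTheory GRing.Theory Num.Theory.
Import numFieldNormedType.Exports.
Local Open Scope classical_set_scope.
Local Open Scope ring_scope.

(** * Integrated Jacobi polynomials *)

(** Moments are computed by algebra: on barycentric monomials [sint] depends on the exponents only,
    so linearity and the divergence theorem reduce to identities between factorials, while the
    geometry sits in [sgram], [gdet] and [normal_deriv].

    A top coefficient has total index [k >= 1], so it does not see constants and is controlled by
    the gradient inside its own element. In (4) the average and the own coefficient are therefore
    bounded separately, on each side of the facet. The powers of [h] balance: a squared coefficient
    is of order [h ^ d] times the gradient energy, whereas the gradient energy of a facet function,
    and its facet energy weighted by [1 / h], are of order [h ^ (- d)].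

    The two sides of a facet fit together because the gradients of a facet vertex taken in the two
    elements differ by a multiple of the normal, which normal traces do not see. That at most two
    elements meet at a facet follows from the signs of the normal derivatives of the opposite
    barycentric coordinates.

    Barycentric coordinates, normals, projections and coefficients are chosen by [xget], so each
    needs an existence proof before use; projections are compared through their values on the
    facet. *)

Section Univariate.
Variable R : realType.
Implicit Types p q : {poly R}.

Lemma deriv_primitive p : (primitive p)^`() = p.
Proof.
apply/polyP => i; rewrite coef_deriv coef_poly ltnS.
case: ltnP => [_|h]; last by rewrite mul0rn nth_default.
by rewrite -[LHS]mulr_natr [LHS]divfK // pnatr_eq0.
Qed.

Lemma deriv_eq_hornerB p q a b :
  p^`() = q^`() -> p.[b] - p.[a] = q.[b] - q.[a].
Proof.
move=> pq; have : size (p - q)^`() = 0%N by rewrite derivB pq subrr size_poly0.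
rewrite polyorder.size_deriv => h.
have /size1_polyC e : (size (p - q)%R <= 1)%N by case: (size _) h => [|[]].
have : (p - q).[b] = (p - q).[a] by rewrite e !hornerC.
rewrite !hornerE; lra.
Qed.

(** The integral over [[-1, 1]], taken through the formal primitive so that linearity and
    integration by parts are statements about polynomials. *)
Definition pint p : R := (primitive p).[1] - (primitive p).[-1].

Lemma pint_deriv p : pint p^`() = p.[1] - p.[-1].
Proof. by apply: deriv_eq_hornerB; rewrite deriv_primitive. Qed.

Lemma pintD p q : pint (p + q) = pint p + pint q.
Proof.
rewrite -{1}[p]deriv_primitive -{1}[q]deriv_primitive -derivD pint_deriv.
rewrite /pint !hornerD; ring.
Qed.

Lemma pintZ c p : pint (c *: p) = c * pint p.
Proof.
by rewrite -{1}[p]deriv_primitive -derivZ pint_deriv /pint !hornerZ mulrBr.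
Qed.

Lemma pint0 : pint 0 = 0.
Proof. by rewrite -(scale0r 0) pintZ mul0r. Qed.

Lemma pintN p : pint (- p) = - pint p.
Proof. by rewrite -scaleN1r pintZ mulN1r. Qed.

Lemma pint_parts p q :
  pint (p^`() * q) = (p * q).[1] - (p * q).[-1] - pint (p * q^`()).
Proof. by rewrite -pint_deriv derivM pintD addrK. Qed.

(** The primitive is nondecreasing on [[-1, 1]]. Equal end values would make it constant there,
    hence constant as a polynomial, and its derivative [p] would be 0. *)
Lemma pint_gt0 p : p != 0 -> (forall x, -1 <= x <= 1 -> 0 <= p.[x]) ->
  0 < pint p.
Proof.
move=> p0 pge; set P := primitive p.
have dP : P^`() = p by rewrite deriv_primitive.
have mono x y : -1 <= x -> x <= y -> y <= 1 -> P.[x] <= P.[y].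
  move=> x1 xy y1; apply: (@ler_hornerW _ (-1) 1) => //.
  - move=> z; rewrite in_itv /= => /andP[z1 z2].
    by rewrite dP pge // !ltW.
  - by rewrite in_itv /= x1 (le_trans xy).
  - by rewrite in_itv /= y1 andbT (le_trans x1).
have N11 : -1 <= 1 :> R by lra.
rewrite subr_gt0 lt_neqAle mono // andbT; apply/eqP => e.
have hP x : -1 <= x -> x <= 1 -> P.[x] = P.[-1].
  by move=> x1 x2; apply/eqP; rewrite eq_le {1}e !mono.
have : P - P.[-1]%:P = 0.
  apply/eqP; apply/negPn/negP => nz.
  (* The points [1 / (i + 1)] are distinct and lie in [[-1, 1]]; there are as many as the size, one
     more than the degree allows for roots. *)
  pose s := [seq (i.+1%:R)^-1 : R | i <- iota 0 (size (P - P.[-1]%:P))].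
  have us : uniq s.
    by rewrite map_inj_uniq ?iota_uniq // => i j /invr_inj/eqP;
       rewrite eqr_nat => /eqP[].
  have rs : all (root (P - P.[-1]%:P)) s.
    apply/allP => _ /mapP[i _ ->]; rewrite rootE !hornerE hP ?subrr //.
      by rewrite (@le_trans _ _ 0) ?invr_ge0 ?ler0n // lerN10.
    by rewrite invf_le1 ?ltr0n // ler1n.
  by have := max_poly_roots nz rs us; rewrite size_map size_iota ltnn.
move/(congr1 (fun p => p^`())); rewrite derivB derivC subr0 dP deriv0.
by apply/eqP.
Qed.

(** [m] integrations by parts move the derivatives onto [q]; each boundary term contains a
    derivative of [p] of order below [m]. *)
Lemma pint_orthogonal_derivn m p q :
  (forall i, (i < m)%N -> root p^`(i) 1 && root p^`(i) (-1)) ->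
  (size q <= m)%N -> pint (p^`(m) * q) = 0.
Proof.
elim: m q => [|m IH] q h sq.
  by move: sq; rewrite leqn0 size_poly_eq0 => /eqP ->; rewrite mulr0 pint0.
rewrite derivnS pint_parts !hornerM.
have /andP[/rootP -> /rootP ->] := h m (ltnSn m).
rewrite !mul0r subrr sub0r IH ?oppr0 //; first by move=> i /ltnW; apply: h.
by rewrite polyorder.size_deriv; case: (size q) sq.
Qed.

Lemma dvdp_exp_derivn p q m n : q ^+ (m + n) %| p -> q ^+ m %| p^`(n).
Proof.
elim: n m => [|n IH] m; first by rewrite addn0.
rewrite addnS -addSn => /IH /dvdpP [r /=].
move=> ->; rewrite derivM deriv_exp /= dvdp_add //.
  by rewrite exprS mulrA dvdp_mull.
by rewrite mulrnAr -mulrnAl dvdp_mull ?dvdp_mull.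
Qed.

Let rodrigues n a := (1 - 'X) ^+ a * ('X ^+ 2 - 1) ^+ n : {poly R}.

Lemma one_subX_neq0 : 1 - 'X != 0 :> {poly R}.
Proof. by rewrite -opprB oppr_eq0 polyXsubC_eq0. Qed.

Lemma size_one_subX_exp a : size ((1 - 'X) ^+ a : {poly R}) = a.+1.
Proof.
by rewrite -opprB exprNn size_Msign size_exp_XsubC.
Qed.

Lemma size_X2_sub1_exp n : size (('X ^+ 2 - 1) ^+ n : {poly R}) = (2 * n).+1.
Proof.
have -> : 'X ^+ 2 - 1 = ('X - 1%:P) * ('X - (-1)%:P) :> {poly R}.
  by rewrite rmorphN rmorph1; ring.
rewrite exprMn size_mul ?expf_neq0 ?polyXsubC_eq0 // !size_exp_XsubC; lia.
Qed.

(** The division in Rodrigues' formula is exact: [(1 - 'X) ^+ (a + n)] divides the differentiated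
    product, and each of the [n] derivatives costs one factor. *)
Lemma jacobi_mul n a : (1 - 'X) ^+ a * jacobi R n a =
  ((2 ^ n * n`!)%N%:R)^-1 *: (rodrigues n a)^`(n).
Proof.
rewrite /jacobi -scalerAr mulrC divpK //.
apply: dvdp_exp_derivn; have -> : 'X ^+ 2 - 1 = (1 - 'X) * (-1 - 'X) :> {poly R}.
  by ring.
rewrite exprMn mulrA -exprD.
exact: dvdp_mulIl.
Qed.

Lemma size_jacobi n a : size (jacobi R n a) = n.+1.
Proof.
have s1 : size (rodrigues n a) = (2 * n + a).+1.
  rewrite size_mul ?expf_neq0 ?one_subX_neq0 //; last first.
    by rewrite -size_poly_eq0 -[_ - _]expr1 size_X2_sub1_exp.
  by rewrite size_one_subX_exp size_X2_sub1_exp; lia.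
have s2 m p : size p^`(m) = (size p - m)%N.
  elim: m => [|m IH]; first by rewrite subn0.
  by rewrite derivnS polyorder.size_deriv IH subnS.
have := congr1 (size \o @polyseq _) (jacobi_mul n a) => /=.
rewrite size_scale // s2 s1 => e.
have j0 : jacobi R n a != 0.
  by apply: contra_eq_neq e => ->; rewrite mulr0 size_poly0; lia.
move: e; rewrite size_mul ?expf_neq0 ?one_subX_neq0 // size_one_subX_exp.
by move: (size (jacobi R n a)) => s; lia.
Qed.

(** Derivatives of order below [n] of the Rodrigues product keep a factor ['X ^+ 2 - 1], so they
    vanish at both ends. *)
Lemma jacobi_orthogonal n a q : (size q <= n)%N ->
  pint ((1 - 'X) ^+ a * jacobi R n a * q) = 0.
Proof.
move=> sq; rewrite jacobi_mul -scalerAl pintZ pint_orthogonal_derivn ?mulr0 //.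
move=> i hi; have : 'X ^+ 2 - 1 %| (rodrigues n a)^`(i).
  have := @dvdp_exp_derivn (rodrigues n a) ('X ^+ 2 - 1) (n - i) i.
  rewrite subnK ?(ltnW hi) // dvdp_mull // => /(_ isT).
  by apply: dvdp_trans; rewrite dvdp_exp // subn_gt0.
move/dvdpP => [r ->]; rewrite !rootE !hornerE; apply/andP; split; apply/eqP; ring.
Qed.

Lemma ijacobiS_deriv n a : (ijacobi R n.+1 a)^`() = jacobi R n a.
Proof. by rewrite /= derivB derivC subr0 deriv_primitive. Qed.

Lemma ijacobiS_N1 n a : (ijacobi R n.+1 a).[-1] = 0.
Proof. by rewrite /= !hornerE subrr. Qed.

Lemma size_ijacobi n a : (size (ijacobi R n a) <= n.+1)%N.
Proof.
case: n => [|n]; first by rewrite size_poly1.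
have := polyorder.size_deriv (ijacobi R n.+1 a).
by rewrite ijacobiS_deriv size_jacobi; case: (size _) => [|[]] // m ->.
Qed.

(** The value at 1 is the integral of the Legendre polynomial of degree [n + 1], which is orthogonal
    to 1. *)
Lemma ijacobi0_1 n : (ijacobi R n.+2 0).[1] = 0.
Proof.
have := pint_deriv (ijacobi R n.+2 0).
rewrite ijacobiS_deriv ijacobiS_N1 subr0 => <-.
by rewrite -(@jacobi_orthogonal n.+1 0 1) ?size_poly1 // expr0 mul1r mulr1.
Qed.

(** With [q] written as a derivative, integration by parts leaves the Legendre polynomial of degree
    [n + 1] against a primitive of [q]; the boundary terms are 0. *)
Lemma ijacobi0_orthogonal n q : (size q <= n)%N ->
  pint (ijacobi R n.+2 0 * q) = 0.
Proof.
move=> sq; rewrite -[q]deriv_primitive mulrC pint_parts !hornerM ijacobi0_1.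
rewrite ijacobiS_N1 !mulr0 subrr sub0r ijacobiS_deriv mulrC.
rewrite -[X in X * _]mul1r -[X in X * _ * _](expr0 (1 - 'X)).
rewrite jacobi_orthogonal ?oppr0 //.
by rewrite (leq_trans (size_poly _ _)).
Qed.

(** Substituting [1 - 'X] for ['X] is an involution, so the powers of [1 - 'X] span. Testing with
    them keeps the Jacobi weight a pure power. *)
Lemma poly_one_subX_ind (P : {poly R} -> Prop) n :
  P 0 -> (forall p q, P p -> P q -> P (p + q)) ->
  (forall c p, P p -> P (c *: p)) ->
  (forall i, (i < n)%N -> P ((1 - 'X) ^+ i)) ->
  forall p, (size p <= n)%N -> P p.
Proof.
move=> P0 PD PZ PX p sp.
have -> : p = (p \Po (1 - 'X)) \Po (1 - 'X).
  by rewrite -comp_polyA comp_polyB comp_polyX comp_polyC opprB addrCA subrr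
    addr0 comp_polyXr.
rewrite comp_polyE; apply: (big_ind P) => // i _; apply: PZ; apply: PX.
by rewrite (leq_trans (ltn_ord i)) // size_comp_poly2 // -[_ - _]expr1
  size_one_subX_exp.
Qed.

(* [- (1 - 'X) ^+ (a.+1 + i) / (a.+1 + i)] is a primitive of
   [(1 - 'X) ^+ (a + i)] divisible by the weight of the Jacobi polynomial. *)
Lemma ijacobi_orthogonal n a q : (size q <= n)%N ->
  pint (ijacobi R n.+1 a.+1 * (1 - 'X) ^+ a * q) = 0.
Proof.
move: q; apply: poly_one_subX_ind; first by rewrite mulr0 pint0.
- by move=> p q hp hq; rewrite mulrDr pintD hp hq addr0.
- by move=> c p hp; rewrite -scalerAr pintZ hp mulr0.
move=> i hi; rewrite -mulrA -exprD.
have -> : (1 - 'X) ^+ (a + i) =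
    (- ((a + i).+1%:R)^-1) *: ((1 - 'X) ^+ (a + i).+1)^`() :> {poly R}.
  rewrite deriv_exp derivB derivX -[X in (X^`())]polyC1 derivC sub0r /=.
  rewrite mulN1r mulNrn scalerN scaleNr opprK -[_ ^+ _ *+ _]scaler_nat scalerA mulVf ?scale1r //.
rewrite -scalerAr mulrC pintZ pint_parts !hornerM ijacobiS_N1 mulr0 subr0.
rewrite ijacobiS_deriv horner_exp !hornerE subrr expr0n mul0r sub0r.
rewrite -addSn exprD -mulrA [_ * jacobi _ _ _]mulrC mulrA jacobi_orthogonal.
  by rewrite oppr0 mulr0.
by rewrite size_one_subX_exp.
Qed.

End Univariate.

(** * Homogenised univariate polynomials *)

Section ScaledPolynomials.
Variables (R : realType) (d : nat).
Implicit Types (p q : {poly R}) (a b : mpoly d R).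

Lemma mpolyC_scale c a : mpolyC d c * a = c *: a.
Proof. by rewrite mul_mpolyC. Qed.

Lemma scaled_linear c p q i a b :
  scaled (c *: p + q) i a b = c *: scaled p i a b + scaled q i a b.
Proof.
rewrite /scaled scaler_sumr -big_split; apply: eq_bigr => m _ /=.
by rewrite coefD coefZ mpolyCD mpolyCM mpolyC_scale !mulrDl -!scalerAl.
Qed.

Lemma scaled0 i a b : scaled 0 i a b = 0.
Proof. by rewrite /scaled big1 // => m _; rewrite coef0 mpolyC0 !mul0r. Qed.

Lemma scaledD p q i a b : scaled (p + q) i a b = scaled p i a b + scaled q i a b.
Proof. by rewrite -[p]scale1r scaled_linear !scale1r. Qed.

Lemma scaledZ c p i a b : scaled (c *: p) i a b = c *: scaled p i a b.
Proof. by rewrite -[c *: p]addr0 scaled_linear scaled0 addr0. Qed.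

Lemma scaledB p q i a b : scaled (p - q) i a b = scaled p i a b - scaled q i a b.
Proof. by rewrite -scaleN1r scaledD scaledZ scaleN1r. Qed.

Lemma scaledXn m i a b : (m <= i)%N ->
  scaled 'X^m i a b = a ^+ m * b ^+ (i - m).
Proof.
move=> mi; rewrite /scaled (bigD1 (Ordinal (mi : (m < i.+1)%N))) //= big1.
  by rewrite coefXn eqxx mpolyC1 mul1r addr0.
move=> j /negPf; rewrite -val_eqE /= => jm.
by rewrite coefXn jm mpolyC0 !mul0r.
Qed.

Lemma poly_Xn_ind (P : {poly R} -> Prop) n :
  P 0 -> (forall p q, P p -> P q -> P (p + q)) ->
  (forall c p, P p -> P (c *: p)) ->
  (forall i, (i < n)%N -> P 'X^i) ->
  forall p, (size p <= n)%N -> P p.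
Proof.
move=> P0 PD PZ PX p sp; rewrite -[p]coefK poly_def.
by apply: (big_ind P) => // i _; apply/PZ/PX/(leq_trans (ltn_ord i)).
Qed.

Lemma scaledM p q i j a b : (size p <= i.+1)%N -> (size q <= j.+1)%N ->
  scaled (p * q) (i + j) a b = scaled p i a b * scaled q j a b.
Proof.
move=> sp sq; move: p sp; apply: poly_Xn_ind.
- by rewrite mul0r !scaled0 mul0r.
- by move=> p p' hp hp'; rewrite mulrDl !scaledD hp hp' mulrDl.
- by move=> c p hp; rewrite -scalerAl !scaledZ hp scalerAl.
move=> m; rewrite ltnS => mi; move: q sq; apply: poly_Xn_ind.
- by rewrite mulr0 !scaled0 mulr0.
- by move=> p p' hp hp'; rewrite mulrDr !scaledD hp hp' mulrDr.
- by move=> c p hp; rewrite -scalerAr !scaledZ hp scalerAr.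
move=> n; rewrite ltnS => nj; rewrite -exprD !scaledXn ?leq_add //.
by rewrite mulrACA -!exprD; congr (_ * _ ^+ _); lia.
Qed.

Lemma scaled1 i a b : scaled 1 i a b = b ^+ i.
Proof. by rewrite -(expr0 'X) scaledXn // mul1r subn0. Qed.

Lemma scaledX a b : scaled 'X 1 a b = a.
Proof. by rewrite -['X]expr1 scaledXn // expr1 subnn mulr1. Qed.

Lemma scaled_raise p i m a b : (size p <= i.+1)%N ->
  scaled p (i + m) a b = scaled p i a b * b ^+ m.
Proof. by move=> sp; rewrite -[p in LHS]mulr1 scaledM ?size_poly1 // scaled1. Qed.

(** The ratio is given as a factor [c] instead of a quotient, so that points with [b = 0] are
    covered, in contrast with [scaledE]. *)
Lemma peval_scaled p i a b x c : (size p <= i.+1)%N ->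
  peval a x = c * peval b x ->
  peval (scaled p i a b) x = p.[c] * peval b x ^+ i.
Proof.
move=> sp ab; rewrite (horner_coef_wide _ sp) mulr_suml /peval /scaled raddf_sum.
apply: eq_bigr => m _; rewrite /= !mevalM !rmorphXn /= mevalC.
move: ab; rewrite /peval => ->.
have mi : (m <= i)%N by rewrite -ltnS.
by rewrite exprMn -!mulrA -exprD subnKC.
Qed.

(** Chain rule for [p(a / b) b ^ (i + 1)]: the factor of [db] is the Euler combination
    [(i + 1) p - t p'] at [t = a / b]. It is checked on powers of ['X], hence without division. *)
Lemma mderiv_scaled l p i a b : (size p <= i.+2)%N ->
  mderiv l (scaled p i.+1 a b) =
  scaled p^`() i a b * mderiv l a +
  scaled (i.+1%:R *: p - 'X * p^`()) i a b * mderiv l b.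
Proof.
move: p; apply: poly_Xn_ind.
- by rewrite deriv0 mulr0 scaler0 subr0 !scaled0 !mul0r mderiv0 addr0.
- move=> p q hp hq; rewrite scaledD mderivD hp hq derivD mulrDr scalerDr opprD.
  by rewrite [X in _ = _ + scaled X _ _ _ * _]addrACA !scaledD !mulrDl addrACA.
- move=> c p hp; rewrite scaledZ mderivZ hp derivZ scalerA [_ * c]mulrC -scalerA.
  by rewrite -scalerAr -scalerBr !scaledZ -!scalerAl scalerDr.
move=> m; rewrite ltnS => mi; rewrite derivXn scaledXn // mderivM.
have mderiv_exp (c : mpoly d R) n : mderiv l (c ^+ n) = c ^+ n.-1 * mderiv l c *+ n.
  elim: n => [|n IH]; first by rewrite expr0 mderivC.
  rewrite exprS mderivM IH /= mulrnAr mulrA; case: n {IH} => [|n] /=.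
    rewrite !expr0 !mulr1 mul1r mulr0n addr0.  by rewrite mulr1n.
  by rewrite -exprS mulrC -mulrS.
rewrite !mderiv_exp; case: m mi => [|m] mi.
  rewrite !mulr0n scaled0 mulr0 subr0 !mul0r !add0r expr0 subn0 mul1r /=.
  by rewrite scaledZ scaled1 -scalerAl scaler_nat.
rewrite [m.+1.-1]/=.
have -> : i.+1%:R *: 'X^(m.+1) - 'X * ('X^m *+ m.+1) =
    (i - m)%:R *: 'X^(m.+1) :> {poly R}.
  by rewrite mulrnAr -exprS -['X^(m.+1) *+ _]scaler_nat -scalerBl -natrB // subSS.
rewrite -['X^m *+ _]scaler_nat !scaledZ scaledXn //.
rewrite subSS mulrnAl mulrAC -!scalerAl !scaler_nat; congr (_ + _).
have [mm|mm] := leqP i m.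
  by rewrite (_ : i - m = 0)%N ?mulr0n ?mulr0 //; lia.
by rewrite scaledXn // mulrnAr mulrA; congr (_ * _ ^+ _ * _ *+ _); lia.
Qed.

End ScaledPolynomials.

(** * Bernstein polynomials and their integrals *)

Section Bernstein.
Variable R : realType.
Implicit Types p q : {poly R}.

(** Homogenised with the ratio [(y - x) / (y + x)] this becomes the monomial [x ^ a y ^ b]; it links
    barycentric monomials to integrals over [[-1, 1]]. *)
Definition bernstein a b : {poly R} :=
  (2^-1 *: (1 - 'X)) ^+ a * (2^-1 *: (1 + 'X)) ^+ b.

(** For [s = (1 - 'X) / 2] and [t = (1 + 'X) / 2] one has [s + t = 1] and [t - s = 'X], so degree
    [n + 1] is reached from degree [n] by multiplication with [s] and [t]. *)
Lemma poly_bernstein_ind (P : {poly R} -> Prop) n :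
  P 0 -> (forall p q, P p -> P q -> P (p + q)) ->
  (forall c p, P p -> P (c *: p)) ->
  (forall a b, (a + b)%N = n -> P (bernstein a b)) ->
  forall p, (size p <= n.+1)%N -> P p.
Proof.
elim: n P => [|n IH] P P0 PD PZ PB p sp.
  by rewrite (size1_polyC sp) -alg_polyC; apply/PZ; have := PB 0%N 0%N erefl;
     rewrite /bernstein !expr0 mulr1.
have PN q : P q -> P (- q) by move/(PZ (-1)); rewrite scaleN1r.
have P2 q : (size q <= n.+1)%N ->
    P (q * (2^-1 *: (1 - 'X))) /\ P (q * (2^-1 *: (1 + 'X))).
  move: q; apply: IH.
  - by rewrite !mul0r.
  - by move=> q r [q1 q2] [r1 r2]; rewrite !mulrDl; split; exact: PD.
  - by move=> c q [q1 q2]; rewrite -!(scalerAl c q); split; exact: PZ.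
  move=> a b ab; split.
    by rewrite /bernstein mulrAC -exprSr; apply: PB; rewrite addSn ab.
  by rewrite /bernstein -mulrA -exprSr; apply: PB; rewrite addnS ab.
have Psmall q : (size q <= n.+1)%N -> P q /\ P (q * 'X).
  move=> /P2[q1 q2]; split.
    have -> : q = q * (2^-1 *: (1 - 'X)) + q * (2^-1 *: (1 + 'X)).
      rewrite -mulrDr -scalerDr (_ : 1 - 'X + (1 + 'X) = 2%:R *: 1).
        by rewrite scalerA mulVf ?pnatr_eq0 // scale1r mulr1.
      by rewrite scaler_nat; ring.
    exact: PD.
  have -> : q * 'X = q * (2^-1 *: (1 + 'X)) - q * (2^-1 *: (1 - 'X)).
    rewrite -mulrBr -scalerBr (_ : 1 + 'X - (1 - 'X) = 2%:R *: 'X).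
      by rewrite scalerA mulVf ?pnatr_eq0 // scale1r.
    by rewrite scaler_nat; ring.
  by apply: PD => //; apply: PN.
have -> : p = drop_poly 1 p * 'X + take_poly 1 p.
  by rewrite addrC -{1}[p](poly_take_drop 1) expr1.
apply: PD.
  by apply: (Psmall _ _).2; rewrite size_drop_poly; lia.
by apply: (Psmall _ _).1; rewrite (leq_trans (size_take_poly _ _)).
Qed.

(** Twice Euler's beta integral. Integration by parts trades a factor [1 - 'X] for a factor
    [1 + 'X], down to [a = 0]. *)
Lemma pint_bernstein a b :
  pint (bernstein a b) = (a`! * b`!)%:R * 2 / ((a + b).+1)`!%:R.
Proof.
have fn0 n : n`!%:R != 0 :> R by rewrite pnatr_eq0 -lt0n fact_gt0.
have dB n : (2^-1 *: (1 + 'X)) ^+ n =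
    (2 / n.+1%:R) *: ((2^-1 *: (1 + 'X)) ^+ n.+1)^`() :> {poly R}.
  rewrite deriv_exp derivZ derivD derivX -[X in X^`()]polyC1 derivC add0r.
  rewrite -[_ * _ *+ _]scaler_nat -scalerAl mul1r !scalerA -[LHS]scale1r /=.
  by congr (_ *: _); rewrite divfK ?pnatr_eq0 // mulfV ?pnatr_eq0.
elim: a b => [|a IH] b.
  rewrite /bernstein expr0 mul1r dB pintZ pint_deriv !horner_exp !hornerE.
  rewrite subrr mulr0 expr0n subr0 ?add0n ?fact0 ?mul1n factS natrM.
  have -> : 2^-1 * (1 + 1) = 1 :> R by lra.
  by rewrite expr1n mulr1; field; rewrite fn0 nat1r pnatr_eq0.
have dA : ((2^-1 *: (1 - 'X)) ^+ a.+1)^`() =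
    (- (a.+1%:R / 2)) *: (2^-1 *: (1 - 'X)) ^+ a :> {poly R}.
  rewrite deriv_exp derivZ derivB derivX -[X in X^`() - _]polyC1 derivC sub0r /=.
  rewrite -[_ * _ *+ _]scaler_nat scalerN mulNr scalerN -scalerAl mul1r scalerA.
  by rewrite scaleNr.
have -> : pint (bernstein a.+1 b) = a.+1%:R / b.+1%:R * pint (bernstein a b.+1).
  rewrite /bernstein [in LHS]dB -scalerAr pintZ [_ ^+ a.+1 * _]mulrC pint_parts.
  rewrite !hornerM !horner_exp !hornerE !subrr !mulr0 !exprS !mul0r mulr0 subrr sub0r.
  rewrite -[X in pint (_ * X^`())]exprS dA -scalerAr pintZ -exprS [_ ^+ a * _]mulrC.
  by field; rewrite nat1r pnatr_eq0.
rewrite IH addSnnS !factS !natrM; field.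
by rewrite fn0 nat1r -natrD nat1r !pnatr_eq0.
Qed.

End Bernstein.

(** * Linear functionals with Dirichlet moments *)

Section Polar.
Variables (R : realType) (d : nat) (L : mpoly d R -> R).
Implicit Types p q : {poly R}.
Hypothesis LD : forall f g, L (f + g) = L f + L g.
Hypothesis LZ : forall c f, L (c *: f) = c * L f.

Let L0 : L 0 = 0.
Proof. by rewrite -[0](scale0r 0) LZ mul0r. Qed.

Lemma scaled_bernstein m n (x y : mpoly d R) :
  scaled (bernstein R m n) (m + n) (y - x) (y + x) = x ^+ m * y ^+ n.
Proof.
have lin s (z : {poly R}) : (size z <= 2)%N -> (size (z ^+ s) <= s.+1)%N.
  move=> sz; rewrite (leq_trans (size_poly_exp_leq _ _)) // ltnS.
  by rewrite -[X in (_ <= X)%N]mul1n leq_mul2r; case: (size z) sz => [|[|[]]]; rewrite ?orbT.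
have powS s (z : {poly R}) (a b : mpoly d R) : (size z <= 2)%N ->
    scaled (z ^+ s) s a b = scaled z 1 a b ^+ s.
  move=> sz; elim: s => [|s IH]; first by rewrite expr0 scaled1 !expr0.
  by rewrite exprS -add1n scaledM ?lin // IH exprS.
have s2 c : (size (c *: (1 - 'X) : {poly R}) <= 2)%N.
  by rewrite (leq_trans (size_scale_leq _ _)) // -[_ - _]expr1 size_one_subX_exp.
have s2' c : (size (c *: (1 + 'X) : {poly R}) <= 2)%N.
  by rewrite (leq_trans (size_scale_leq _ _)) // addrC -polyC1 size_XaddC.
rewrite scaledM ?lin // !powS //.
rewrite !scaledZ scaledB scaledD scaled1 scaledX expr1.
have -> : y + x - (y - x) = 2%:R *: x by rewrite scaler_nat mulr2n; ring.
have -> : y + x + (y - x) = 2%:R *: y by rewrite scaler_nat mulr2n; ring.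
by rewrite !scalerA mulVf ?scale1r // pnatr_eq0.
Qed.

(** An algebraic passage to the coordinates [x1 + x2] and [(x2 - x1) / (x2 + x1)]. With [L], [y] and
    [w] abstract it serves integrals over facets and over elements alike. *)
Lemma linear_polar2 (x1 x2 y : mpoly d R) (w : nat -> R) :
  (forall m n, L (x1 ^+ m * x2 ^+ n * y) = (m`! * n`!)%:R * w (m + n)%N) ->
  forall p N, (size p <= N.+1)%N ->
  L (scaled p N (x2 - x1) (x2 + x1) * y) = pint p * ((N.+1)`!%:R / 2 * w N).
Proof.
move=> H p N; move: p; apply: poly_bernstein_ind.
- by rewrite scaled0 mul0r L0 pint0 mul0r.
- by move=> p q hp hq; rewrite scaledD mulrDl LD hp hq pintD [RHS]mulrDl.
- by move=> c p hp; rewrite scaledZ -scalerAl LZ hp pintZ mulrA.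
move=> m n <-; rewrite scaled_bernstein H pint_bernstein.
have fn0 : (m + n).+1`!%:R != 0 :> R by rewrite pnatr_eq0 -lt0n fact_gt0.
by field.
Qed.

(** Duffy's collapsed coordinates. In the weight [((1 - t) / 2) ^ (N + 1)] the power [N] comes from
    the degree of the first form in [x1 + x2], the last factor from the Jacobian of the collapse. *)
Lemma linear_polar3 (x1 x2 x3 y : mpoly d R) (w : nat -> R) :
  (forall m n l, L (x1 ^+ m * x2 ^+ n * x3 ^+ l * y) =
     (m`! * n`! * l`!)%:R * w (m + n + l)%N) ->
  forall p N q M, (size p <= N.+1)%N -> (size q <= M.+1)%N ->
  L (scaled p N (x2 - x1) (x2 + x1) *
     scaled q M (x3 - x2 - x1) (x3 + x2 + x1) * y) =
  pint p * pint ((2^-1 *: (1 - 'X)) ^+ N.+1 * q) *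
  ((N + M).+2`!%:R / 4 * w (N + M)%N).
Proof.
move=> H p N q M sp; move: q; apply: poly_bernstein_ind.
- by rewrite scaled0 mulr0 mul0r L0 mulr0 pint0 mulr0 mul0r.
- move=> q r hq hr.
  by rewrite scaledD mulrDr mulrDl LD hq hr [_ ^+ _ * (q + r)]mulrDr pintD; ring.
- move=> c q hq.
  by rewrite scaledZ -scalerAr -scalerAl LZ hq -[_ ^+ _ * (c *: q)]scalerAr pintZ; ring.
move=> m n <-; rewrite (_ : x3 - x2 - x1 = x3 - (x2 + x1)); last by ring.
(* The Bernstein polynomial has become [(x2 + x1) ^ m x3 ^ n]; its first factor raises the degree of
   the inner form to [N + m], which leaves the case of two coordinates. *)
rewrite -addrA scaled_bernstein mulrA -scaled_raise // -mulrA.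
rewrite (@linear_polar2 _ _ _ (fun l => n`!%:R * w (l + n)%N)); last first.
- by rewrite (leq_trans sp) // ltnS leq_addr.
- by move=> a b; rewrite mulrA H !natrM !mulrA.
rewrite addnA [_ ^+ N.+1 * _]mulrA -exprD -/(bernstein R _ _) pint_bernstein natrM.
rewrite (_ : (N.+1 + m + n).+1 = (N + m + n).+2)%N //.
have fn0 : (N + m + n).+2`!%:R != 0 :> R by rewrite pnatr_eq0 -lt0n fact_gt0.
by rewrite addSn; field.
Qed.

End Polar.

(** * Integration over simplices *)

Section ReferenceIntegral.
Variable R : realType.
Let mu := @lebesgue_measure R.

Lemma Rintegral_horner (p : {poly R}) r : 0 <= r ->
  \int[mu]_(t in `[0, r]) p.[t] = (primitive p).[r] - (primitive p).[0].
Proof.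
rewrite le_eqVlt => /orP[/eqP <-|r0].
  by rewrite set_itv1 Rintegral_set1 subrr.
rewrite /Rintegral (@continuous_FTC2 _ _ (horner (primitive p))) //.
- by apply: continuous_subspaceT => x; exact: continuous_horner.
- split.
  + by move=> x _; exact: derivable_horner.
  + by apply: cvg_at_right_filter; exact: continuous_horner.
  + by apply: cvg_at_left_filter; exact: continuous_horner.
- by move=> x _; rewrite -derive.derivE deriv_primitive.
Qed.

Lemma Rintegral_beta m n (r : R) : 0 <= r ->
  \int[mu]_(t in `[0, r]) (t ^+ m * (r - t) ^+ n) =
  (m`! * n`!)%:R / (m + n).+1`!%:R * r ^+ (m + n).+1.
Proof.
have fn0 l : l`!%:R != 0 :> R by rewrite pnatr_eq0 -lt0n fact_gt0.
pose pol a b : {poly R} := 'X^a * (r%:P - 'X) ^+ b.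
have polyE a b : (fun t => t ^+ a * (r - t) ^+ b) = horner (pol a b).
  by apply/funext => t; rewrite /pol !hornerE.
move=> r0; elim: n m => [|n IH] m.
  rewrite (_ : (fun t => _) = horner ((m.+1%:R)^-1 *: 'X^(m.+1))^`()).
    rewrite Rintegral_horner // (@deriv_eq_hornerB _ _ ((m.+1%:R)^-1 *: 'X^(m.+1))).
      rewrite !hornerE expr0n /= mulr0 subr0 ?addn0 ?fact0 ?muln1 factS natrM.
      by congr (_ * _); field; rewrite fn0 nat1r pnatr_eq0.
    by rewrite deriv_primitive.
  apply/funext => t; rewrite derivZ derivXn /= !hornerE ?expr0 ?mulr1 hornerMn hornerXn -[_ ^+ _ *+ _]mulr_natl mulrA.
  by rewrite mulVf ?mul1r // pnatr_eq0.
have := IH m.+1; rewrite !polyE.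
rewrite (Rintegral_horner (pol m.+1 n) r0) (Rintegral_horner (pol m n.+1) r0) => IHm.
have polS : pol m n.+1 = (m.+1%:R)^-1 *:
    (n.+1%:R *: pol m.+1 n + (pol m.+1 n.+1)^`()).
  rewrite /pol derivM !deriv_exp derivB derivC !derivX sub0r mul1r /=.
  rewrite -['X^m *+ _]scaler_nat -[_ * _ *+ n.+1]scaler_nat.
  rewrite mulN1r scalerN mulrN -scalerAr addrCA subrr addr0 -scalerAl scalerA.
  by rewrite mulVf ?scale1r // pnatr_eq0.
rewrite (@deriv_eq_hornerB _ _ ((m.+1%:R)^-1 *:
   (n.+1%:R *: primitive (pol m.+1 n) + pol m.+1 n.+1))); last first.
  by rewrite deriv_primitive polS derivZ derivD derivZ deriv_primitive.
rewrite [pol m.+1 n.+1]/pol !(hornerZ, hornerD, hornerM, hornerXn, horner_exp, hornerC, hornerN, hornerX).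
rewrite subrr !expr0n /= mulr0 mul0r !addr0 -mulrBr -mulrBr IHm addSnnS !factS !natrM.
by field; rewrite !nat1r fn0 -natrD nat1r !pnatr_eq0.
Qed.

Variable d : nat.
Implicit Types (E : seq 'rV[R]_d) (f g : 'rV[R]_d -> R).

Let param E (x : 'rV[R]_d) (t : nat -> R) := x + \sum_(j < size E) t j *: E`_j.

Let param_cons e E x (t : nat -> R) (t0 : R) :
  param E (x + t0 *: e) t = param (e :: E) x (fun j => if j is j'.+1 then t j' else t0).
Proof. by rewrite /param /= big_ord_recl /= addrA. Qed.

Lemma ref_integral_eq E (r : R) x f g : 0 <= r ->
  (forall t : nat -> R, (forall j, 0 <= t j) -> \sum_(j < size E) t j <= r ->
     f (param E x t) = g (param E x t)) ->
  ref_integral E r x f = ref_integral E r x g.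
Proof.
elim: E r x => [|e E IH] r x r0 fg /=.
  have := fg (fun=> 0) (fun=> lexx 0); rewrite /param /= !big_ord0 addr0.
  exact.
apply: eq_Rintegral => t; rewrite inE /= in_itv /= => /andP[t0 tr].
apply: IH => [|u u0 ur]; first by rewrite subr_ge0.
rewrite param_cons; apply: fg => [[|j]//|].
by rewrite big_ord_recl /= -lerBrDl.
Qed.

Lemma ref_integral_ge0 E (r : R) x f : 0 <= r ->
  (forall t : nat -> R, (forall j, 0 <= t j) -> \sum_(j < size E) t j <= r ->
     0 <= f (param E x t)) ->
  0 <= ref_integral E r x f.
Proof.
elim: E r x => [|e E IH] r x r0 f0 /=.
  have := f0 (fun=> 0) (fun=> lexx 0); rewrite /param /= !big_ord0 addr0.
  exact.
apply: Rintegral_ge0 => t; rewrite /= in_itv /= => /andP[t0 tr].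
apply: IH => [|u u0 ur]; first by rewrite subr_ge0.
rewrite param_cons; apply: f0 => [[|j]//|].
by rewrite big_ord_recl /= -lerBrDl.
Qed.

(** Dirichlet's formula, with one Lebesgue integral per edge; [e] holds the exponents along the
    edges and [b] that of the base vertex. A whole combination is treated at once: by induction the
    inner integral is a polynomial [P] in the outer variable, to which the fundamental theorem
    applies. *)
Lemma ref_integral_monomials (I : Type) (s : seq I) (c : I -> R)
  (e : I -> nat -> nat) (b : I -> nat) E (r : R) x f : 0 <= r ->
  (forall t : nat -> R, (forall j, 0 <= t j) -> \sum_(j < size E) t j <= r ->
     f (param E x t) = \sum_(i <- s) c i *
       ((\prod_(j < size E) t j ^+ e i j) * (r - \sum_(j < size E) t j) ^+ b i)) ->
  ref_integral E r x f = \sum_(i <- s) c i *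
    (((\prod_(j < size E) (e i j)`!) * (b i)`!)%:R /
      ((\sum_(j < size E) e i j) + b i + size E)`!%:R) *
    r ^+ ((\sum_(j < size E) e i j) + b i + size E).
Proof.
elim: E c e r x => [|v E IH] c e r x r0 H.
  have := H (fun=> 0) (fun=> lexx 0); rewrite /param /= !big_ord0 addr0.
  move=> /(_ r0) ->; apply: eq_bigr => i _; rewrite !big_ord0 !mul1n subr0 mul1r.
  by rewrite add0n addn0 mulfV ?mulr1 // pnatr_eq0 -lt0n fact_gt0.
pose w i := ((\sum_(j < size E) e i j.+1) + b i + size E)%N.
pose K i : R := ((\prod_(j < size E) (e i j.+1)`!) * (b i)`!)%:R / (w i)`!%:R.
pose P : {poly R} := \sum_(i <- s) (c i * K i) *: ('X^(e i 0%N) * (r%:P - 'X) ^+ w i).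
have inner (t : R) : 0 <= t -> t <= r -> ref_integral E (r - t) (x + t *: v) f = P.[t].
  move=> t0 tr; rewrite (IH (fun i => c i * t ^+ e i 0%N) (fun i j => e i j.+1)).
  - rewrite /P horner_sum; apply: eq_bigr => i _; rewrite -/(w i) -/(K i).
    rewrite !(hornerZ, hornerM, horner_exp, hornerXn, hornerD, hornerN, hornerC, hornerX).
    by ring.
  - by rewrite subr_ge0.
  move=> u u0 ur; rewrite param_cons H => [|[|j]//|]; last first.
    by rewrite big_ord_recl /= -lerBrDl.
  apply: eq_bigr => i _; rewrite big_ord_recl /= big_ord_recl /= opprD addrA.
  by rewrite !mulrA.
have -> : ref_integral (v :: E) r x f = \int[mu]_(t in `[0, r]) P.[t].
  apply: eq_Rintegral => t; rewrite inE /= in_itv /= => /andP[t0 tr].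
  exact: inner.
rewrite Rintegral_horner //.
rewrite (@deriv_eq_hornerB _ _ (\sum_(i <- s)
   (c i * K i) *: primitive ('X^(e i 0%N) * (r%:P - 'X) ^+ w i))); last first.
  rewrite deriv_primitive raddf_sum; apply: eq_bigr => i _ /=.
  by rewrite derivZ deriv_primitive.
rewrite !horner_sum -sumrB; apply: eq_bigr => i _.
rewrite !hornerZ -mulrBr -(Rintegral_horner ('X^(e i 0%N) * (r%:P - 'X) ^+ w i) r0).
rewrite (_ : Rintegral _ _ _ =
    \int[mu]_(t in `[0, r]) (t ^+ e i 0%N * (r - t) ^+ w i)); last first.
  apply: eq_Rintegral => t _.
  by rewrite !(hornerM, horner_exp, hornerXn, hornerD, hornerN, hornerC, hornerX).
rewrite Rintegral_beta // /K !big_ord_recl /=.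
have fn0 l : l`!%:R != 0 :> R by rewrite pnatr_eq0 -lt0n fact_gt0.
rewrite (_ : (e i 0%N + \sum_(j < size E) e i (lift ord0 j) + b i + (size E).+1 =
  (e i 0%N + w i).+1)%N); last by rewrite /w addnS !addnA.
rewrite !natrM; by field; rewrite !fn0 -natrD nat1r pnatr_eq0.
Qed.

End ReferenceIntegral.

(** * Euclidean inner product and norm *)

Section EuclideanDot.
Variables (R : realType) (d : nat).
Implicit Types x y z : 'rV[R]_d.

Lemma dotC x y : dot x y = dot y x.
Proof. by apply: eq_bigr => i _; rewrite mulrC. Qed.

Lemma dotDl x y z : dot (x + y) z = dot x z + dot y z.
Proof. by rewrite -big_split; apply: eq_bigr => i _ /=; rewrite !mxE mulrDl. Qed.

Lemma dotZl c x y : dot (c *: x) y = c * dot x y.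
Proof. by rewrite mulr_sumr; apply: eq_bigr => i _ /=; rewrite !mxE mulrA. Qed.

Lemma dotNl x y : dot (- x) y = - dot x y.
Proof. by rewrite -scaleN1r dotZl mulN1r. Qed.

Lemma dotBl x y z : dot (x - y) z = dot x z - dot y z.
Proof. by rewrite dotDl dotNl. Qed.

Lemma dotDr x y z : dot x (y + z) = dot x y + dot x z.
Proof. by rewrite !(dotC x) dotDl. Qed.

Lemma dotZr c x y : dot x (c *: y) = c * dot x y.
Proof. by rewrite !(dotC x) dotZl. Qed.

Lemma dotNr x y : dot x (- y) = - dot x y.
Proof. by rewrite !(dotC x) dotNl. Qed.

Lemma dotBr x y z : dot x (y - z) = dot x y - dot x z.
Proof. by rewrite dotDr dotNr. Qed.

Lemma dot0l x : dot 0 x = 0.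
Proof. by rewrite -(scale0r 0) dotZl mul0r. Qed.

Lemma dot_suml (I : Type) (r : seq I) (P : pred I) (F : I -> 'rV[R]_d) y :
  dot (\sum_(i <- r | P i) F i) y = \sum_(i <- r | P i) dot (F i) y.
Proof.
by apply: (big_morph (fun x => dot x y)) => [? ?|]; rewrite ?dotDl ?dot0l.
Qed.

Lemma dot_ge0 x : 0 <= dot x x.
Proof. by apply: sumr_ge0 => i _; rewrite -expr2 sqr_ge0. Qed.

Lemma enorm_ge0 x : 0 <= enorm x.
Proof. exact: sqrtr_ge0. Qed.

Lemma enorm_sqr x : enorm x ^+ 2 = dot x x.
Proof. by rewrite sqr_sqrtr // dot_ge0. Qed.

Lemma enormN x : enorm (- x) = enorm x.
Proof. by rewrite /enorm dotNl dotNr opprK. Qed.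

Lemma enormZ c x : enorm (c *: x) = `|c| * enorm x.
Proof. by rewrite /enorm dotZl dotZr mulrA sqrtrM ?sqr_ge0 // -expr2 sqrtr_sqr. Qed.

Lemma dot_eq0 x : dot x x = 0 -> x = 0.
Proof.
move/eqP; rewrite psumr_eq0 => [|i _]; last by rewrite -expr2 sqr_ge0.
move/allP => h; apply/rowP => i; rewrite mxE.
by have := h i (mem_index_enum i); rewrite mulf_eq0 orbb => /eqP.
Qed.

Lemma cauchy_schwarz x y : dot x y ^+ 2 <= dot x x * dot y y.
Proof.
have [/dot_eq0 ->|y0] := eqVneq (dot y y) 0.
  by rewrite dotC dot0l expr0n mulr_ge0 ?dot_ge0.
have yp : 0 < dot y y by rewrite lt_neqAle eq_sym y0 dot_ge0.
have := dot_ge0 (dot y y *: x - dot x y *: y).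
rewrite !(dotBl, dotBr, dotZl, dotZr) (dotC y x) => h.
rewrite -(ler_pM2l yp) -subr_ge0; apply: le_trans h _.
rewrite le_eqVlt; apply/orP; left; apply/eqP; ring.
Qed.

Lemma dot_le_enorm x y : `|dot x y| <= enorm x * enorm y.
Proof.
rewrite -ler_sqr ?nnegrE ?mulr_ge0 ?enorm_ge0 //.
by rewrite real_normK ?num_real // exprMn !enorm_sqr cauchy_schwarz.
Qed.

Lemma enormD x y : enorm (x + y) <= enorm x + enorm y.
Proof.
rewrite -ler_sqr ?nnegrE ?addr_ge0 ?enorm_ge0 // sqrrD !enorm_sqr.
rewrite dotDl !dotDr (dotC y x).
have := le_trans (ler_norm _) (dot_le_enorm x y).
set a := enorm x * enorm y; lra.
Qed.

Lemma coord_le_enorm x i : `|x 0 i| <= enorm x.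
Proof.
rewrite -ler_sqr ?nnegrE ?enorm_ge0 // enorm_sqr real_normK ?num_real //.
rewrite /dot (bigD1 i) //= -expr2 lerDl sumr_ge0 // => j _.
by rewrite -expr2 sqr_ge0.
Qed.

End EuclideanDot.

(** * Evaluation and degree of polynomials in several variables *)

Section MultivariatePolynomials.
Variables (R : realType) (d : nat).
Implicit Types (p q : mpoly d R) (x y : 'rV[R]_d).

Lemma pevalD p q x : peval (p + q) x = peval p x + peval q x.
Proof. exact: mevalD. Qed.
Lemma pevalN p x : peval (- p) x = - peval p x.
Proof. exact: mevalN. Qed.
Lemma pevalB p q x : peval (p - q) x = peval p x - peval q x.
Proof. exact: mevalB. Qed.
Lemma pevalM p q x : peval (p * q) x = peval p x * peval q x.
Proof. exact: mevalM. Qed.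
Lemma pevalZ c p x : peval (c *: p) x = c * peval p x.
Proof. exact: mevalZ. Qed.
Lemma pevalC c x : peval (mpolyC d c) x = c.
Proof. exact: mevalC. Qed.
Lemma peval0 x : peval 0 x = 0.
Proof. exact: meval0. Qed.
Lemma peval1 x : peval 1 x = 1.
Proof. exact: meval1. Qed.
Lemma pevalX p n x : peval (p ^+ n) x = peval p x ^+ n.
Proof. by rewrite /peval rmorphXn. Qed.
Lemma pevalXU i x : peval (mpolyX R (mnm1 i)) x = x 0 i.
Proof. exact: mevalXU. Qed.

Lemma peval_sum (I : Type) (r : seq I) (P : pred I) (F : I -> mpoly d R) x :
  peval (\sum_(i <- r | P i) F i) x = \sum_(i <- r | P i) peval (F i) x.
Proof. by rewrite /peval raddf_sum. Qed.

Lemma peval_prod (I : Type) (r : seq I) (P : pred I) (F : I -> mpoly d R) x :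
  peval (\prod_(i <- r | P i) F i) x = \prod_(i <- r | P i) peval (F i) x.
Proof. by rewrite /peval rmorph_prod. Qed.

Definition pevalE := (pevalD, pevalB, pevalN, pevalM, pevalZ, pevalC, peval0,
  peval1, pevalX, pevalXU).

Lemma deg_lt_le m n p : (m <= n)%N -> deg_lt m p -> deg_lt n p.
Proof. by move=> mn h; apply: leq_trans h mn. Qed.

Lemma deg_lt0 m : @deg_lt R d m 0.
Proof. by rewrite /deg_lt msize0. Qed.

Lemma deg_ltC m (c : R) : deg_lt m.+1 (mpolyC d c).
Proof. by rewrite /deg_lt msizeC; case: eqP. Qed.

Lemma deg_ltD m p q : deg_lt m p -> deg_lt m q -> deg_lt m (p + q).
Proof.
by move=> hp hq; apply: leq_trans (msizeD_le _ _) _; rewrite geq_max; apply/andP.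
Qed.

Lemma deg_ltZ m c p : deg_lt m p -> deg_lt m (c *: p).
Proof. by move=> hp; apply: leq_trans (msizeZ_le _ _) hp. Qed.

Lemma deg_ltN m p : deg_lt m p -> deg_lt m (- p).
Proof. by rewrite -scaleN1r; apply: deg_ltZ. Qed.

Lemma deg_ltB m p q : deg_lt m p -> deg_lt m q -> deg_lt m (p - q).
Proof. by move=> hp hq; apply/deg_ltD/deg_ltN. Qed.

Lemma deg_lt_sum m (I : Type) (r : seq I) (P : pred I) (F : I -> mpoly d R) :
  (forall i, P i -> deg_lt m (F i)) -> deg_lt m (\sum_(i <- r | P i) F i).
Proof. by move=> h; apply: (big_ind _ (deg_lt0 m)) => // p q; apply: deg_ltD. Qed.

Lemma deg_ltM m n p q : deg_lt m.+1 p -> deg_lt n.+1 q ->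
  deg_lt (m + n).+1 (p * q).
Proof.
rewrite /deg_lt; have [->|p0] := eqVneq p 0; first by rewrite mul0r msize0.
have [->|q0] := eqVneq q 0; first by rewrite mulr0 msize0.
rewrite msizeM // => hp hq.
by have := leq_add hp hq; rewrite addSn addnS; case: (_ + _)%N.
Qed.

Lemma deg_ltX m n p : deg_lt m.+1 p -> deg_lt (n * m).+1 (p ^+ n).
Proof.
move=> hp; elim: n => [|n IH]; first by rewrite expr0 mul0n; apply: deg_ltC.
by rewrite exprS mulSn; apply: deg_ltM.
Qed.

Lemma deg_lt_mderiv m i p : deg_lt m.+1 p -> deg_lt m (mderiv i p).
Proof.
move=> hp; rewrite [p]mpolyE raddf_sum /= big_seq.
apply: deg_lt_sum => mon hmon; rewrite mderivZ mderivX.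
apply: deg_ltZ; case e : (mon i) => [|a]; first by rewrite scale0r; apply: deg_lt0.
apply: deg_ltZ; rewrite /deg_lt msizeX.
have := leq_trans (msize_mdeg_lt hmon) hp; rewrite ltnS; apply: leq_trans.
have le1 : lem (mnm1 i) mon.
  by apply/mnm_lepP => j; rewrite mnm1E; case: eqP => // <-; rewrite e.
by rewrite -{2}(submK le1) mdegD mdeg1 addn1.
Qed.

Lemma affineP p : deg_lt 2 p -> exists (c0 : R) (c : 'I_d -> R),
  p = mpolyC d c0 + \sum_i c i *: mpolyX R (mnm1 i).
Proof.
move=> hp; rewrite [p]mpolyE big_seq.
apply: (big_ind (fun p => exists c0 c,
  p = mpolyC d c0 + \sum_i c i *: mpolyX R (mnm1 i))).
- exists 0, (fun=> 0); rewrite mpolyC0 add0r big1 // => i _.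
  by rewrite scale0r.
- move=> _ _ [a0 [a ->]] [b0 [b ->]]; exists (a0 + b0), (fun i => a i + b i).
  rewrite mpolyCD addrACA; congr (_ + _); rewrite -big_split.
  by apply: eq_bigr => i _ /=; rewrite scalerDl.
move=> m hm; have := leq_trans (msize_mdeg_lt hm) hp; rewrite ltnS leq_eqVlt.
case/orP => [/mdeg1P[i /eqP ->]|].
  exists 0, (fun j => if j == i then mcoeff (mnm1 i) p else 0).
  rewrite mpolyC0 add0r (bigD1 i) //= eqxx big1 ?addr0 // => j /negPf ->.
  by rewrite scale0r.
rewrite ltnS leqn0 mdeg_eq0 => /eqP ->; exists (mcoeff mnm0 p), (fun=> 0).
rewrite big1 ?addr0 => [|i _]; last by rewrite scale0r.
by rewrite mpolyX0 -mul_mpolyC mulr1.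
Qed.

Lemma mderiv_affine i p x : deg_lt 2 p ->
  mderiv i p = mpolyC d (peval (mderiv i p) x).
Proof.
move=> /(deg_lt_mderiv i) h; rewrite /deg_lt in h.
by rewrite {2}(msize1_polyC h) pevalC -msize1_polyC.
Qed.

Lemma peval_affine p (I : Type) (r : seq I) (P : pred I) (c : I -> R)
    (F : I -> 'rV[R]_d) : deg_lt 2 p -> \sum_(i <- r | P i) c i = 1 ->
  peval p (\sum_(i <- r | P i) c i *: F i) =
  \sum_(i <- r | P i) c i * peval p (F i).
Proof.
move=> /affineP [b0 [b ->]] c1; rewrite pevalE peval_sum.
under [RHS]eq_bigr do rewrite pevalE mulrDr.
rewrite big_split /=; congr (_ + _).
  by rewrite pevalC; under [RHS]eq_bigr do rewrite pevalC; rewrite -mulr_suml c1 mul1r.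
under [RHS]eq_bigr do rewrite peval_sum mulr_sumr.
rewrite exchange_big; apply: eq_bigr => i _ /=.
rewrite !pevalE summxE mulr_sumr; apply: eq_bigr => j _.
by rewrite !pevalE !mxE mulrCA.
Qed.

Lemma mderiv_mpolyXU i j :
  mderiv i (mpolyX R (mnm1 j)) = (i == j)%:R :> mpoly d R.
Proof.
rewrite mderivX mnm1E eq_sym; case: eqP => [->|_]; last by rewrite scale0r.
rewrite scale1r (_ : mnm_sub _ _ = mnm0) ?mpolyX0 //.
by apply/mnmP => k; rewrite mnmBE subnn mnm0E.
Qed.

Lemma peval_affineB p x y : deg_lt 2 p -> peval p x - peval p y =
  \sum_i peval (mderiv i p) 0 * (x 0 i - y 0 i).
Proof.
move=> /affineP [b0 [b ->]].
rewrite !pevalE !peval_sum opprD addrACA subrr add0r -sumrB.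
apply: eq_bigr => i _; rewrite !pevalE -mulrBr; congr (_ * _).
rewrite mderivD mderivC add0r raddf_sum /= peval_sum (bigD1 i) //= big1 => [|j ji].
  by rewrite mderivZ mderiv_mpolyXU eqxx !pevalE mulr1 addr0.
by rewrite mderivZ mderiv_mpolyXU eq_sym (negPf ji) !pevalE mulr0.
Qed.

End MultivariatePolynomials.

(** * Barycentric coordinates of an element *)

Section Cell.
Variables (R : realType) (d : nat) (M : mesh R d).
Local Notation V := 'I_(nvert M).
Variable T : {set V}.
Hypothesis cardT : #|T| = d.+1.
Hypothesis indT : affinely_independent T.

Local Notation lam := (barycentric T).
Local Notation X i := (mpolyX R (mnm1 i)).

(** Affine independence of the vertices says that these rows are free, and [d + 1] free rows in
    dimension [1 + d] make the matrix invertible. *)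
Let vmat : 'M[R]_(#|T|, 1 + d) :=
  \matrix_(i < #|T|) row_mx 1%:M (vert (enum_val i)).

Let vmat0 j : vmat j (lshift d 0) = 1.
Proof. by rewrite mxE row_mxEl mxE eqxx. Qed.

Let vmatS j l : vmat j (rshift 1 l) = vert (enum_val j) 0 l.
Proof. by rewrite mxE row_mxEr. Qed.

Let row_free_vmat : row_free vmat.
Proof.
rewrite -kermx_eq0; apply/rowV0P => c /sub_kermxP cv.
apply/rowP => i; rewrite mxE.
pose c' v : R := c 0 (enum_rank_in (enum_valP i) v).
have c'E j : c' (enum_val j) = c 0 j by rewrite /c' enum_valK_in.
rewrite -c'E; apply: indT (enum_valP i).
  have := congr1 (fun A : 'M[R]_(1, 1 + d) => A 0 (lshift d 0)) cv.
  rewrite !mxE (big_enum_val c') => e; rewrite -[RHS]e.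
  by apply: eq_bigr => j _; rewrite c'E vmat0 mulr1.
apply/rowP => l.
have := congr1 (fun A : 'M[R]_(1, 1 + d) => A 0 (rshift 1 l)) cv.
rewrite !mxE (big_enum_val (fun v => c' v *: vert v)) summxE => e; rewrite -[RHS]e.
by apply: eq_bigr => j _; rewrite c'E vmatS mxE.
Qed.

Let row_full_vmat : row_full vmat.
Proof. by rewrite -col_leq_rank (eqP row_free_vmat) cardT. Qed.

Let vmatE b0 (b : 'I_d -> R) i :
  peval (mpolyC d b0 + \sum_l b l *: X l) (vert (enum_val i)) =
  (vmat *m col_mx (const_mx b0 : 'cV[R]_1) (\col_l b l)) i 0.
Proof.
rewrite pevalD peval_sum mxE big_split_ord big_ord1 /= pevalC; congr (_ + _).
  by rewrite vmat0 col_mxEu mxE mul1r.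
apply: eq_bigr => l _.
by rewrite pevalZ pevalXU vmatS col_mxEd mxE mulrC.
Qed.

(** The coefficients are a column of the inverse of [vmat]. This existence gives the [xget] in
    [barycentric] its meaning. *)
Lemma barycentricP v : v \in T ->
  deg_lt 2 (lam v) /\ forall w, w \in T -> peval (lam v) (vert w) = (w == v)%:R.
Proof.
move=> vT; apply: (@xgetPex _ 0 [set p : mpoly d R | deg_lt 2 p /\
    forall w, w \in T -> peval p (vert w) = (w == v)%:R]).
pose j := enum_rank_in vT v; pose c := col j (pinvmx vmat).
exists (mpolyC d (c (lshift d 0) 0) + \sum_l c (rshift 1 l) 0 *: X l); split.
  apply: deg_ltD; first exact: deg_ltC.
  by apply: deg_lt_sum => l _; apply: deg_ltZ; rewrite /deg_lt msizeX mdeg1.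
move=> w wT; rewrite -{1}(enum_rankK_in wT wT) vmatE.
have -> : col_mx (const_mx (c (lshift d 0) 0) : 'cV[R]_1) (\col_l c (rshift 1 l) 0) = c.
  rewrite -[RHS]vsubmxK; congr col_mx; apply/colP => l; rewrite !mxE //.
  by rewrite !ord1.
rewrite /c colE mulmxA mulmxVp // mul1mx !mxE eqxx andbT.
by rewrite -(inj_eq enum_val_inj) !enum_rankK_in.
Qed.

Lemma deg_lt_barycentric v : v \in T -> deg_lt 2 (lam v).
Proof. by case/barycentricP. Qed.

Lemma barycentric_vert v w : v \in T -> w \in T ->
  peval (lam v) (vert w) = (w == v)%:R.
Proof. by case/barycentricP => _; apply. Qed.

Lemma affine_eq0 p : deg_lt 2 p -> (forall v, v \in T -> peval p (vert v) = 0) ->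
  p = 0.
Proof.
move=> /affineP[b0 [b ->]] h.
have : vmat *m col_mx (const_mx b0 : 'cV[R]_1) (\col_l b l) = 0.
  by apply/colP => i; rewrite -vmatE h ?mxE // enum_valP.
move/(congr1 (mulmx (pinvmx vmat))); rewrite mulmxA mulVpmx // mul1mx mulmx0 => e.
have b00 : b0 = 0.
  by have := congr1 (fun A : 'cV[R]_(1 + d) => A (lshift d 0) 0) e;
     rewrite col_mxEu !mxE.
have bl l : b l = 0.
  by have := congr1 (fun A : 'cV[R]_(1 + d) => A (rshift 1 l) 0) e;
     rewrite col_mxEd !mxE.
by rewrite b00 mpolyC0 add0r big1 // => l _; rewrite bl scale0r.
Qed.

Lemma affine_eq p q : deg_lt 2 p -> deg_lt 2 q ->
  (forall v, v \in T -> peval p (vert v) = peval q (vert v)) -> p = q.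
Proof.
move=> hp hq h; apply/eqP; rewrite -subr_eq0; apply/eqP.
by apply: affine_eq0 => [|v vT]; [exact: deg_ltB|rewrite pevalB h // subrr].
Qed.

Lemma sum_barycentric_vert (c : V -> R) w : w \in T ->
  peval (\sum_(v in T) c v *: lam v) (vert w) = c w.
Proof.
move=> wT; rewrite peval_sum (bigD1 w) //= big1 => [|v /andP[vT vw]].
  by rewrite pevalZ barycentric_vert // eqxx mulr1 addr0.
by rewrite pevalZ barycentric_vert // eq_sym (negPf vw) mulr0.
Qed.

Lemma sum_barycentric : \sum_(v in T) lam v = 1.
Proof.
apply: affine_eq.
- by apply: deg_lt_sum => v vT; apply: deg_lt_barycentric.
- by rewrite -mpolyC1; exact: deg_ltC.
move=> w wT; rewrite peval1 -[RHS](sum_barycentric_vert (fun=> 1) wT).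
by congr peval; apply: eq_bigr => v _; rewrite scale1r.
Qed.

Lemma coord_barycentric i : X i = \sum_(v in T) vert v 0 i *: lam v.
Proof.
apply: affine_eq.
- by rewrite /deg_lt msizeX mdeg1.
- by apply: deg_lt_sum => v vT; apply/deg_ltZ/deg_lt_barycentric.
by move=> w wT; rewrite pevalXU (sum_barycentric_vert (fun v => vert v 0 i)).
Qed.

(** The partial derivatives are constants when [v] is a vertex of [T], so 0 is an arbitrary
    evaluation point. *)
Definition bgrad v : 'rV[R]_d := \row_j peval (mderiv j (lam v)) 0.

Lemma mderiv_barycentric v j : v \in T -> mderiv j (lam v) = mpolyC d (bgrad v 0 j).
Proof. by move=> vT; rewrite mxE; apply/mderiv_affine/deg_lt_barycentric. Qed.

Lemma sum_bgrad : \sum_(v in T) bgrad v = 0.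
Proof.
apply/rowP => j; rewrite summxE mxE.
have := congr1 (fun p => peval (mderiv j p) 0) sum_barycentric.
rewrite -mpolyC1 mderivC peval0 => e; rewrite -[RHS]e raddf_sum peval_sum.
by apply: eq_bigr => v _; rewrite mxE.
Qed.

Lemma peval_barycentricB v x y : v \in T ->
  peval (lam v) x - peval (lam v) y = dot (bgrad v) (x - y).
Proof.
move=> vT; rewrite peval_affineB; last exact: deg_lt_barycentric.
by apply: eq_bigr => i _; rewrite !mxE.
Qed.

Lemma dot_bgrad v w w' : v \in T -> w \in T -> w' \in T ->
  dot (bgrad v) (vert w - vert w') = (w == v)%:R - (w' == v)%:R.
Proof. by move=> vT wT w'T; rewrite -peval_barycentricB // !barycentric_vert. Qed.

Definition bmon (a : V -> nat) : mpoly d R := \prod_(v in T) lam v ^+ a v.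

(** Inductive, so that statements linear in a polynomial can be proved monomial by monomial with the
    degree bound at hand. *)
Inductive bspan m : mpoly d R -> Prop :=
| bspan0 : bspan m 0
| bspanS c a p : (\sum_(v in T) a v <= m)%N -> bspan m p ->
    bspan m (c *: bmon a + p).

Lemma bspanD m p q : bspan m p -> bspan m q -> bspan m (p + q).
Proof.
elim=> [|c a {}p am _ IH] hq; first by rewrite add0r.
by rewrite -addrA; apply: bspanS am (IH hq).
Qed.

Lemma bspanZ m c p : bspan m p -> bspan m (c *: p).
Proof.
elim=> [|b a {}p am _ IH]; first by rewrite scaler0; exact: bspan0.
by rewrite scalerDr scalerA; apply: bspanS.
Qed.

Lemma bspan_le m n p : (m <= n)%N -> bspan m p -> bspan n p.
Proof.
move=> mn; elim=> [|b a {}p am _ IH]; first exact: bspan0.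
by apply: bspanS IH; exact: leq_trans mn.
Qed.

Lemma bspanM m n p q : bspan m p -> bspan n q -> bspan (m + n) (p * q).
Proof.
move=> hp hq; elim: hp => [|b a {}p am _ IH]; first by rewrite mul0r; exact: bspan0.
rewrite mulrDl; apply: bspanD IH; rewrite -scalerAl; apply: bspanZ.
elim: hq => [|b' a' {}q am' _ IH]; first by rewrite mulr0; exact: bspan0.
rewrite mulrDr; apply: bspanD IH; rewrite -scalerAr; apply: bspanZ.
have -> : bmon a * bmon a' = bmon (fun v => a v + a' v)%N.
  by rewrite -big_split; apply: eq_bigr => v _; rewrite exprD.
rewrite -[bmon _]scale1r -[1 *: _]addr0; apply: bspanS; last exact: bspan0.
by rewrite big_split leq_add.
Qed.

Lemma bspan1 : bspan 0 1.
Proof.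
have := @bspanS 0 1 (fun=> 0%N) 0; rewrite big1 // => /(_ isT (bspan0 0)).
by rewrite scale1r addr0 /bmon big1.
Qed.

Lemma bspan_lam v : v \in T -> bspan 1 (lam v).
Proof.
move=> vT; have := @bspanS 1 1 (fun w => (w == v) : nat) 0.
rewrite scale1r addr0 (bigD1 v) //= eqxx big1 => [|w /andP[_ /negPf->]//].
move=> /(_ isT (bspan0 1)); rewrite /bmon (bigD1 v) //= eqxx big1 ?mulr1 //.
by move=> w /andP[_ /negPf ->]; rewrite expr0.
Qed.

Lemma bspan_sum m (I : Type) (r : seq I) (P : pred I) (F : I -> mpoly d R) :
  (forall i, P i -> bspan m (F i)) -> bspan m (\sum_(i <- r | P i) F i).
Proof. by move=> h; apply: (big_ind _ (bspan0 m)) => // p q; apply: bspanD. Qed.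

(** Each Cartesian coordinate is the combination of the barycentric ones weighted by the vertices;
    substitution into a monomial does not raise the degree. *)
Lemma deg_lt_bspan m p : deg_lt m.+1 p -> bspan m p.
Proof.
move=> hp; rewrite [p]mpolyE big_seq; apply: bspan_sum => mon hmon.
apply: bspanZ; have := leq_trans (msize_mdeg_lt hmon) hp; rewrite ltnS => hm.
apply: (bspan_le hm); rewrite mpolyXE_id mdegE.
apply: (big_ind2 (fun n q => bspan n q)) => [||i _]; first exact: bspan1.
  by move=> n1 q1 n2 q2; apply: bspanM.
have b1 : bspan 1 (X i).
  rewrite coord_barycentric; apply: bspan_sum => v vT.
  exact/bspanZ/bspan_lam.
elim: (mon i) => [|n IH]; first by rewrite expr0; exact: bspan1.
by rewrite exprS -add1n; apply: bspanM.
Qed.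

Lemma bspan_ex m p : bspan m p -> exists s : seq (R * (V -> nat)),
  p = \sum_(i <- s) i.1 *: bmon i.2.
Proof.
elim=> [|c a {}p _ _ [s ->]]; first by exists [::]; rewrite big_nil.
by exists ((c, a) :: s); rewrite big_cons.
Qed.

Lemma bmon_ex p : exists s : seq (R * (V -> nat)),
  p = \sum_(i <- s) i.1 *: bmon i.2.
Proof. by apply: (@bspan_ex (msize p)); apply: deg_lt_bspan; apply: leqnSn. Qed.

Lemma barycentric_comb (S : {set V}) (c : V -> R) v : S \subset T ->
  \sum_(w in S) c w = 1 -> v \in T ->
  peval (lam v) (\sum_(w in S) c w *: vert w) = if v \in S then c v else 0.
Proof.
move=> ST c1 vT; rewrite peval_affine //; last exact: deg_lt_barycentric.
have wv w : w \in S -> c w * peval (lam v) (vert w) = if w == v then c w else 0.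
  move=> wS; rewrite (barycentric_vert vT (fintype.subsetP ST _ wS)).
  by case: eqP; rewrite ?mulr1 ?mulr0.
rewrite (eq_bigr _ wv) -big_mkcondr /=.
case: ifPn => vS; last first.
  by rewrite big1 // => w /andP[wS /eqP wv']; rewrite wv' (negPf vS) in wS.
rewrite (bigD1 v) /= ?vS ?eqxx // big1 ?addr0 // => w.
by case/andP => /andP[_ ->].
Qed.

End Cell.

(** * Integrals over simplices and Dirichlet's formula *)

Section SimplexIntegral.
Variables (R : realType) (d : nat) (M : mesh R d).
Local Notation V := 'I_(nvert M).
Implicit Types (S : {set V}) (f g : 'rV[R]_d -> R).

Let edges S := [seq b - head 0 [seq vert v | v <- enum S] |
  b <- behead [seq vert v | v <- enum S]].

Definition sgram S : R :=
  Num.sqrt (\det (\matrix_(i < size (edges S), j < size (edges S))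
    dot (edges S)`_i (edges S)`_j)).

(** The volume factor [sgram] is split off, so that integrals of barycentric monomials do not depend
    on the shape of the simplex. *)
Definition sint S f : R :=
  ref_integral (edges S) 1 (head 0 [seq vert v | v <- enum S]) f.

Lemma simplex_integralE S f : S != finset.set0 ->
  simplex_integral S f = sgram S * sint S f.
Proof.
move=> S0; rewrite /simplex_integral /sgram /sint /edges.
case e : (enum S) => [|v s] //=.
by case/finset.set0Pn: S0 => x; rewrite -mem_enum e.
Qed.

Lemma sgram_ge0 S : 0 <= sgram S.
Proof. exact: sqrtr_ge0. Qed.

Section Parametrization.
Variables (S : {set V}) (v0 : V) (s : seq V).
Hypothesis enumS : enum S = v0 :: s.

(* the barycentric coordinates of the points of [ref_integral] *)
Let coef (t : nat -> R) (v : V) : R :=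
  if v == v0 then 1 - \sum_(j < size s) t j else t (index v s).

Let uniq_s : v0 \notin s /\ uniq s.
Proof. by have := enum_uniq S; rewrite enumS => /andP[]. Qed.

Let size_edgesE : size (edges S) = size s.
Proof. by rewrite /edges enumS /= !size_map. Qed.

Let big_enumS (T : Type) (idx : T) (op : Monoid.com_law idx) (F : V -> T) :
  \big[op/idx]_(v in S) F v = op (F v0) (\big[op/idx]_(j < size s) F (nth v0 s j)).
Proof. by rewrite -big_enum enumS big_cons (big_nth v0) big_mkord. Qed.

Let coef_v0 t : coef t v0 = 1 - \sum_(j < size s) t j.
Proof. by rewrite /coef eqxx. Qed.

Let coef_nth t (j : 'I_(size s)) : coef t (nth v0 s j) = t j.
Proof.
have [v0s us] := uniq_s; rewrite /coef; case: eqP => [e|_].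
  by rewrite -e mem_nth in v0s.
by rewrite index_uniq.
Qed.

Let sum_coef t : \sum_(v in S) coef t v = 1.
Proof.
rewrite big_enumS coef_v0 /=.
by rewrite (eq_bigr _ (fun j _ => coef_nth t j)) subrK.
Qed.

Let coef_ge0 (t : nat -> R) : (forall j, 0 <= t j) -> \sum_(j < size (edges S)) t j <= 1 ->
  forall v, 0 <= coef t v.
Proof.
by rewrite size_edgesE => t0 t1 v; rewrite /coef; case: eqP; rewrite ?subr_ge0.
Qed.

Let paramE (t : nat -> R) : head 0 [seq vert v | v <- enum S] +
  \sum_(j < size (edges S)) t j *: (edges S)`_j =
  \sum_(v in S) coef t v *: vert v.
Proof.
rewrite big_enumS coef_v0 size_edgesE /edges enumS /=.
rewrite [X in _ = _ + X](eq_bigr _ (fun j _ => congr1 (fun x => x *: _) (coef_nth t j))).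
under eq_bigr => j _.
  rewrite (nth_map 0) ?size_map // (nth_map v0) // scalerBr; over.
by rewrite sumrB scalerBl scale1r -scaler_suml addrA addrAC.
Qed.

Let param_simplex (t : nat -> R) : (forall j, 0 <= t j) ->
  \sum_(j < size (edges S)) t j <= 1 ->
  simplex S (head 0 [seq vert v | v <- enum S] +
    \sum_(j < size (edges S)) t j *: (edges S)`_j).
Proof.
move=> t0 t1; exists (coef t); split; [|exact: sum_coef|exact: paramE].
by move=> v _; apply: coef_ge0.
Qed.

Lemma sint_eq_enum f g : (forall x, simplex S x -> f x = g x) -> sint S f = sint S g.
Proof. by move=> fg; apply: ref_integral_eq => // t t0 t1; apply/fg/param_simplex. Qed.

Lemma sint_ge0_enum f : (forall x, simplex S x -> 0 <= f x) -> 0 <= sint S f.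
Proof. by move=> fg; apply: ref_integral_ge0 => // t t0 t1; apply/fg/param_simplex. Qed.

Variable T : {set V}.
Hypothesis cardT : #|T| = d.+1.
Hypothesis indT : affinely_independent T.
Hypothesis ST : S \subset T.

(** On [S] the coordinates of the vertices in [T :\: S] vanish, which kills every monomial
    containing one; the others are Dirichlet integrals in the coordinates of [S]. *)
Lemma sint_bmon_enum (l : seq (R * (V -> nat))) :
  sint S (peval (\sum_(i <- l) i.1 *: bmon T i.2)) =
  \sum_(i <- l) i.1 * (if [forall v in T :\: S, i.2 v == 0%N] then
    (\prod_(v in S) (i.2 v)`!)%:R / (\sum_(v in S) i.2 v + #|S|.-1)`!%:R else 0).
Proof.
rewrite /sint (@ref_integral_monomials _ _ _ l
  (fun i => if [forall v in T :\: S, i.2 v == 0%N] then i.1 else 0)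
  (fun i j => i.2 (nth v0 s j)) (fun i => i.2 v0)) //; last first.
  move=> t t0 t1; rewrite paramE peval_sum; apply: eq_bigr => -[c a] _ /=.
  rewrite pevalZ /bmon peval_prod.
  under eq_bigr => v vT.
    rewrite pevalX (barycentric_comb indT ST (sum_coef t) vT); over.
  rewrite (bigID (mem S)) /=.
  rewrite [X in _ * (X * _) = _](_ : _ = \prod_(v in S) coef t v ^+ a v); last first.
    rewrite big_mkcondr /= (eq_bigr (fun v => if v \in S then coef t v ^+ a v else 1)).
      rewrite -big_mkcondr; apply: eq_bigl => v.
      by case: (boolP (v \in S)) => [/(fintype.subsetP ST) ->|]; rewrite ?andbF.
    by move=> v _; case: (v \in S).
  rewrite big_enumS coef_v0 size_edgesE.
  rewrite [X in _ * (_ * X * _) = _](eq_bigr _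
    (fun j _ => congr1 (fun x => x ^+ _) (coef_nth t j))).
  case: ifPn => [/forall_inP h|].
    rewrite [X in _ * (_ * X) = _]big1 ?mulr1; first by rewrite [X in _ * X = _]mulrC.
    move=> v /andP[vT vS]; have := h v; rewrite !inE vT vS => /(_ isT) /eqP ->.
    by rewrite expr0.
  rewrite negb_forall => /existsP[v]; rewrite negb_imply !inE => /andP[/andP[vS vT] av].
  rewrite [X in _ * (_ * X) = _](bigD1 v) ?vT ?vS //= (negPf vS) expr0n (negPf av).
  by rewrite mul0r !mulr0 mul0r.
apply: eq_bigr => -[c a] _ /=; rewrite expr1n mulr1.
case: ifP => _; last by rewrite mul0r mulr0.
rewrite big_enumS (@big_enumS _ _ addn) size_edgesE [in #|S|]cardE enumS /= mulnC addnC.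
by rewrite [X in (_ + X)%N]addnC addnC.
Qed.

End Parametrization.

End SimplexIntegral.

Section SimplexFunctional.
Variables (R : realType) (d : nat) (M : mesh R d).
Local Notation V := 'I_(nvert M).
Variables (S : {set V}).
Hypothesis S0 : S != finset.set0.

Let enum_cons : exists v0 s, enum S = v0 :: s.
Proof.
case e : (enum S) => [|v s]; last by exists v, s.
by case/finset.set0Pn: S0 => x; rewrite -mem_enum e.
Qed.

Lemma sint_eq f g : (forall x, simplex S x -> f x = g x) -> sint S f = sint S g.
Proof. by have [v0 [s e]] := enum_cons; apply: (sint_eq_enum e). Qed.

Lemma sint_ge0 f : (forall x, simplex S x -> 0 <= f x) -> 0 <= sint S f.
Proof. by have [v0 [s e]] := enum_cons; apply: (sint_ge0_enum e). Qed.

Lemma simplex_vert v : v \in S -> simplex S (vert v).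
Proof.
move=> vS; exists (fun w => (w == v)%:R); split=> [w _||]; first exact: ler0n.
  by rewrite (bigD1 v) //= eqxx big1 ?addr0 // => w /andP[_ /negPf ->].
rewrite (bigD1 v) //= eqxx scale1r big1 ?addr0 // => w /andP[_ /negPf ->].
by rewrite scale0r.
Qed.

Variable T : {set V}.
Hypothesis cardT : #|T| = d.+1.
Hypothesis indT : affinely_independent T.
Hypothesis ST : S \subset T.

Definition dirichlet (a : V -> nat) : R :=
  if [forall v in T :\: S, a v == 0%N] then
    (\prod_(v in S) (a v)`!)%:R / (\sum_(v in S) a v + #|S|.-1)`!%:R else 0.

Lemma sint_bmon a : sint S (peval (bmon T a)) = dirichlet a.
Proof.
have [v0 [s e]] := enum_cons.
have := sint_bmon_enum e indT ST [:: (1, a)].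
by rewrite !big_seq1 /= scale1r mul1r.
Qed.

Let sint_sum_bmon (l : seq (R * (V -> nat))) :
  sint S (peval (\sum_(i <- l) i.1 *: bmon T i.2)) =
  \sum_(i <- l) i.1 * dirichlet i.2.
Proof. by have [v0 [s e]] := enum_cons; apply: (sint_bmon_enum e). Qed.

(** Both polynomials are expanded in barycentric monomials, where the integral is a sum of Dirichlet
    values. *)
Lemma sintD p q :
  sint S (peval (p + q)) = sint S (peval p) + sint S (peval q).
Proof.
have [l ->] := bmon_ex cardT indT p; have [l' ->] := bmon_ex cardT indT q.
by rewrite -big_cat !sint_sum_bmon big_cat.
Qed.

Lemma sintZ c p : sint S (peval (c *: p)) = c * sint S (peval p).
Proof.
have [l ->] := bmon_ex cardT indT p.
pose l' := [seq (c * i.1, i.2) | i <- l].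
rewrite (_ : c *: _ = \sum_(i <- l') i.1 *: bmon T i.2).
  rewrite !sint_sum_bmon big_map mulr_sumr; apply: eq_bigr => i _ /=.
  by rewrite mulrA.
by rewrite big_map scaler_sumr; apply: eq_bigr => i _; rewrite scalerA.
Qed.

Lemma sint0 : sint S (peval 0) = 0.
Proof. by rewrite -(scale0r 0) sintZ mul0r. Qed.

Lemma sintN p : sint S (peval (- p)) = - sint S (peval p).
Proof. by rewrite -scaleN1r sintZ mulN1r. Qed.

Lemma sintB p q :
  sint S (peval (p - q)) = sint S (peval p) - sint S (peval q).
Proof. by rewrite sintD sintN. Qed.

Lemma sint_sum (I : Type) (r : seq I) (P : pred I) (F : I -> mpoly d R) :
  sint S (peval (\sum_(i <- r | P i) F i)) =
  \sum_(i <- r | P i) sint S (peval (F i)).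
Proof. by apply: (big_morph _ sintD sint0). Qed.

Lemma sint_le p q : (forall x, simplex S x -> peval p x <= peval q x) ->
  sint S (peval p) <= sint S (peval q).
Proof.
move=> pq; rewrite -subr_ge0 -sintB; apply: sint_ge0 => x Sx.
by rewrite pevalB subr_ge0 pq.
Qed.

Lemma sint_const (c : R) : sint S (peval (mpolyC d c)) = c / (#|S|.-1)`!%:R.
Proof.
rewrite -[c]mulr1 mpolyCM mpolyC1 mul_mpolyC sintZ mulr1; congr (_ * _).
have -> : 1 = bmon T (fun=> 0%N) :> mpoly d R by rewrite /bmon big1.
rewrite sint_bmon /dirichlet ifT; last by apply/forall_inP.
by rewrite !big1 // add0n mul1r.
Qed.

Lemma sint_sqr_le p q :
  sint S (peval (p * q)) ^+ 2 <=
  sint S (peval (p ^+ 2)) * sint S (peval (q ^+ 2)).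
Proof.
set A := sint S (peval (p ^+ 2)); set B := sint _ _; set C := sint _ (peval (q ^+ 2)).
have sq_ge0 r : 0 <= sint S (peval (r ^+ 2)).
  by apply: sint_ge0 => x _; rewrite pevalX sqr_ge0.
have h t : 0 <= t ^+ 2 * A + 2 * t * B + C.
  have := sq_ge0 (t *: p + q).
  rewrite (_ : (t *: p + q) ^+ 2 = t ^+ 2 *: p ^+ 2 + (2 * t) *: (p * q) + q ^+ 2).
    by rewrite !sintD !sintZ.
  rewrite sqrrD exprZn -scalerAl; congr (_ + _ + _).
  by rewrite -scaler_nat scalerA.
have A0 : 0 <= A by exact: sq_ge0.
have C0 : 0 <= C by exact: sq_ge0.
have [A00|An0] := eqVneq A 0.
  have [->|B0] := eqVneq B 0; first by rewrite expr0n mulr_ge0.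
  (* With [A = 0] the quadratic is affine in [t]; this [t] gives it the value -1. *)
  have := h (- (C + 1) / (2 * B)); rewrite A00 mulr0 add0r.
  have -> : 2 * (- (C + 1) / (2 * B)) * B + C = -1 by field.
  by rewrite oppr_ge0 leNgt ltr01.
have Ap : 0 < A by rewrite lt_neqAle eq_sym An0.
have := h (- B / A); rewrite -(ler_pM2r Ap) mul0r => h'.
rewrite -subr_ge0; apply: le_trans h' _; rewrite le_eqVlt; apply/orP; left.
by apply/eqP; field.
Qed.

End SimplexFunctional.

(** * Divergence theorem on an element *)

Section DivergenceTheorem.
Variables (R : realType) (d : nat) (M : mesh R d).
Local Notation V := 'I_(nvert M).

Lemma mderiv_prod (I : eqType) (r : seq I) (F : I -> mpoly d R) j : uniq r ->
  mderiv j (\prod_(v <- r) F v) =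
  \sum_(v <- r) mderiv j (F v) * \prod_(w <- r | w != v) F w.
Proof.
elim: r => [|x r IH] /=; first by rewrite !big_nil -mpolyC1 mderivC.
case/andP => xr ur; rewrite !big_cons mderivM IH // eqxx; congr (_ * _ + _).
  rewrite [LHS]big_seq [RHS]big_seq_cond.
  by apply: eq_bigl => w; case: eqP => [->|]; rewrite ?(negPf xr) // andbT.
rewrite mulr_sumr; apply: eq_big_seq => v vr.
rewrite big_cons ifT; first by rewrite mulrCA.
by apply: contraNneq xr => ->.
Qed.

Lemma mderiv_exp (p : mpoly d R) n j :
  mderiv j (p ^+ n) = n%:R *: (p ^+ n.-1 * mderiv j p).
Proof.
elim: n => [|n IH]; first by rewrite expr0 -mpolyC1 mderivC scale0r.
rewrite exprS mderivM IH /= -scalerAr mulrA; case: n {IH} => [|n] /=.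
  by rewrite expr0 mulr1 mul1r scale0r addr0 scale1r.
by rewrite -exprS mulrC -[n.+2%:R]nat1r scalerDl scale1r.
Qed.

Variables (T : {set V}).
Hypothesis cardT : #|T| = d.+1.
Hypothesis indT : affinely_independent T.
Hypothesis d_gt0 : (0 < d)%N.

Let T0 : T != finset.set0.
Proof. by rewrite -card_gt0 cardT. Qed.

Let Tv0 v : v \in T -> T :\ v != finset.set0.
Proof.
move=> vT; rewrite -card_gt0; have := cardsD1 v T.
by rewrite vT cardT add1n => -[<-].
Qed.

(** In the normalisation of [sint], the outward normal of the facet opposite to [v], times the ratio
    of the two factors [sgram], is [- bgrad T v]. The identity is checked on monomials. *)
Lemma sint_mderiv j p : sint T (peval (mderiv j p)) =
  - \sum_(v in T) bgrad T v 0 j * sint (T :\ v) (peval p).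
Proof.
have Tv v : T :\ v \subset T by apply: subsetDl.
have [l ->] := bmon_ex cardT indT p; elim: l => [|[c a] l IH].
  rewrite big_nil mderiv0 (sint0 T0 cardT indT) // big1 ?oppr0 // => v vT.
  by rewrite (sint0 (Tv0 vT) cardT indT (Tv v)) mulr0.
rewrite big_cons mderivD mderivZ /= (sintD T0 cardT indT) // (sintZ T0 cardT indT) //.
rewrite IH.
rewrite [in RHS](eq_bigr (fun v => c * (bgrad T v 0 j * sint (T :\ v) (peval (bmon T a)))
   + bgrad T v 0 j * sint (T :\ v) (peval (\sum_(i <- l) i.1 *: bmon T i.2)))); last first.
  move=> v vT; rewrite (sintD (Tv0 vT) cardT indT (Tv v)).
  by rewrite (sintZ (Tv0 vT) cardT indT (Tv v)); ring.
rewrite big_split opprD -mulr_sumr -mulrN; congr (_ * _ + _).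
pose b v w := (a w - (w == v))%N.
have -> : mderiv j (bmon T a) =
    \sum_(v in T) ((a v)%:R * bgrad T v 0 j) *: bmon T (b v).
  rewrite /bmon -big_enum mderiv_prod ?enum_uniq // big_enum /=.
  apply: eq_bigr => v vT; rewrite mderiv_exp (mderiv_barycentric indT) // [X in _ = _ *: X](bigD1 v vT) /=.
  rewrite big_enum_cond /b eqxx subn1 -scalerA -!scalerAl; congr (_ *: _).
  rewrite [_ * mpolyC _ _]mulrC mul_mpolyC -!scalerAl; congr (_ *: (_ * _)).
  by apply: eq_bigr => w /andP[_ /negPf ->]; rewrite subn0.
rewrite (sint_sum T0 cardT indT) //.
(* [K] does not depend on [v]: if [a v > 0] it is the cell integral and the facet integral is 0; if
   [a v = 0] the two exchange roles. It drops out because the gradients sum to 0. *)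
pose K : R := (\prod_(v in T) (a v)`!)%:R / (\sum_(v in T) a v + d.-1)`!%:R.
have KE v : v \in T -> (a v)%:R * sint T (peval (bmon T (b v))) =
    K - sint (T :\ v) (peval (bmon T a)).
  move=> vT; rewrite (sint_bmon T0 indT) // (sint_bmon (Tv0 vT) indT (Tv v)) /dirichlet.
  rewrite ifT; last by apply/forall_inP => w; rewrite inE; case: (w \in T).
  have -> : [forall w in T :\: (T :\ v), a w == 0%N] = (a v == 0%N).
    apply/forall_inP/idP => [|av w]; first by apply; rewrite !inE eqxx vT.
    by rewrite !inE negb_and negbK; case: eqP => [->//|_] /=; case: (w \in T).
  have bw w : w != v -> b v w = a w by rewrite /b => /negPf ->; rewrite subn0.
  have card' : #|T :\ v| = d by have := cardsD1 v T; rewrite vT cardT add1n => -[].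
  have [av|av] := eqVneq (a v) 0%N.
    by rewrite av mul0r /K card' !(big_setD1 v vT) /= av fact0 mul1n add0n subrr.
  rewrite subr0 /K cardT !(big_setD1 v vT) /= (eq_bigr (fun w => (a w)`!)); last first.
    by move=> w; rewrite !inE => /andP[/bw ->].
  rewrite [X in (_ + X + _)%N](eq_bigr a) => [|w]; last by rewrite !inE => /andP[/bw ->].
  rewrite /b eqxx; case: (a v) av => // n _; rewrite subn1 /= factS.
  rewrite -mulnA natrM mulrA; congr (_ / _`!%:R); [by rewrite !natrM|lia].
rewrite (eq_bigr (fun v => K * bgrad T v 0 j -
    bgrad T v 0 j * sint (T :\ v) (peval (bmon T a)))); last first.
  move=> v vT; rewrite (sintZ T0 cardT indT) //.
  by rewrite mulrAC KE //; ring.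
rewrite sumrB -mulr_sumr.
have := congr1 (fun x : 'rV[R]_d => x 0 j) (sum_bgrad cardT indT).
by rewrite summxE mxE => ->; rewrite mulr0 sub0r.
Qed.

End DivergenceTheorem.

(** * Orthogonality of the univariate factors of the facet functions *)

Section JacobiForms.
Variable R : realType.
Implicit Types r : {poly R}.

Lemma legendre_orthogonal n r : (size r <= n)%N -> pint (jacobi R n 0 * r) = 0.
Proof. by move=> sr; have := jacobi_orthogonal 0 sr; rewrite expr0 mul1r. Qed.

(* the coefficient of [db] in the differential of [P(a / b) b ^ n.+1], where
   [P = ijacobi R n.+1 a]; that of [da] is [P' = jacobi R n a] *)
Definition dform n a : {poly R} :=
  n.+1%:R *: ijacobi R n.+1 a - 'X * jacobi R n a.

Lemma size_dform n a : (size (dform n a) <= n.+1)%N.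
Proof.
apply/leq_sizeP => j; rewrite leq_eqVlt => /orP[/eqP <-|nj].
  have := coef_deriv (ijacobi R n.+1 a) n; rewrite ijacobiS_deriv => e.
  by rewrite coefB coefZ coefXM e -[X in _ - X]mulr_natl subrr.
rewrite /dform coefB coefZ coefXM.
have -> : (ijacobi R n.+1 a)`_j = 0 by apply/nth_default/(leq_trans (size_ijacobi _ _ _)).
by case: j nj => // j nj; rewrite [X in _ - X]nth_default ?mulr0 ?subrr // size_jacobi.
Qed.

Lemma size_mul_lin c r n : (size r <= n)%N -> (size ((c%:P - 'X) * r)%R <= n.+1)%N.
Proof.
move=> sr; rewrite mulrBl (leq_trans (size_polyD _ _)) // geq_max size_polyN.
rewrite mul_polyC (leq_trans (size_scale_leq _ _)) ?(leq_trans sr) //=.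
by rewrite (leq_trans (size_polyMleq _ _)) // size_polyX.
Qed.

Lemma size_mul_one_addX r n : (size r <= n)%N -> (size ((1 + 'X) * r)%R <= n.+1)%N.
Proof.
by move=> sr; have := size_mul_lin (-1) sr; rewrite -(size_polyN (_ * _)) -mulNr
  opprB polyCN opprK addrC.
Qed.

Lemma size_mul_one_subX r n : (size r <= n)%N -> (size ((1 - 'X) * r)%R <= n.+1)%N.
Proof. by move=> sr; have := size_mul_lin 1 sr; rewrite polyC1. Qed.

(** The first factor is [(c - 'X) P' + (n + 2) P] with [P] an integrated Legendre polynomial, and
    each part is orthogonal to [r]. *)
Lemma dform0_orthogonal n c r : (size r <= n)%N ->
  pint ((c *: jacobi R n.+1 0 + dform n.+1 0) * r) = 0.
Proof.
move=> sr; rewrite (_ : _ * r = jacobi R n.+1 0 * ((c%:P - 'X) * r) +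
    n.+2%:R *: (ijacobi R n.+2 0 * r)).
  rewrite pintD pintZ ijacobi0_orthogonal // mulr0 addr0.
  by apply: legendre_orthogonal; apply: size_mul_lin.
by rewrite /dform -!mul_polyC; ring.
Qed.

(** [P' + (n + 1) P - 'X P'] equals [(1 - 'X) P' + (n + 1) P]: the factor [1 - 'X] completes the
    weight of [P'], and [P] is orthogonal for the weight [(1 - 'X) ^+ a] itself. *)
Lemma dform_sum_orthogonal n a r : (size r <= n)%N ->
  pint ((1 - 'X) ^+ a * (jacobi R n a.+1 + dform n a.+1) * r) = 0.
Proof.
move=> sr; rewrite (_ : _ * r = (1 - 'X) ^+ a.+1 * jacobi R n a.+1 * r +
    n.+1%:R *: (ijacobi R n.+1 a.+1 * (1 - 'X) ^+ a * r)).
  by rewrite pintD pintZ jacobi_orthogonal // ijacobi_orthogonal // mulr0 addr0.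
by rewrite /dform -!mul_polyC exprS; ring.
Qed.

(** The difference is [(n + 1) P - (1 + 'X) P']. Moving [1 + 'X], or the spare [1 - 'X], onto [r]
    costs one degree, whence the strict bound. *)
Lemma dform_diff_orthogonal n a r : (size r < n)%N ->
  pint ((1 - 'X) ^+ a.+1 * (dform n a.+1 - jacobi R n a.+1) * r) = 0.
Proof.
move=> sr; rewrite (_ : _ * r =
    n.+1%:R *: (ijacobi R n.+1 a.+1 * (1 - 'X) ^+ a * ((1 - 'X) * r)) -
    (1 - 'X) ^+ a.+1 * jacobi R n a.+1 * ((1 + 'X) * r)).
  rewrite pintD pintN pintZ jacobi_orthogonal ?ijacobi_orthogonal ?mulr0 ?oppr0 ?addr0 //.
    by apply: leq_trans (size_mul_one_subX (leqnn _)) _.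
  by apply: leq_trans (size_mul_one_addX (leqnn _)) _.
by rewrite /dform -!mul_polyC exprS; ring.
Qed.

Lemma size_weights m n : (size ((1 - 'X) ^+ m * (1 + 'X) ^+ n : {poly R})%R <= (m + n).+1)%N.
Proof.
elim: m => [|m IH]; last by rewrite exprS -mulrA; apply: size_mul_one_subX.
rewrite expr0 mul1r; elim: n => [|n IH]; first by rewrite expr0 size_poly1.
by rewrite exprS; apply: size_mul_one_addX.
Qed.

(* the trace on the facet of the curl of [v N0], with [v] of degree [n.+1] *)
Definition tform n : {poly R} := (1 - 'X) * jacobi R n 3 - 2 *: ijacobi R n.+1 3.

(** As an exact derivative, [tform] inherits its orthogonality from the integrated Jacobi polynomial
    through integration by parts. *)
Lemma tformE n : (1 - 'X) * tform n = ((1 - 'X) ^+ 2 * ijacobi R n.+1 3)^`().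
Proof.
rewrite derivM deriv_exp derivB derivX -[X in X^`() - _]polyC1 derivC sub0r.
by rewrite ijacobiS_deriv /tform -mul_polyC expr1; ring.
Qed.

Lemma size_tform n : (size (tform n) <= n.+2)%N.
Proof.
rewrite (leq_trans (size_polyD _ _)) // geq_max size_polyN.
rewrite size_mul_one_subX ?size_jacobi //=.
exact: leq_trans (size_scale_leq 2 (ijacobi R n.+1 3)) (size_ijacobi R n.+1 3).
Qed.

Lemma tform_neq0 n : tform n != 0.
Proof.
apply/eqP => e; have := tformE n; rewrite e mulr0 => d0.
have i0 : ijacobi R n.+1 3 != 0.
  apply/eqP => h; have := size_jacobi R n 3.
  by rewrite -ijacobiS_deriv h deriv0 size_poly0.
have := polyorder.size_deriv ((1 - 'X) ^+ 2 * ijacobi R n.+1 3).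
rewrite -d0 size_poly0 size_mul ?expf_neq0 ?one_subX_neq0 // size_one_subX_exp.
have : size (ijacobi R n.+1 3) != 0%N by rewrite size_poly_eq0.
by move: (size _) => [].
Qed.

Lemma tform_orthogonal n a b : (a + b <= n)%N ->
  pint ((1 - 'X) ^+ a.+1 * tform n * (1 + 'X) ^+ b) = 0.
Proof.
move=> ab; have -> : (1 - 'X) ^+ a.+1 * tform n * (1 + 'X) ^+ b =
    ((1 - 'X) * tform n) * ((1 - 'X) ^+ a * (1 + 'X) ^+ b) by rewrite exprS; ring.
have z1 : (1 - 'X : {poly R}).[1] = 0 by rewrite !hornerE subrr.
rewrite tformE pint_parts !hornerM ijacobiS_N1 !(horner_exp _ 1) z1 ?expr0n !mul0r.
rewrite mulr0 mul0r subrr sub0r [_ ^+ 2 * _]mulrC ijacobi_orthogonal ?oppr0 //.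
by rewrite polyorder.size_deriv; have := size_weights a b; move: (size _) => s; lia.
Qed.

(** Minus twice the coefficient of the third dual vector in the curl of [v N0], where [l1 + l2] has
    become its univariate counterpart [(1 - 'X) / 2]. *)
Definition sform n : {poly R} :=
  (1 - 'X) * (dform n 3 - jacobi R n 3) + 4 *: ijacobi R n.+1 3.

Lemma size_sform n : (size (sform n) <= n.+2)%N.
Proof.
rewrite (leq_trans (size_polyD _ _)) // geq_max.
rewrite (leq_trans (size_scale_leq 4 (ijacobi R n.+1 3)) (size_ijacobi R n.+1 3)) andbT.
rewrite size_mul_one_subX // (leq_trans (size_polyD _ _)) // geq_max.
by rewrite size_polyN size_dform size_jacobi /=.
Qed.

(** Adding the derivative of [F], which vanishes at both ends, removes the Jacobi polynomial and
    leaves integrated Jacobi polynomials against [(1 - 'X) ^+ 2], the weight of [ijacobi_orthogonal]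
    for parameter 3. *)
Lemma sform_orthogonal n m c : (m + c < n)%N ->
  pint ((1 - 'X) ^+ m.+1 * sform n * (1 + 'X) ^+ c) = 0.
Proof.
move=> mc; pose q := ijacobi R n.+1 3.
pose F := q * ((1 - 'X) ^+ m.+2 * (1 + 'X) ^+ c.+1).
have dX : (1 - 'X)^`() = -1 :> {poly R} by rewrite derivB derivX -polyC1 derivC sub0r.
have dX' : (1 + 'X)^`() = 1 :> {poly R} by rewrite derivD derivX -polyC1 derivC add0r.
have dF : F^`() = jacobi R n 3 * ((1 - 'X) ^+ m.+2 * (1 + 'X) ^+ c.+1) +
   q * (- m.+2%:R * (1 - 'X) ^+ m.+1 * (1 + 'X) ^+ c.+1 +
        c.+1%:R * (1 - 'X) ^+ m.+2 * (1 + 'X) ^+ c).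
  rewrite /F derivM ijacobiS_deriv derivM !deriv_exp dX dX' /=.
  by rewrite -/q; ring.
have F0 : pint F^`() = 0.
  have z1 : (1 - 'X : {poly R}).[1] = 0 by rewrite !hornerE subrr.
  rewrite pint_deriv /F !hornerM ijacobiS_N1 !(horner_exp _ 1) z1 ?expr0n.
  by rewrite !(mul0r, mulr0) subrr.
(* The last term has the factor [2 m], so the truncated exponent [m.-1] does no harm at [m = 0]. *)
have -> : (1 - 'X) ^+ m.+1 * sform n * (1 + 'X) ^+ c =
   (- 1) *: F^`() +
   (n + m + c + 4)%:R *: (q * (1 - 'X) ^+ 2 * ((1 - 'X) ^+ m * (1 + 'X) ^+ c)) -
   (2 * m)%:R *: (q * (1 - 'X) ^+ 2 * ((1 - 'X) ^+ m.-1 * (1 + 'X) ^+ c)).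
  rewrite dF /sform /dform -/q scaleN1r -!mul_polyC !polyC_natr.
  rewrite (_ : (n + m + c + 4)%:R = n.+1%:R + m%:R + c.+1%:R + 2 :> {poly R}); last first.
    by rewrite -!natrD; congr _%:R; lia.
  rewrite (_ : (2 * m)%:R = 2 * m%:R :> {poly R}) ?natrM //.
  rewrite (_ : m.+2%:R = m%:R + 2 :> {poly R}); last by rewrite -natrD addn2.
  move: (jacobi R n 3) (q) (n.+1%:R) (c.+1%:R) => Q q' N C.
  rewrite [(1 + 'X) ^+ c.+1]exprS; move: ((1 + 'X) ^+ c) => B.
  case: (m) => [|m'] /=; first by rewrite !exprS expr0; ring.
  by rewrite !exprS -[m'.+1%:R]nat1r; move: ((1 - 'X) ^+ m') m'%:R => A m''; ring.
rewrite !pintD pintN !pintZ F0.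
rewrite !ijacobi_orthogonal ?mulr0 ?oppr0 ?addr0 //.
  by apply: leq_trans (size_weights _ _) _; lia.
by apply: leq_trans (size_weights _ _) _; lia.
Qed.

End JacobiForms.

(** * Facet functions in barycentric coordinates *)

(* Locked, since unification would otherwise compare distinct forms by
   unfolding multivariate polynomials. *)
HB.lock Definition form2 (R : realType) d (l1 l2 : mpoly d R) p n :=
  scaled p n (l2 - l1) (l2 + l1).
HB.lock Definition form3 (R : realType) d (l1 l2 l3 : mpoly d R) p n :=
  scaled p n (l3 - l2 - l1) (l3 + l2 + l1).

(** * Moments of forms in two and three barycentric coordinates *)

Section Moments.
Variables (R : realType) (d : nat).
Variables (l1 l2 l3 : mpoly d R).
Implicit Types p q : {poly R}.
Local Notation form2 := (form2 l1 l2).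
Local Notation form3 := (form3 l1 l2 l3).

Lemma form2D p q n : form2 (p + q) n = form2 p n + form2 q n.
Proof. by rewrite form2.unlock scaledD. Qed.
Lemma form2B p q n : form2 (p - q) n = form2 p n - form2 q n.
Proof. by rewrite form2.unlock scaledB. Qed.
Lemma form3D p q n : form3 (p + q) n = form3 p n + form3 q n.
Proof. by rewrite form3.unlock scaledD. Qed.
Lemma form3B p q n : form3 (p - q) n = form3 p n - form3 q n.
Proof. by rewrite form3.unlock scaledB. Qed.

Lemma form2Z c p n : form2 (c *: p) n = c *: form2 p n.
Proof. by rewrite form2.unlock scaledZ. Qed.
Lemma form3Z c p n : form3 (c *: p) n = c *: form3 p n.
Proof. by rewrite form3.unlock scaledZ. Qed.

Lemma form2_0 : form2 1 0 = 1.
Proof. by rewrite form2.unlock scaled1 expr0. Qed.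

Lemma form2M p q m n : (size p <= m.+1)%N -> (size q <= n.+1)%N ->
  form2 p m * form2 q n = form2 (p * q) (m + n).
Proof. by move=> sp sq; rewrite form2.unlock scaledM. Qed.

Lemma form3M p q m n : (size p <= m.+1)%N -> (size q <= n.+1)%N ->
  form3 p m * form3 q n = form3 (p * q) (m + n).
Proof. by move=> sp sq; rewrite form3.unlock scaledM. Qed.

Lemma form2_monomial a b : form2 (bernstein R a b) (a + b) = l1 ^+ a * l2 ^+ b.
Proof. by rewrite form2.unlock scaled_bernstein. Qed.

Lemma form3_monomial a b :
  form3 (bernstein R a b) (a + b) = (l2 + l1) ^+ a * l3 ^+ b.
Proof. by rewrite -scaled_bernstein form3.unlock opprD !addrA. Qed.

(** At ratio [t] the share of [l1 + l2] in [l1 + l2 + l3] is [(1 - t) / 2]. *)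
Lemma form3_mul_sum q n : (size q <= n.+1)%N ->
  (l2 + l1) * form3 q n = 2^-1 *: form3 ((1 - 'X) * q) n.+1.
Proof.
move=> sq; have := form3_monomial 1 0; rewrite expr1 expr0 mulr1 => <-.
rewrite form3M // -?form3Z ?addn0 ?add1n.
  by rewrite /bernstein expr1 expr0 mulr1 -scalerAl.
by rewrite /bernstein expr1 expr0 mulr1 (leq_trans (size_scale_leq _ _)) //
  -[_ - _]expr1 size_one_subX_exp.
Qed.

Lemma bernsteinE a b : bernstein R a b =
  (2^-1 ^+ a * 2^-1 ^+ b) *: ((1 - 'X) ^+ a * (1 + 'X) ^+ b).
Proof. by rewrite /bernstein !exprZn -scalerAl -scalerAr scalerA. Qed.

Lemma size_bernstein a b : (size (bernstein R a b) <= (a + b).+1)%N.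
Proof.
rewrite bernsteinE.
exact: leq_trans (size_scale_leq _ _) (size_weights _ _ _).
Qed.

Lemma form2_mul_monomial p n a b : (size p <= n.+1)%N ->
  form2 p n * (l1 ^+ a * l2 ^+ b) = form2 (p * bernstein R a b) (n + (a + b)).
Proof.
by move=> sp; rewrite -form2_monomial (form2M sp (size_bernstein a b)).
Qed.

Lemma form3_mul_monomial p n c : (size p <= n.+1)%N ->
  form3 p n * l3 ^+ c = form3 (p * bernstein R 0 c) (n + c).
Proof.
move=> sp; rewrite -[l3 ^+ c]mul1r -(expr0 (l2 + l1)) -form3_monomial.
by rewrite (form3M sp (size_bernstein 0 c)).
Qed.

Variable L : mpoly d R -> R.
Hypothesis LD : forall f g, L (f + g) = L f + L g.
Hypothesis LZ : forall c f, L (c *: f) = c * L f.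
Variables (y : mpoly d R) (w : nat -> R).

Let size_mul p q m n : (size p <= m.+1)%N -> (size q <= n.+1)%N ->
  (size (p * q)%R <= (m + n).+1)%N.
Proof.
move=> sp sq; apply: leq_trans (size_polyMleq _ _) _.
by have := leq_add sp sq; rewrite addSn addnS; case: (_ + _)%N.
Qed.

Lemma form2_moment p n a b : (size p <= n.+1)%N ->
  (forall a b, L (l1 ^+ a * l2 ^+ b * y) = (a`! * b`!)%:R * w (a + b)%N) ->
  L (form2 p n * (l1 ^+ a * l2 ^+ b * y)) =
  pint (p * bernstein R a b) *
  ((n + (a + b)).+1`!%:R / 2 * w (n + (a + b))%N).
Proof.
move=> sp H; rewrite mulrA form2_mul_monomial //.
by rewrite form2.unlock (linear_polar2 LD LZ H) //; apply: (size_mul sp (size_bernstein a b)).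
Qed.

Lemma form2_moment_eq0 p n a b : (size p <= n.+1)%N ->
  (forall a b, L (l1 ^+ a * l2 ^+ b * y) = (a`! * b`!)%:R * w (a + b)%N) ->
  pint (p * ((1 - 'X) ^+ a * (1 + 'X) ^+ b)) = 0 ->
  L (form2 p n * (l1 ^+ a * l2 ^+ b * y)) = 0.
Proof.
move=> sp H p0; rewrite form2_moment // bernsteinE -[p * (_ *: _)]scalerAr.
by rewrite pintZ p0 mulr0 mul0r.
Qed.

Hypothesis H : forall a b c, L (l1 ^+ a * l2 ^+ b * l3 ^+ c * y) =
  (a`! * b`! * c`!)%:R * w (a + b + c)%N.

Lemma form3_moment p n q m a b c : (size p <= n.+1)%N -> (size q <= m.+1)%N ->
  L (form2 p n * form3 q m * (l1 ^+ a * l2 ^+ b * l3 ^+ c * y)) =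
  pint (p * bernstein R a b) *
  pint ((2^-1 *: (1 - 'X)) ^+ (n + (a + b)).+1 * (q * bernstein R 0 c)) *
  ((n + (a + b) + (m + c)).+2`!%:R / 4 * w (n + (a + b) + (m + c))%N).
Proof.
move=> sp sq.
have -> : form2 p n * form3 q m * (l1 ^+ a * l2 ^+ b * l3 ^+ c * y) =
    form2 (p * bernstein R a b) (n + (a + b)) *
    form3 (q * bernstein R 0 c) (m + c) * y.
  by rewrite -form2_mul_monomial // -form3_mul_monomial //; ring.
rewrite form2.unlock form3.unlock (linear_polar3 LD LZ H) //; first exact: (size_mul sp (size_bernstein a b)).
exact: (size_mul sq (size_bernstein 0 c)).
Qed.

(** The moment is a product of two integrals over [[-1, 1]] and a constant; the orthogonality proofs
    choose which integral vanishes. *)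
Lemma form3_moment_eq0 p n q m a b c : (size p <= n.+1)%N -> (size q <= m.+1)%N ->
  pint (p * ((1 - 'X) ^+ a * (1 + 'X) ^+ b)) = 0 \/
  pint ((1 - 'X) ^+ (n + (a + b)).+1 * q * (1 + 'X) ^+ c) = 0 ->
  L (form2 p n * form3 q m * (l1 ^+ a * l2 ^+ b * l3 ^+ c * y)) = 0.
Proof.
move=> sp sq z; rewrite form3_moment //; apply/eqP; rewrite !mulf_eq0 -orbA.
case: z => z; apply/orP.
  by left; rewrite bernsteinE -[p * (_ *: _)]scalerAr pintZ z mulr0.
right; apply/orP; left; rewrite bernsteinE [(1 - 'X) ^+ 0]expr0 mul1r exprZn.
set s := (1 - 'X) ^+ _ in z *; set t := (1 + 'X) ^+ _ in z *.
rewrite (_ : _ * (q * (_ *: t)) =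
    (2^-1 ^+ (n + (a + b)).+1 * (2^-1 ^+ 0 * 2^-1 ^+ c)) *: (s * q * t)).
  by rewrite pintZ z mulr0.
by rewrite -!mul_polyC [in RHS]polyCM; ring.
Qed.

End Moments.

(** * Facet functions as combinations of dual vectors *)

Section FacetForms.
Variable R : realType.
Implicit Types p q : {poly R}.

Lemma rowD (A : nmodType) n (u v : 'rV[A]_n) c : (u + v) 0 c = u 0 c + v 0 c.
Proof. by rewrite mxE. Qed.
Lemma rowB (A : zmodType) n (u v : 'rV[A]_n) c : (u - v) 0 c = u 0 c - v 0 c.
Proof. by rewrite !mxE. Qed.
Lemma rowZ (A : pzRingType) n a (u : 'rV[A]_n) c : (a *: u) 0 c = a * u 0 c.
Proof. by rewrite mxE. Qed.
Lemma gradE n (p : mpoly n R) c : grad p 0 c = mderiv c p.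
Proof. by rewrite mxE. Qed.
Lemma cross3E (A : comPzRingType) (a b : 'rV[A]_3) c : cross3 a b 0 c =
  a 0 (c + 1) * b 0 (c + 2%:R) - a 0 (c + 2%:R) * b 0 (c + 1).
Proof. by rewrite mxE. Qed.
Lemma curl3E (u : 'rV[mpoly 3 R]_3) c : curl3 u 0 c =
  mderiv (c + 1) (u 0 (c + 2%:R)) - mderiv (c + 2%:R) (u 0 (c + 1)).
Proof. by rewrite mxE. Qed.
Lemma curl2E (p : mpoly 2 R) c : curl2 p 0 c =
  if c == 0 then mderiv 1 p else - mderiv 0 p.
Proof. by rewrite mxE. Qed.

(** The coefficient of the [l]-th dual vector, read off the expanded curl: in the differential of
    [P(a / b) b ^ (n + 1)], [jacobi] multiplies [da] and [dform] multiplies [db], and [da], [db] are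
    combinations of the gradients of the coordinates. *)
Definition facet_form3 (lam : 'I_3 -> mpoly 3 R) (i j : nat) (l : 'I_3) :
    mpoly 3 R :=
  let l1 := lam 0 in let l2 := lam 1 in let l3 := lam 2%:R in
  let f2 := form2 l1 l2 in let f3 := form3 l1 l2 l3 in
  match i, j with
  | 0, 0 => lam l
  | 0, n.+1 =>
    if l == 2%:R then (- 2^-1) *: f3 (sform R n) n.+1
    else lam l * f3 (jacobi R n 3 + dform R n 3) n
  | i'.+1, _ =>
    let a := (2 * i).+1 in
    if l == 0 then - (f2 (jacobi R i 0 + dform R i 0) i *
                      f3 (jacobi R j a + dform R j a) j)
    else if l == 1 then f2 (dform R i 0 - jacobi R i 0) i *
                        f3 (jacobi R j a + dform R j a) j
    else 2 *: (f2 (jacobi R i 0) i * f3 (dform R j a - jacobi R j a) j)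
  end.

Definition facet_trace3 (lam : 'I_3 -> mpoly 3 R) (i j : nat) : mpoly 3 R :=
  let l1 := lam 0 in let l2 := lam 1 in let l3 := lam 2%:R in
  let f2 := form2 l1 l2 in let f3 := form3 l1 l2 l3 in
  match i, j with
  | 0, 0 => 1
  | 0, n.+1 => f3 (tform R n) n.+1
  | i'.+1, _ => (- 4) *: (f2 (jacobi R i 0) i * f3 (jacobi R j (2 * i).+1) j)
  end.

Definition facet_dual3 (g : 'I_3 -> 'rV[R]_3) (l : 'I_3) : 'rV[R]_3 :=
  cross3 (g (l + 1)) (g (l + 2%:R)).

Definition facet_form2 (lam : 'I_2 -> mpoly 2 R) (i : nat) (l : 'I_2) :
    mpoly 2 R :=
  let f2 := form2 (lam 0) (lam 1) in
  match i with
  | 0 => - lam l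
  | _ => if l == 0 then f2 (jacobi R i 0 + dform R i 0) i
         else f2 (jacobi R i 0 - dform R i 0) i
  end.

Definition facet_trace2 (lam : 'I_2 -> mpoly 2 R) (i : nat) : mpoly 2 R :=
  match i with
  | 0 => -1
  | _ => 2 *: form2 (lam 0) (lam 1) (jacobi R i 0) i
  end.

(** The gradient of the other vertex turned by a right angle; the sign makes both pairings equal to
    the same determinant. *)
Definition facet_dual2 (g : 'I_2 -> 'rV[R]_2) (l : 'I_2) : 'rV[R]_2 :=
  (-1) ^+ l *: \row_c (if c == 0 then g (l + 1) 0 1 else - g (l + 1) 0 0).

Section Explicit3.
Variables (lam : 'I_3 -> mpoly 3 R) (g : 'I_3 -> 'rV[R]_3).
Hypothesis dlam : forall l c, mderiv c (lam l) = mpolyC 3 (g l 0 c).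

Let sum3 (A : nmodType) (F : 'I_3 -> A) : \sum_l F l = F 0 + F 1 + F 2%:R.
Proof.
rewrite !big_ord_recl big_ord0 addr0 addrA.
by congr (_ + F _ + F _); apply/val_inj.
Qed.

Let add11 : 1 + 1 = 2%:R :> 'I_3. Proof. exact/val_inj. Qed.
Let add12 : 1 + 2%:R = 0 :> 'I_3. Proof. exact/val_inj. Qed.
Let add21 : 2%:R + 1 = 0 :> 'I_3. Proof. exact/val_inj. Qed.
Let add22 : 2%:R + 2%:R = 1 :> 'I_3. Proof. exact/val_inj. Qed.
Let addE := (add11, add12, add21, add22, @add0r 'I_3).

Let mderiv_form2 p n c : (size p <= n.+2)%N ->
  mderiv c (form2 (lam 0) (lam 1) p n.+1) =
  form2 (lam 0) (lam 1) p^`() n * (mpolyC 3 (g 1 0 c) - mpolyC 3 (g 0 0 c)) +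
  form2 (lam 0) (lam 1) (n.+1%:R *: p - 'X * p^`()) n *
    (mpolyC 3 (g 1 0 c) + mpolyC 3 (g 0 0 c)).
Proof. by move=> sp; rewrite form2.unlock mderiv_scaled // mderivB mderivD !dlam. Qed.

Let mderiv_form3 p n c : (size p <= n.+2)%N ->
  mderiv c (form3 (lam 0) (lam 1) (lam 2%:R) p n.+1) =
  form3 (lam 0) (lam 1) (lam 2%:R) p^`() n *
    (mpolyC 3 (g 2%:R 0 c) - mpolyC 3 (g 1 0 c) - mpolyC 3 (g 0 0 c)) +
  form3 (lam 0) (lam 1) (lam 2%:R) (n.+1%:R *: p - 'X * p^`()) n *
    (mpolyC 3 (g 2%:R 0 c) + mpolyC 3 (g 1 0 c) + mpolyC 3 (g 0 0 c)).
Proof. by move=> sp; rewrite form3.unlock mderiv_scaled // !(mderivB, mderivD) !dlam. Qed.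

Let sform_form3 n : (- 2^-1) *: form3 (lam 0) (lam 1) (lam 2%:R) (sform R n) n.+1 =
  - ((lam 1 + lam 0) *
     (form3 (lam 0) (lam 1) (lam 2%:R) (dform R n 3 - jacobi R n 3) n) +
     2 *: form3 (lam 0) (lam 1) (lam 2%:R) (ijacobi R n.+1 3) n.+1).
Proof.
rewrite form3_mul_sum; last first.
  by rewrite (leq_trans (size_polyD _ _)) // geq_max size_polyN size_dform size_jacobi /=.
rewrite scaleNr form3D form3Z scalerDr scalerA; congr (- (_ + _ *: _)).
by field.
Qed.

Ltac generalize_atoms :=
  repeat match goal with |- context [mpolyC 3 ?x] => generalize (mpolyC 3 x) end;
  generalize (lam 0) (lam 1) (lam 2%:R).

Let dd (p q : mpoly 3 R) (c : 'I_3) := mderiv (c + 1) p * mderiv (c + 2%:R) q -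
  mderiv (c + 2%:R) p * mderiv (c + 1) q.

Let cross3_grad (p q : mpoly 3 R) c : cross3 (grad p) (grad q) 0 c = dd p q c.
Proof. by rewrite cross3E; congr (_ * _ - _ * _); apply: gradE. Qed.

Let facet_fun3_00 c : facet_fun3 lam 0 0 0 c = lam 0 * dd (lam 1) (lam 2%:R) c +
  lam 1 * dd (lam 2%:R) (lam 0) c + lam 2%:R * dd (lam 0) (lam 1) c.
Proof.
rewrite -!cross3_grad.
by etransitivity; [exact: rowD|congr (_ + _); [
  etransitivity; [exact: rowD|congr (_ + _); exact: rowZ]|exact: rowZ]].
Qed.

Let curl3_grad (p q : mpoly 3 R) c : curl3 (p *: grad q) 0 c = dd p q c.
Proof.
rewrite curl3E; have e l : (p *: grad q) 0 l = p * mderiv l q.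
  by etransitivity; [exact: rowZ|rewrite gradE].
by rewrite !e !mderivM (mderiv_comm (c + 1)) /dd; ring.
Qed.

(** The second derivatives cancel in the curl; the term with the factor 2 is the curl of the Whitney
    form itself. *)
Let curl3_whitney (p : mpoly 3 R) c : curl3 (p *: (lam 1 *: grad (lam 0) - lam 0 *: grad (lam 1))) 0 c =
  lam 1 * dd p (lam 0) c - lam 0 * dd p (lam 1) c - 2 * p * dd (lam 0) (lam 1) c.
Proof.
rewrite curl3E.
have e l : (p *: (lam 1 *: grad (lam 0) - lam 0 *: grad (lam 1))) 0 l =
    p * (lam 1 * mderiv l (lam 0) - lam 0 * mderiv l (lam 1)).
  etransitivity; [exact: rowZ|congr (_ * _)].
  by etransitivity; [exact: rowB|congr (_ - _); (etransitivity; [exact: rowZ|rewrite gradE])].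
rewrite !e !(mderivM, mderivB) (mderiv_comm (c + 1) _ (lam 0)).
rewrite (mderiv_comm (c + 1) _ (lam 1)) /dd.
move: (mderiv (c + 1) (mderiv (c + 2%:R) (lam 0))) (mderiv (c + 1) (mderiv (c + 2%:R) (lam 1))).
move: (mderiv (c + 1) (lam 0)) (mderiv (c + 2%:R) (lam 0)) (mderiv (c + 1) (lam 1)).
move: (mderiv (c + 2%:R) (lam 1)) (mderiv (c + 1) p) (mderiv (c + 2%:R) p) (lam 0) (lam 1) => *.
ring.
Qed.

(* (vr grad r + vw grad w) x (ua grad a + ub grad b) in terms of the cross
   products of the gradients of the barycentric coordinates *)
Let curl_forms_identity (A : comPzRingType) (ua ub vr vw a1 a2 b1 b2 c1 c2 : A) :
  (vr * (c1 - b1 - a1) + vw * (c1 + b1 + a1)) *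
  (ua * (b2 - a2) + ub * (b2 + a2)) -
  (vr * (c2 - b2 - a2) + vw * (c2 + b2 + a2)) *
  (ua * (b1 - a1) + ub * (b1 + a1)) =
  - ((ua + ub) * (vr + vw)) * (b1 * c2 - b2 * c1) +
  (ub - ua) * (vr + vw) * (c1 * a2 - c2 * a1) +
  2%:R * (ua * (vw - vr)) * (a1 * b2 - a2 * b1).
Proof. by ring. Qed.

Lemma facet_fun3E i j c : facet_fun3 lam i j 0 c =
  \sum_l facet_form3 lam i j l * mpolyC 3 (facet_dual3 g l 0 c).
Proof.
rewrite sum3 /facet_dual3 !cross3E !addE !(mpolyCB, mpolyCM).
case: i => [|i].
  case: j => [|n].
    rewrite facet_fun3_00 /dd !dlam /=; generalize_atoms => *; ring.
  have -> : facet_fun3 lam 0 n.+1 =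
      curl3 (form3 (lam 0) (lam 1) (lam 2%:R) (ijacobi R n.+1 3) n.+1
        *: (lam 1 *: grad (lam 0) - lam 0 *: grad (lam 1))) by rewrite form3.unlock.
  rewrite curl3_whitney /dd.
  rewrite !mderiv_form3 ?size_ijacobi // !dlam ijacobiS_deriv -!/(dform R n 3).
  rewrite /facet_form3 !eqxx sform_form3 /=.
  rewrite !(form3D _ _ _ (jacobi R n 3) (dform R n 3)) -mul_mpolyC mpolyC_nat.
  rewrite !(form3B _ _ _ (dform R n 3) (jacobi R n 3)).
  move: (form3 _ _ _ (jacobi R n 3) n) (form3 _ _ _ (dform R n 3) n).
  move: (form3 _ _ _ (ijacobi R n.+1 3) n.+1); generalize_atoms => *.
  by ring.
(* The first index is [i.+1], so the second factor has the parameter [2 (i + 2) - 1], which is this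
   [a]. *)
pose a := (2 * i.+1).+1.
pose V := form3 (lam 0) (lam 1) (lam 2%:R) (ijacobi R j.+1 a) j.+1.
pose U := form2 (lam 0) (lam 1) (ijacobi R i.+2 0) i.+2.
have -> : facet_fun3 lam i.+1 j 0 c = dd V U c.
  by rewrite -curl3_grad /V /U form3.unlock form2.unlock /a (_ : (2 * i.+1).+1 = (2 * i.+2 - 1)%N); last by lia.
have dV e := @mderiv_form3 (ijacobi R j.+1 a) j e (size_ijacobi R j.+1 a).
have dU e := @mderiv_form2 (ijacobi R i.+2 0) i.+1 e (size_ijacobi R i.+2 0).
rewrite -/V ijacobiS_deriv -/(dform R j a) in dV.
rewrite -/U ijacobiS_deriv -/(dform R i.+1 0) in dU.
rewrite /dd !dV !dU -/a {dV dU U V}.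
rewrite /facet_form3 !eqxx [(1 : 'I_3) == 0](_ : _ = false) //.
rewrite [(2%:R : 'I_3) == 0](_ : _ = false) // [(2%:R : 'I_3) == 1](_ : _ = false) //.
rewrite -mul_mpolyC mpolyC_nat.
rewrite !(form3D _ _ _ (jacobi R j _) (dform R j _)).
rewrite !(form3B _ _ _ (dform R j _) (jacobi R j _)).
rewrite !(form2D _ _ (jacobi R i.+1 _) (dform R i.+1 _)).
rewrite !(form2B _ _ (dform R i.+1 _) (jacobi R i.+1 _)).
exact: curl_forms_identity.
Qed.

End Explicit3.
End FacetForms.

(** * Roots and degrees of the forms *)

Section FormLemmas.
Variable R : realType.
Implicit Types p q : {poly R}.

Lemma horner_dform n a c : (dform R n a).[c] =
  n.+1%:R * (ijacobi R n.+1 a).[c] - c * (jacobi R n a).[c].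
Proof. by rewrite /dform hornerD hornerN hornerZ hornerM hornerX. Qed.

(** The Jacobi terms cancel at 1 and the integrated Legendre polynomial is 0 there; 1 is the ratio
    [(l2 - l1) / (l2 + l1)] where [l1 = 0]. At -1, the ratio where the last coordinate is 0, the
    difference plays this part. *)
Lemma dform_add_root n : (jacobi R n.+1 0 + dform R n.+1 0).[1] = 0.
Proof. by rewrite hornerD horner_dform ijacobi0_1; ring. Qed.

Lemma dform_sub_root n a : (dform R n a - jacobi R n a).[-1] = 0.
Proof. by rewrite hornerD hornerN horner_dform ijacobiS_N1; ring. Qed.

Lemma sform_root n : (sform R n).[-1] = 0.
Proof.
by rewrite hornerD hornerM dform_sub_root mulr0 add0r hornerZ ijacobiS_N1 mulr0.
Qed.

Lemma size_dform_add n a : (size (jacobi R n a + dform R n a)%R <= n.+1)%N.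
Proof.
by rewrite (leq_trans (size_polyD _ _)) // geq_max size_jacobi size_dform leqnn.
Qed.

Lemma size_dform_sub n a : (size (dform R n a - jacobi R n a)%R <= n.+1)%N.
Proof.
by rewrite (leq_trans (size_polyD _ _)) // geq_max size_polyN size_jacobi size_dform leqnn.
Qed.

Lemma deg_lt_scaled d p n (a b : mpoly d R) : deg_lt 2 a -> deg_lt 2 b ->
  deg_lt n.+1 (scaled p n a b).
Proof.
move=> ha hb; apply: deg_lt_sum => m _.
have mn : (m <= n)%N by rewrite -ltnS.
rewrite -mulrA mul_mpolyC; apply: deg_ltZ; rewrite -{1}(subnKC mn).
by apply: deg_ltM; rewrite -[X in deg_lt X.+1]muln1; apply: deg_ltX.
Qed.

Section FormDegrees.
Variables (d : nat) (l1 l2 l3 : mpoly d R).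
Hypotheses (h1 : deg_lt 2 l1) (h2 : deg_lt 2 l2) (h3 : deg_lt 2 l3).

Lemma deg_lt_form2 p n : deg_lt n.+1 (form2 l1 l2 p n).
Proof.
by rewrite form2.unlock; apply: deg_lt_scaled; [apply: deg_ltB|apply: deg_ltD].
Qed.

Lemma deg_lt_form3 p n : deg_lt n.+1 (form3 l1 l2 l3 p n).
Proof.
rewrite form3.unlock.
by apply: deg_lt_scaled; [do 2! apply: deg_ltB => //|do 2! apply: deg_ltD => //].
Qed.
End FormDegrees.

Section FormValues.
Variables (d : nat) (l1 l2 l3 : mpoly d R) (x : 'rV[R]_d).

Lemma peval_form2_l1 p n : (size p <= n.+1)%N -> p.[1] = 0 ->
  peval l1 x = 0 -> peval (form2 l1 l2 p n) x = 0.
Proof.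
move=> sp p1 l0; rewrite form2.unlock (@peval_scaled _ _ _ _ _ _ _ 1) ?p1 ?mul0r //.
by rewrite pevalB pevalD l0 subr0 addr0 mul1r.
Qed.

Lemma peval_form2_l2 p n : (size p <= n.+1)%N -> p.[-1] = 0 ->
  peval l2 x = 0 -> peval (form2 l1 l2 p n) x = 0.
Proof.
move=> sp p1 l0; rewrite form2.unlock (@peval_scaled _ _ _ _ _ _ _ (-1)) ?p1 ?mul0r //.
by rewrite pevalB pevalD l0 sub0r add0r mulN1r.
Qed.

Lemma peval_form3_l3 p n : (size p <= n.+1)%N -> p.[-1] = 0 ->
  peval l3 x = 0 -> peval (form3 l1 l2 l3 p n) x = 0.
Proof.
move=> sp p1 l0; rewrite form3.unlock (@peval_scaled _ _ _ _ _ _ _ (-1)) ?p1 ?mul0r //.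
by rewrite !pevalB !pevalD l0 sub0r add0r mulN1r opprD.
Qed.

End FormValues.

Lemma pint_weight_sqr_gt0 m p : p != 0 ->
  0 < pint ((2^-1 *: (1 - 'X)) ^+ m * (p ^+ 2)).
Proof.
move=> p0; apply: pint_gt0.
  rewrite mulf_neq0 ?expf_neq0 // -mul_polyC mulf_neq0 ?one_subX_neq0 //.
  by rewrite polyC_eq0 invr_eq0 pnatr_eq0.
move=> x /andP[_ x1]; have e : (1 - 'X : {poly R}).[x] = 1 - x by rewrite !hornerE.
rewrite hornerM !horner_exp hornerZ e mulr_ge0 ?sqr_ge0 //.
by rewrite exprn_ge0 // mulr_ge0 ?invr_ge0 ?ler0n // subr_ge0.
Qed.

Lemma exprD_mulA (A : comPzRingType) (s q t : A) m e :
  s ^+ (m + e) * q * t = s ^+ m * q * (s ^+ e * t).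
Proof. by rewrite exprD; ring. Qed.

Lemma size_mul_le p q m n : (size p <= m.+1)%N -> (size q <= n.+1)%N ->
  (size (p * q)%R <= (m + n).+1)%N.
Proof.
move=> sp sq; apply: leq_trans (size_polyMleq _ _) _.
by have := leq_add sp sq; rewrite addSn addnS; case: (_ + _)%N.
Qed.

End FormLemmas.

(** * Facet functions in three dimensions *)

Section Facet3.
Variable R : realType.
Implicit Types p q : {poly R}.

Lemma sum_ord3 (A : nmodType) (F : 'I_3 -> A) : \sum_l F l = F 0 + F 1 + F 2%:R.
Proof.
rewrite !big_ord_recl big_ord0 addr0 addrA.
by congr (_ + F _ + F _); apply/val_inj.
Qed.

Lemma prod_ord3 (A : pzSemiRingType) (F : 'I_3 -> A) : \prod_l F l = F 0 * F 1 * F 2%:R.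
Proof.
rewrite !big_ord_recl big_ord0 mulr1 mulrA.
by congr (_ * F _ * F _); apply/val_inj.
Qed.

Lemma ord3P (P : 'I_3 -> Prop) : P 0 -> P 1 -> P 2%:R -> forall l, P l.
Proof.
move=> P0 P1 P2 [[|[|[|//]]] h].
- by rewrite (_ : Ordinal h = 0) //; apply/val_inj.
- by rewrite (_ : Ordinal h = 1) //; apply/val_inj.
- by rewrite (_ : Ordinal h = 2%:R) //; apply/val_inj.
Qed.

Variable lam : 'I_3 -> mpoly 3 R.
Local Notation f2 := (form2 (lam 0) (lam 1)).
Local Notation f3 := (form3 (lam 0) (lam 1) (lam 2%:R)).

(** A vanishing coordinate is either a factor of the form or puts a ratio at 1 or -1, where a factor
    has a root. This is why the flux through the other facets is 0. *)
Lemma facet_form3_root i j l x : peval (lam l) x = 0 ->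
  peval (facet_form3 lam i j l) x = 0.
Proof.
case: i => [|i].
  case: j => [|n] // h; rewrite /facet_form3; case: eqP => [l2|_].
    by rewrite pevalZ peval_form3_l3 ?mulr0 ?size_sform ?sform_root -?l2.
  by rewrite pevalM h mul0r.
move: l; apply: ord3P => h; rewrite /facet_form3 /= ?pevalN ?pevalZ pevalM.
- by rewrite peval_form2_l1 ?mul0r ?oppr0 ?size_dform_add ?dform_add_root.
- by rewrite peval_form2_l2 ?mul0r ?size_dform_sub ?dform_sub_root.
- by rewrite (@peval_form3_l3 _ _ _ _ _ x _ j) ?mulr0 ?size_dform_sub ?dform_sub_root.
Qed.

Let trace_forms_identity (A : comPzRingType) (ua ub vr vw : A) :
  - ((ua + ub) * (vr + vw)) + (ub - ua) * (vr + vw) + 2%:R * (ua * (vw - vr)) =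
  - (4%:R * (ua * vr)).
Proof. by ring. Qed.

(** For [i > 0] the [dform] terms cancel in the sum, and for [i = 0], [j > 0] they combine to
    [tform]; for the lowest function the sum is that of the coordinates, which is 1 on the facet. *)
Lemma sum_facet_form3 i j x : \sum_l peval (lam l) x = 1 ->
  \sum_l peval (facet_form3 lam i j l) x = peval (facet_trace3 lam i j) x.
Proof.
case: i => [|i]; first case: j => [|n] h.
- by rewrite /facet_trace3 peval1.
- rewrite -peval_sum; congr (peval _ x); rewrite sum_ord3 /facet_form3 /facet_trace3 /=.
  rewrite -mulrDl [lam 0 + _]addrC !form3_mul_sum ?size_dform_add //.
  rewrite scaleNr -scalerBr -form3B.
  rewrite (_ : _ - sform R n = 2%:R *: tform R n); last first.
    by rewrite /sform /tform -!mul_polyC !polyC_natr; ring.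
  by rewrite form3Z scalerA mulVf ?scale1r // pnatr_eq0.
move=> _; rewrite -peval_sum; congr (peval _ x).
rewrite sum_ord3 /facet_form3 /facet_trace3 /=.
rewrite !(form3D _ _ _ (jacobi R j _) (dform R j _)).
rewrite !(form3B _ _ _ (dform R j _) (jacobi R j _)).
rewrite !(form2D _ _ (jacobi R i.+1 _) (dform R i.+1 _)).
rewrite !(form2B _ _ (dform R i.+1 _) (jacobi R i.+1 _)).
rewrite scaleNr -!mul_mpolyC !mpolyC_nat.
exact: trace_forms_identity.
Qed.

Lemma deg_lt_facet_form3 i j l : (forall m, deg_lt 2 (lam m)) -> (0 < i + j)%N ->
  deg_lt (i + j).+1 (facet_form3 lam i j l).
Proof.
move=> h; have d2 := deg_lt_form2 (h 0) (h 1).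
have d3 := deg_lt_form3 (h 0) (h 1) (h 2%:R).
case: i => [|i]; first case: j => [|n] // _; rewrite /facet_form3.
  by case: eqP => _; [exact/deg_ltZ/d3|apply: (@deg_ltM _ _ 1 n)].
move=> _; case: eqP => _; first by apply/deg_ltN/deg_ltM.
by case: eqP => _; [apply/deg_ltM|apply/deg_ltZ/deg_ltM].
Qed.

Lemma deg_lt_facet_trace3 i j : (forall m, deg_lt 2 (lam m)) ->
  deg_lt (i + j).+1 (facet_trace3 lam i j).
Proof.
move=> h; case: i => [|i]; first case: j => [|n]; rewrite /facet_trace3.
- by rewrite -mpolyC1; apply: deg_ltC.
- exact: deg_lt_form3.
by apply/deg_ltZ/deg_ltM; [apply: deg_lt_form2|apply: deg_lt_form3].
Qed.

Lemma div_facet_fun3 i j : (0 < i + j)%N ->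
  \sum_c mderiv c (facet_fun3 lam i j 0 c) = 0.
Proof.
have div_curl (U : 'rV[mpoly 3 R]_3) : \sum_c mderiv c (curl3 U 0 c) = 0.
  under eq_bigr => c _ do rewrite curl3E mderivB.
  rewrite sum_ord3 !add0r.
  have -> : 1 + 1 = 2%:R :> 'I_3 by apply/val_inj.
  have -> : 1 + 2%:R = 0 :> 'I_3 by apply/val_inj.
  have -> : 2%:R + 1 = 0 :> 'I_3 by apply/val_inj.
  have -> : 2%:R + 2%:R = 1 :> 'I_3 by apply/val_inj.
  rewrite (mderiv_comm 1 0) (mderiv_comm 2%:R 1) (mderiv_comm 2%:R 0).
  by move: (mderiv _ _) (mderiv _ _) (mderiv _ _) => *; ring.
by case: i => [|i]; first case: j => [|n] // _; first apply: div_curl; move=> _; apply: div_curl.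
Qed.

Variable L : mpoly 3 R -> R.
Hypothesis LD : forall f g, L (f + g) = L f + L g.
Hypothesis LZ : forall c f, L (c *: f) = c * L f.

Let LN f : L (- f) = - L f.
Proof. by rewrite -scaleN1r LZ mulN1r. Qed.

Variables (y : mpoly 3 R) (w : nat -> R).
Hypothesis H : forall a b c, L (lam 0 ^+ a * lam 1 ^+ b * lam 2%:R ^+ c * y) =
  (a`! * b`! * c`!)%:R * w (a + b + c)%N.

Let shuffle1 (A : comPzRingType) (l f a b c z : A) :
  l * f * (a * b * c * z) = 1 * f * (l * a * b * c * z).
Proof. by ring. Qed.

Let shuffle2 (A : comPzRingType) (l f a b c z : A) :
  l * f * (a * b * c * z) = 1 * f * (a * (l * b) * c * z).
Proof. by ring. Qed.

(** For [i > 0] the monomial is shared between two integrals. If [a + b] is small against [i], the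
    first vanishes; otherwise the excess of [a + b] completes the Jacobi weight in the second, and
    what remains has low enough degree. *)
Lemma facet_form3_orthogonal i j l a b c : (a + b + c + 2 <= i + j)%N ->
  L (facet_form3 lam i j l * (lam 0 ^+ a * lam 1 ^+ b * lam 2%:R ^+ c * y)) = 0.
Proof.
have moment0 := form3_moment_eq0 LD LZ H.
case: i => [|i]; first case: j => [|n] h; first by lia.
  move: l; apply: ord3P; rewrite /facet_form3 /=.
  (* The factor [lam 0] joins the monomial; this yields the weight [(1 - 'X) ^+ 2] that goes with
     parameter 3. *)
  - rewrite (_ : _ * _ = f2 1 0 * f3 (jacobi R n 3 + dform R n 3) n *
      (lam 0 ^+ a.+1 * lam 1 ^+ b * lam 2%:R ^+ c * y)); last first.
      by rewrite form2_0 exprS; exact: shuffle1.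
    apply: moment0; rewrite ?size_poly1 ?size_dform_add //; right.
    rewrite (_ : (0 + (a.+1 + b)).+1 = 2 + (a + b))%N; last by lia.
    rewrite exprD_mulA.
    apply: dform_sum_orthogonal; apply: leq_trans (size_weights _ _ _) _; lia.
  - rewrite (_ : _ * _ = f2 1 0 * f3 (jacobi R n 3 + dform R n 3) n *
      (lam 0 ^+ a * lam 1 ^+ b.+1 * lam 2%:R ^+ c * y)); last first.
      by rewrite form2_0 exprS; exact: shuffle2.
    apply: moment0; rewrite ?size_poly1 ?size_dform_add //; right.
    rewrite (_ : (0 + (a + b.+1)).+1 = 2 + (a + b))%N; last by lia.
    rewrite exprD_mulA.
    apply: dform_sum_orthogonal; apply: leq_trans (size_weights _ _ _) _; lia.
  - rewrite -scalerAl LZ -[f3 _ _]mul1r -(form2_0 (lam 0) (lam 1)) moment0 ?mulr0 ?size_poly1 ?size_sform //.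
    by right; rewrite add0n; apply: sform_orthogonal; lia.
move=> h; move: l; apply: ord3P; rewrite /facet_form3 /=.
- rewrite mulNr LN moment0 ?oppr0 ?size_dform_add //.
  have [ab|ab] := leqP (a + b + 2) i.+1.
    left; rewrite -[jacobi _ _ _]scale1r; apply: dform0_orthogonal.
    by apply: leq_trans (size_weights _ _ _) _; lia.
  right; rewrite (_ : (i.+1 + (a + b)).+1 = 2 * i.+1 + (a + b + 1 - i.+1))%N; last by lia.
  rewrite exprD_mulA.
  by apply: dform_sum_orthogonal; apply: leq_trans (size_weights _ _ _) _; lia.
- rewrite moment0 ?size_dform_add ?size_dform_sub //.
  have [ab|ab] := leqP (a + b + 2) i.+1.
    left; rewrite addrC -scaleN1r; apply: dform0_orthogonal.
    by apply: leq_trans (size_weights _ _ _) _; lia.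
  right; rewrite (_ : (i.+1 + (a + b)).+1 = 2 * i.+1 + (a + b + 1 - i.+1))%N; last by lia.
  rewrite exprD_mulA.
  by apply: dform_sum_orthogonal; apply: leq_trans (size_weights _ _ _) _; lia.
- rewrite -scalerAl LZ moment0 ?mulr0 ?size_jacobi ?size_dform_sub //.
  have [ab|ab] := leqP (a + b + 1) i.+1.
    left; apply: legendre_orthogonal.
    by apply: leq_trans (size_weights _ _ _) _; lia.
  right; rewrite (_ : (i.+1 + (a + b)).+1 = (2 * i.+1).+1 + (a + b - i.+1))%N; last by lia.
  rewrite exprD_mulA.
  apply: dform_diff_orthogonal; apply: leq_ltn_trans (size_weights _ _ _) _; lia.
Qed.

Lemma facet_trace3_orthogonal i j a b c : (a + b + c < i + j)%N ->
  L (facet_trace3 lam i j * (lam 0 ^+ a * lam 1 ^+ b * lam 2%:R ^+ c * y)) = 0.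
Proof.
have moment0 := form3_moment_eq0 LD LZ H.
case: i => [|i]; first case: j => [|n] h; first by lia.
  rewrite -[facet_trace3 _ _ _]/(f3 (tform R n) n.+1) -[f3 _ _]mul1r.
  rewrite -(form2_0 (lam 0) (lam 1)).
  rewrite moment0 ?size_poly1 ?size_tform //.
  by right; rewrite add0n; apply: tform_orthogonal; lia.
move=> h; rewrite /facet_trace3 -scalerAl LZ moment0 ?mulr0 ?size_jacobi //.
have [ab|ab] := leqP (a + b + 1) i.+1.
  left; apply: legendre_orthogonal.
  by apply: leq_trans (size_weights _ _ _) _; lia.
right; rewrite (_ : (i.+1 + (a + b)).+1 = (2 * i.+1).+1 + (a + b - i.+1))%N; last by lia.
rewrite exprD_mulA.
by apply: jacobi_orthogonal; apply: leq_trans (size_weights _ _ _) _; lia.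
Qed.

Let moment00 p n q m : (size p <= n.+1)%N -> (size q <= m.+1)%N ->
  L (f2 p n * f3 q m * y) =
  pint p * pint ((2^-1 *: (1 - 'X)) ^+ n.+1 * q) * ((n + m).+2`!%:R / 4 * w (n + m)%N).
Proof.
move=> sp sq; have := form3_moment LD LZ H 0 0 0 sp sq.
by rewrite !expr0 !mul1r /bernstein !expr0 !mulr1 !addn0.
Qed.

(** Total degree cannot separate these traces. The first integral does: it pairs Legendre
    polynomials of different degrees, index 0 contributing a constant. *)
Lemma facet_trace3_disjoint i j i' j' : i != i' -> (i + j = i' + j')%N ->
  L (facet_trace3 lam i j * facet_trace3 lam i' j' * y) = 0.
Proof.
wlog ii : i j i' j' / (i < i')%N => [hw|] ne e.
  case: (ltngtP i i') => [lt|gt|eq]; first exact: (hw _ _ _ _ lt).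
    by rewrite [X in L (X * _)]mulrC; apply: (hw _ _ _ _ gt) => //; rewrite eq_sym.
  by rewrite eq eqxx in ne.
case: i' ii e {ne} => // i' ii e; rewrite /facet_trace3.
case: i ii e => [|i] ii e.
  case: j e => [|n] e; first by lia.
  rewrite -scalerAr -scalerAl LZ mulrCA form3M ?size_tform ?size_jacobi //.
  rewrite moment00 ?size_jacobi ?size_mul_le ?size_tform ?size_jacobi //.
  by rewrite -[jacobi R i'.+1 0]mulr1 legendre_orthogonal ?size_poly1 // !mul0r mulr0.
rewrite -!scalerAl -scalerAr -scalerAl !LZ mulrACA form2M ?form3M ?size_jacobi //.
rewrite moment00 ?size_mul_le ?size_jacobi //.
by rewrite [X in pint X]mulrC legendre_orthogonal ?size_jacobi // !(mul0r, mulr0).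
Qed.

(** Explicit squared norms, determined by the indices and the weight [w]; on facets their inverses
    enter the stability constant. *)
Definition facet_norm3 i j : R :=
  match i, j with
  | 0, 0 => w 0
  | 0, n.+1 => pint 1 * pint ((2^-1 *: (1 - 'X)) ^+ 1 * tform R n ^+ 2) *
      ((n.+1 + n.+1).+2`!%:R / 4 * w (n.+1 + n.+1)%N)
  | _, _ => 16 * (pint (jacobi R i 0 ^+ 2) *
      pint ((2^-1 *: (1 - 'X)) ^+ (i + i).+1 * jacobi R j (2 * i).+1 ^+ 2) *
      ((i + i + (j + j)).+2`!%:R / 4 * w (i + i + (j + j))%N))
  end.

Lemma facet_norm3_gt0 i j : (forall n, 0 < w n) -> 0 < facet_norm3 i j.
Proof.
move=> w0; have f0 n : 0 < n`!%:R :> R by rewrite ltr0n fact_gt0.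
have pw p : p != 0 -> 0 < pint (p ^+ 2).
  by move=> p0; have := pint_weight_sqr_gt0 0 p0; rewrite expr0 mul1r.
have j0 n a : jacobi R n a != 0 by rewrite -size_poly_eq0 size_jacobi.
case: i => [|i]; first case: j => [|n]; rewrite /facet_norm3; first exact: w0.
  rewrite !mulr_gt0 ?f0 ?w0 ?invr_gt0 ?ltr0n ?pint_weight_sqr_gt0 ?tform_neq0 //.
  by rewrite -(expr1n _ 2) pw ?oner_eq0.
by rewrite !mulr_gt0 ?f0 ?w0 ?invr_gt0 ?ltr0n ?pint_weight_sqr_gt0 ?pw ?j0.
Qed.

Lemma facet_trace3_norm i j :
  L (facet_trace3 lam i j * facet_trace3 lam i j * y) = facet_norm3 i j.
Proof.
case: i => [|i]; first case: j => [|n]; rewrite /facet_trace3 /facet_norm3.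
- by have := H 0 0 0; rewrite !expr0 !mul1r.
- rewrite -[X in L (X * _)]mul1r -[X in X * _ * _](form2_0 (lam 0) (lam 1)).
  by rewrite form3M ?size_tform // moment00 ?size_poly1 ?size_mul_le ?size_tform.
rewrite (_ : _ * y = (-4 * -4) *: (f2 (jacobi R i.+1 0) i.+1 * f2 (jacobi R i.+1 0) i.+1 *
  (f3 (jacobi R j (2 * i.+1).+1) j * f3 (jacobi R j (2 * i.+1).+1) j) * y)); last first.
  by rewrite -!scalerAl -scalerAr -scalerAl scalerA mulrACA.
rewrite LZ form2M ?form3M ?size_jacobi // moment00 ?size_mul_le ?size_jacobi // -!expr2.
by congr (_ * _); ring.
Qed.

End Facet3.

(** * Facet functions in two dimensions *)

Section Facet2.
Variable R : realType.
Implicit Types p q : {poly R}.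

Lemma sum_ord2 (A : nmodType) (F : 'I_2 -> A) : \sum_l F l = F 0 + F 1.
Proof. by rewrite !big_ord_recl big_ord0 addr0; congr (_ + F _); apply/val_inj. Qed.

Lemma prod_ord2 (A : pzSemiRingType) (F : 'I_2 -> A) : \prod_l F l = F 0 * F 1.
Proof. by rewrite !big_ord_recl big_ord0 mulr1; congr (_ * F _); apply/val_inj. Qed.

Lemma ord2P (P : 'I_2 -> Prop) : P 0 -> P 1 -> forall l, P l.
Proof.
move=> P0 P1 [[|[|//]] h].
- by rewrite (_ : Ordinal h = 0) //; apply/val_inj.
- by rewrite (_ : Ordinal h = 1) //; apply/val_inj.
Qed.

Lemma facet_dual2_0 (g : 'I_2 -> 'rV[R]_2) c :
  facet_dual2 g 0 0 c = if c == 0 then g 1 0 1 else - g 1 0 0.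
Proof. by rewrite /facet_dual2 rowZ expr0 mul1r mxE add0r. Qed.

Lemma facet_dual2_1 (g : 'I_2 -> 'rV[R]_2) c :
  facet_dual2 g 1 0 c = - if c == 0 then g 0 0 1 else - g 0 0 0.
Proof.
rewrite /facet_dual2 rowZ expr1 mulN1r mxE.
by rewrite (_ : 1 + 1 = 0 :> 'I_2) //; apply/val_inj.
Qed.

Variable lam : 'I_2 -> mpoly 2 R.
Local Notation f2 := (form2 (lam 0) (lam 1)).

Let form2_identity (A : comPzRingType) (ua ub a1 b1 : A) :
  ua * (b1 - a1) + ub * (b1 + a1) = (ua + ub) * b1 + (ua - ub) * - a1.
Proof. by ring. Qed.

Lemma facet_fun2E (g : 'I_2 -> 'rV[R]_2) i j c :
  (forall l c, mderiv c (lam l) = mpolyC 2 (g l 0 c)) ->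
  facet_fun2 lam i j 0 c =
  \sum_l facet_form2 lam i l * mpolyC 2 (facet_dual2 g l 0 c).
Proof.
move=> dlam; rewrite sum_ord2 facet_dual2_0 facet_dual2_1.
case: i => [|i].
  have -> : facet_fun2 lam 0 j 0 c =
      lam 1 * curl2 (lam 0) 0 c - lam 0 * curl2 (lam 1) 0 c.
    by etransitivity; [exact: rowB|congr (_ - _); exact: rowZ].
  rewrite !curl2E !dlam /facet_form2; case: (c == 0); rewrite !mpolyCN.
    by move: (mpolyC 2 (g 0 0 1)) (mpolyC 2 (g 1 0 1)) => *; ring.
  by move: (mpolyC 2 (g 0 0 0)) (mpolyC 2 (g 1 0 0)) => *; ring.
have -> : facet_fun2 lam i.+1 j 0 c = curl2 (f2 (ijacobi R i.+2 0) i.+2) 0 c.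
  by rewrite form2.unlock.
have dU e : mderiv e (f2 (ijacobi R i.+2 0) i.+2) =
    f2 (jacobi R i.+1 0) i.+1 * (mpolyC 2 (g 1 0 e) - mpolyC 2 (g 0 0 e)) +
    f2 (dform R i.+1 0) i.+1 * (mpolyC 2 (g 1 0 e) + mpolyC 2 (g 0 0 e)).
  rewrite form2.unlock mderiv_scaled ?size_ijacobi // mderivB mderivD !dlam.
  by rewrite ijacobiS_deriv.
rewrite curl2E !dU /facet_form2 eqxx [(1 : 'I_2) == 0](_ : _ = false) //.
rewrite (form2D _ _ (jacobi R _ _)) (form2B _ _ (jacobi R _ _)).
case: (c == 0); rewrite !mpolyCN; first exact: form2_identity.
by rewrite opprK form2_identity opprD -!mulrN !opprK.
Qed.

Lemma facet_form2_root i l x : peval (lam l) x = 0 ->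
  peval (facet_form2 lam i l) x = 0.
Proof.
case: i => [|i]; first by move=> h; rewrite pevalN h oppr0.
move: l; apply: ord2P => h; rewrite /facet_form2 /=.
  by rewrite peval_form2_l1 ?size_dform_add ?dform_add_root.
rewrite -[X in f2 X](opprB (dform R i.+1 0)) -scaleN1r form2Z pevalZ.
by rewrite peval_form2_l2 ?mulr0 ?size_dform_sub ?dform_sub_root.
Qed.

Lemma sum_facet_form2 i x : \sum_l peval (lam l) x = 1 ->
  \sum_l peval (facet_form2 lam i l) x = peval (facet_trace2 lam i) x.
Proof.
case: i => [|i] h.
  rewrite /facet_form2 /facet_trace2 pevalN peval1 -h -sumrN.
  by apply: eq_bigr => l _; rewrite pevalN.
rewrite -peval_sum; congr (peval _ x); rewrite sum_ord2 /facet_form2 /facet_trace2 /=.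
by rewrite -form2D addrACA subrr addr0 -mulr2n -scaler_nat form2Z.
Qed.

Lemma deg_lt_facet_form2 i l : (forall m, deg_lt 2 (lam m)) -> (0 < i)%N ->
  deg_lt i.+1 (facet_form2 lam i l).
Proof.
move=> h; have d2 := deg_lt_form2 (h 0) (h 1).
by case: i => [|i] // _; rewrite /facet_form2; case: eqP.
Qed.

Lemma deg_lt_facet_trace2 i : (forall m, deg_lt 2 (lam m)) ->
  deg_lt i.+1 (facet_trace2 lam i).
Proof.
move=> h; case: i => [|i]; rewrite /facet_trace2.
  by rewrite -mpolyC1 -mpolyCN; apply: deg_ltC.
exact/deg_ltZ/deg_lt_form2.
Qed.

Lemma div_facet_fun2 i j : (0 < i)%N ->
  \sum_c mderiv c (facet_fun2 lam i j 0 c) = 0.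
Proof.
case: i => // i _; rewrite /facet_fun2 sum_ord2 !curl2E eqxx.
rewrite [(1 : 'I_2) == 0](_ : _ = false) // mderivN (mderiv_comm 0 1).
by rewrite subrr.
Qed.

Variable L : mpoly 2 R -> R.
Hypothesis LD : forall f g, L (f + g) = L f + L g.
Hypothesis LZ : forall c f, L (c *: f) = c * L f.
Variables (y : mpoly 2 R) (w : nat -> R).
Hypothesis H : forall a b, L (lam 0 ^+ a * lam 1 ^+ b * y) =
  (a`! * b`!)%:R * w (a + b)%N.

Lemma facet_form2_orthogonal i l a b : (a + b + 2 <= i)%N ->
  L (facet_form2 lam i l * (lam 0 ^+ a * lam 1 ^+ b * y)) = 0.
Proof.
have moment0 := fun p n a b sp => form2_moment_eq0 LD LZ (p := p) (n := n) (a := a) (b := b) sp H.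
case: i => [|i] h; first by lia.
move: l; apply: ord2P; rewrite /facet_form2 /=.
  rewrite moment0 ?size_dform_add // -[jacobi _ _ _]scale1r; apply: dform0_orthogonal.
  by apply: leq_trans (size_weights _ _ _) _; lia.
rewrite moment0 //.
  by rewrite -opprB size_polyN size_dform_sub.
have e := @dform0_orthogonal R i (-1) ((1 - 'X) ^+ a * (1 + 'X) ^+ b).
rewrite (_ : _ - _ = - (-1 *: jacobi R i.+1 0 + dform R i.+1 0)).
  by rewrite mulNr pintN e ?oppr0 //; apply: leq_trans (size_weights _ _ _) _; lia.
by rewrite -mul_polyC polyCN polyC1; ring.
Qed.

Lemma facet_trace2_orthogonal i a b : (a + b < i)%N ->
  L (facet_trace2 lam i * (lam 0 ^+ a * lam 1 ^+ b * y)) = 0.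
Proof.
case: i => [|i] // h; rewrite /facet_trace2 -scalerAl LZ.
have moment0 := fun p n a b sp => form2_moment_eq0 LD LZ (p := p) (n := n) (a := a) (b := b) sp H.
rewrite moment0 ?mulr0 ?size_jacobi //.
by apply: legendre_orthogonal; apply: leq_trans (size_weights _ _ _) _.
Qed.

Definition facet_norm2 i : R :=
  match i with
  | 0 => w 0
  | _ => 4 * (pint (jacobi R i 0 ^+ 2) * ((i + i).+1`!%:R / 2 * w (i + i)%N))
  end.

Lemma facet_norm2_gt0 i : (forall n, 0 < w n) -> 0 < facet_norm2 i.
Proof.
move=> w0; have f0 n : 0 < n`!%:R :> R by rewrite ltr0n fact_gt0.
have j0 n a : jacobi R n a != 0 by rewrite -size_poly_eq0 size_jacobi.
case: i => [|i]; rewrite /facet_norm2; first exact: w0.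
have := pint_weight_sqr_gt0 0 (j0 i.+1 0%N); rewrite expr0 mul1r => pw.
by rewrite !mulr_gt0 ?f0 ?w0 ?invr_gt0 ?ltr0n ?pw.
Qed.

Lemma facet_trace2_norm i :
  L (facet_trace2 lam i * facet_trace2 lam i * y) = facet_norm2 i.
Proof.
case: i => [|i]; rewrite /facet_trace2 /facet_norm2.
  by have := H 0 0; rewrite !expr0 !mul1r mulrNN mulr1 mul1r.
rewrite (_ : _ * y = (2 * 2) *: (form2 (lam 0) (lam 1)
   (jacobi R i.+1 0 * jacobi R i.+1 0) (i.+1 + i.+1) * (lam 0 ^+ 0 * lam 1 ^+ 0 * y))); last first.
  by rewrite -form2M ?size_jacobi // -!scalerAl -scalerAr -scalerAl scalerA !expr0 !mul1r.
have moment := fun p n a b sp => form2_moment LD LZ (p := p) (n := n) a b sp H.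
rewrite LZ moment ?size_mul_le ?size_jacobi //.
rewrite /bernstein !expr0 !mulr1 !addn0 -expr2.
by congr (_ * _); ring.
Qed.

End Facet2.

(** * Duality between the facet vectors and the gradients *)

Section FacetDual3.
Variable R : realType.

Lemma facet_dual3_dot (g : 'I_3 -> 'rV[R]_3) l m :
  dot (facet_dual3 g l) (g m) = (l == m)%:R * \det (\matrix_(l, c) g l 0 c).
Proof.
have detE : \det (\matrix_(l, c) g l 0 c) =
   g 0 0 0 * (g 1 0 1 * g 2%:R 0 2%:R - g 1 0 2%:R * g 2%:R 0 1) -
   g 0 0 1 * (g 1 0 0 * g 2%:R 0 2%:R - g 1 0 2%:R * g 2%:R 0 0) +
   g 0 0 2%:R * (g 1 0 0 * g 2%:R 0 1 - g 1 0 1 * g 2%:R 0 0).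
  pose G a b := g (inord a) 0 (inord b).
  have gE l' c : g l' 0 c = G l' c by rewrite /G !inord_val.
  rewrite (expand_det_row _ ord0) !big_ord_recl big_ord0 /cofactor.
  rewrite !(expand_det_row _ ord0) !big_ord_recl !big_ord0 /cofactor !det_mx11 !mxE.
  rewrite !gE /=; ring.
have -> : dot (facet_dual3 g l) (g m) = facet_dual3 g l 0 0 * g m 0 0 +
    facet_dual3 g l 0 1 * g m 0 1 + facet_dual3 g l 0 2%:R * g m 0 2%:R.
  exact: sum_ord3.
rewrite detE /facet_dual3 !cross3E.
have e11 : 1 + 1 = 2%:R :> 'I_3 by apply/val_inj.
have e12 : 1 + 2%:R = 0 :> 'I_3 by apply/val_inj.
have e21 : 2%:R + 1 = 0 :> 'I_3 by apply/val_inj.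
have e22 : 2%:R + 2%:R = 1 :> 'I_3 by apply/val_inj.
move: l m; apply: ord3P; apply: ord3P; rewrite ?add0r ?e11 ?e12 ?e21 ?e22 ?add0r /=; ring.
Qed.

Lemma facet_dual2_dot (g : 'I_2 -> 'rV[R]_2) l m :
  dot (facet_dual2 g l) (g m) = (l == m)%:R * \det (\matrix_(l, c) g l 0 c).
Proof.
have detE : \det (\matrix_(l, c) g l 0 c) = g 0 0 0 * g 1 0 1 - g 0 0 1 * g 1 0 0.
  pose G a b := g (inord a) 0 (inord b).
  have gE l' c : g l' 0 c = G l' c by rewrite /G !inord_val.
  rewrite (expand_det_row _ ord0) !big_ord_recl big_ord0 /cofactor.
  rewrite !det_mx11 !mxE !gE /=; ring.
have -> : dot (facet_dual2 g l) (g m) = facet_dual2 g l 0 0 * g m 0 0 +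
    facet_dual2 g l 0 1 * g m 0 1 by exact: sum_ord2.
rewrite detE; move: l m; apply: ord2P; apply: ord2P;
  rewrite ?facet_dual2_0 ?facet_dual2_1 /=; ring.
Qed.

End FacetDual3.

(** * Common treatment of both dimensions *)

Section FacetFunctions.
Variable R : realType.

Definition facet_form d : ('I_d -> mpoly d R) -> nat -> nat -> 'I_d -> mpoly d R :=
  match d return ('I_d -> mpoly d R) -> nat -> nat -> 'I_d -> mpoly d R with
  | 2 => fun lam i _ => facet_form2 lam i
  | 3 => @facet_form3 R
  | _ => fun _ _ _ _ => 0
  end.

Definition facet_trace d : ('I_d -> mpoly d R) -> nat -> nat -> mpoly d R :=
  match d return ('I_d -> mpoly d R) -> nat -> nat -> mpoly d R with
  | 2 => fun lam i _ => facet_trace2 lam i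
  | 3 => @facet_trace3 R
  | _ => fun _ _ _ => 0
  end.

Definition facet_dual d : ('I_d -> 'rV[R]_d) -> 'I_d -> 'rV[R]_d :=
  match d return ('I_d -> 'rV[R]_d) -> 'I_d -> 'rV[R]_d with
  | 2 => @facet_dual2 R
  | 3 => @facet_dual3 R
  | _ => fun _ _ => 0
  end.

Definition facet_norm (d : nat) (w : nat -> R) (i j : nat) : R :=
  if d == 2%N then facet_norm2 w i else facet_norm3 w i j.

Variable d : nat.
Hypothesis hd : d = 2%N \/ d = 3%N.

Lemma facet_funE (lam : 'I_d -> mpoly d R) (g : 'I_d -> 'rV[R]_d) i j c :
  (forall l c, mderiv c (lam l) = mpolyC d (g l 0 c)) ->
  facet_fun lam i j 0 c =
  \sum_l facet_form lam i j l * mpolyC d (facet_dual g l 0 c).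
Proof.
by case: hd => e; subst d => h; [apply: facet_fun2E|apply: facet_fun3E].
Qed.

Lemma facet_dual_dot (g : 'I_d -> 'rV[R]_d) l m :
  dot (facet_dual g l) (g m) = (l == m)%:R * \det (\matrix_(l, c) g l 0 c).
Proof.
by case: hd => e; subst d; [apply: facet_dual2_dot|apply: facet_dual3_dot].
Qed.

Section Lam.
Variable lam : 'I_d -> mpoly d R.

Lemma facet_form_root i j l x : peval (lam l) x = 0 ->
  peval (facet_form lam i j l) x = 0.
Proof.
by case: hd => e; subst d; [apply: facet_form2_root|apply: facet_form3_root].
Qed.

Lemma sum_facet_form i j x : \sum_l peval (lam l) x = 1 ->
  \sum_l peval (facet_form lam i j l) x = peval (facet_trace lam i j) x.
Proof.
by case: hd => e; subst d; [apply: sum_facet_form2|apply: sum_facet_form3].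
Qed.

Lemma deg_lt_facet_form i j l : (d == 3%N) || (j == 0%N) ->
  (forall m, deg_lt 2 (lam m)) -> (0 < i + j)%N ->
  deg_lt (i + j).+1 (facet_form lam i j l).
Proof.
case: hd => e; subst d; last by move=> _; apply: deg_lt_facet_form3.
by move=> /= /eqP->; rewrite addn0; apply: deg_lt_facet_form2.
Qed.

Lemma deg_lt_facet_trace i j : (d == 3%N) || (j == 0%N) ->
  (forall m, deg_lt 2 (lam m)) -> deg_lt (i + j).+1 (facet_trace lam i j).
Proof.
case: hd => e; subst d; last by move=> _; apply: deg_lt_facet_trace3.
by move=> /= /eqP->; rewrite addn0; apply: deg_lt_facet_trace2.
Qed.

Lemma div_facet_fun i j : (d == 3%N) || (j == 0%N) -> (0 < i + j)%N ->
  \sum_c mderiv c (facet_fun lam i j 0 c) = 0.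
Proof.
case: hd => e; subst d; last by move=> _; apply: div_facet_fun3.
by move=> /= /eqP->; rewrite addn0; apply: div_facet_fun2.
Qed.

Variable L : mpoly d R -> R.
Hypothesis LD : forall f g, L (f + g) = L f + L g.
Hypothesis LZ : forall c f, L (c *: f) = c * L f.
Variables (y : mpoly d R) (w : nat -> R).
Hypothesis H : forall a : 'I_d -> nat, L (\prod_l lam l ^+ a l * y) =
  (\prod_l (a l)`!)%:R * w (\sum_l a l)%N.

Lemma prod_ord2n (F : 'I_2 -> nat) : (\prod_l F l)%N = (F 0%R * F 1%R)%N.
Proof. by rewrite !big_ord_recl big_ord0 muln1; congr (_ * F _)%N; apply/val_inj. Qed.
Lemma prod_ord3n (F : 'I_3 -> nat) : (\prod_l F l)%N = (F 0%R * F 1%R * F (2%:R)%R)%N.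
Proof. by rewrite !big_ord_recl big_ord0 muln1 mulnA; congr (_ * F _ * F _)%N; apply/val_inj. Qed.
Lemma sum_ord2n (F : 'I_2 -> nat) : (\sum_l F l)%N = (F 0%R + F 1%R)%N.
Proof. by rewrite !big_ord_recl big_ord0 addn0; congr (_ + F _)%N; apply/val_inj. Qed.
Lemma sum_ord3n (F : 'I_3 -> nat) : (\sum_l F l)%N = (F 0%R + F 1%R + F (2%:R)%R)%N.
Proof. by rewrite !big_ord_recl big_ord0 addn0 addnA; congr (_ + F _ + F _)%N; apply/val_inj. Qed.

Lemma facet_form_orthogonal i j l (a : 'I_d -> nat) : (d == 3%N) || (j == 0%N) ->
  (\sum_l a l + 2 <= i + j)%N ->
  L (facet_form lam i j l * (\prod_l lam l ^+ a l * y)) = 0.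
Proof.
case: hd => e; subst d.
  move=> /= /eqP->; rewrite sum_ord2n prod_ord2 addn0.
  apply: (facet_form2_orthogonal LD LZ (w := w)) => // b c.
  have := H (fun l => if l == 0 then b else c).
  by rewrite sum_ord2n prod_ord2 prod_ord2n.
move=> _; rewrite sum_ord3n prod_ord3.
apply: (facet_form3_orthogonal LD LZ (w := w)) => // b c m.
have := H (fun l => if l == 0 then b else if l == 1 then c else m).
by rewrite sum_ord3n prod_ord3 prod_ord3n.
Qed.

Lemma facet_trace_orthogonal i j (a : 'I_d -> nat) : (d == 3%N) || (j == 0%N) ->
  (\sum_l a l < i + j)%N ->
  L (facet_trace lam i j * (\prod_l lam l ^+ a l * y)) = 0.
Proof.
case: hd => e; subst d.
  move=> /= /eqP->; rewrite sum_ord2n prod_ord2 addn0.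
  apply: (facet_trace2_orthogonal LD LZ (w := w)) => // b c.
  have := H (fun l => if l == 0 then b else c).
  by rewrite sum_ord2n prod_ord2 prod_ord2n.
move=> _; rewrite sum_ord3n prod_ord3.
apply: (facet_trace3_orthogonal LD LZ (w := w)) => // b c m.
have := H (fun l => if l == 0 then b else if l == 1 then c else m).
by rewrite sum_ord3n prod_ord3 prod_ord3n.
Qed.

Lemma facet_trace_disjoint i j i' j' :
  (d == 3%N) || (j == 0%N) -> (d == 3%N) || (j' == 0%N) ->
  i != i' -> (i + j = i' + j')%N ->
  L (facet_trace lam i j * facet_trace lam i' j' * y) = 0.
Proof.
case: hd => e; subst d.
  by move=> /= /eqP-> /eqP->; rewrite !addn0 => /eqP.
move=> _ _; apply: (facet_trace3_disjoint LD LZ (w := w)) => // b c m.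
have := H (fun l => if l == 0 then b else if l == 1 then c else m).
by rewrite sum_ord3n prod_ord3 prod_ord3n.
Qed.

Lemma facet_trace_norm i j :
  L (facet_trace lam i j * facet_trace lam i j * y) = facet_norm d w i j.
Proof.
case: hd => e; subst d.
  apply: (facet_trace2_norm LD LZ (w := w)) => // b c.
  have := H (fun l => if l == 0 then b else c).
  by rewrite sum_ord2n prod_ord2 prod_ord2n.
apply: (facet_trace3_norm LD LZ (w := w)) => // b c m.
have := H (fun l => if l == 0 then b else if l == 1 then c else m).
by rewrite sum_ord3n prod_ord3 prod_ord3n.
Qed.

End Lam.

Lemma facet_norm_gt0 w i j : (forall n, 0 < w n) -> 0 < facet_norm d w i j.
Proof.
by rewrite /facet_norm; case: eqP => _; [apply: facet_norm2_gt0|apply: facet_norm3_gt0].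
Qed.

End FacetFunctions.

(** * Bounds uniform over all elements *)

Section UniformBounds.
Variables (R : realType) (d : nat).
Implicit Types f g : ('I_d -> mpoly d R) -> mpoly d R.

(** Replaces scaling to a reference element: [f] is a recipe applied to barycentric coordinates, and
    [C] is chosen before the element. A derivative costs one factor [h], the bound of the
    gradients. *)
Definition uniformly_bounded f := exists2 C : R, 0 <= C &
  forall lam x h, (forall l, `|peval (lam l) x| <= 1) -> 0 <= h ->
    (forall l c, `|peval (mderiv c (lam l)) x| <= h) ->
    `|peval (f lam) x| <= C /\ forall c, `|peval (mderiv c (f lam)) x| <= C * h.

Lemma uniformly_bounded_var l : uniformly_bounded (fun lam => lam l).
Proof. by exists 1 => // lam x h l1 _ dl; split => // c; rewrite mul1r. Qed.

Lemma uniformly_boundedC a : uniformly_bounded (fun=> mpolyC d a).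
Proof.
exists `|a| => // lam x h l1 h0 dl; split => [|c]; first by rewrite pevalC.
by rewrite mderivC peval0 normr0 mulr_ge0.
Qed.

Lemma uniformly_boundedD f g : uniformly_bounded f -> uniformly_bounded g ->
  uniformly_bounded (fun lam => f lam + g lam).
Proof.
move=> [C C0 fC] [E E0 gE]; exists (C + E); first exact: addr_ge0.
move=> lam x h l1 h0 dl; have [f1 f2] := fC _ _ _ l1 h0 dl.
have [g1 g2] := gE _ _ _ l1 h0 dl; split => [|c].
  by rewrite pevalD (le_trans (ler_normD _ _)) ?lerD.
by rewrite mderivD pevalD (le_trans (ler_normD _ _)) // mulrDl lerD.
Qed.

Lemma uniformly_boundedM f g : uniformly_bounded f -> uniformly_bounded g ->
  uniformly_bounded (fun lam => f lam * g lam).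
Proof.
move=> [C C0 fC] [E E0 gE]; exists (C * E *+ 2); first by rewrite mulrn_wge0 ?mulr_ge0.
move=> lam x h l1 h0 dl; have [f1 f2] := fC _ _ _ l1 h0 dl.
have [g1 g2] := gE _ _ _ l1 h0 dl; split => [|c].
  rewrite pevalM normrM (le_trans (ler_pM _ _ f1 g1)) //.
  by rewrite mulr2n lerDl mulr_ge0.
rewrite mderivM pevalD !pevalM (le_trans (ler_normD _ _)) // !normrM.
rewrite (_ : _ * h = C * h * E + C * (E * h)); last by ring.
by apply: lerD; apply: ler_pM.
Qed.

Lemma uniformly_bounded_ext f g : f =1 g -> uniformly_bounded f -> uniformly_bounded g.
Proof. by move=> e [C C0 h]; exists C => // lam; rewrite -e; apply: h. Qed.

Lemma uniformly_boundedZ a f : uniformly_bounded f ->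
  uniformly_bounded (fun lam => a *: f lam).
Proof.
move=> fb; apply: uniformly_bounded_ext (uniformly_boundedM (uniformly_boundedC a) fb).
by move=> lam; rewrite mul_mpolyC.
Qed.

Lemma uniformly_boundedN f : uniformly_bounded f ->
  uniformly_bounded (fun lam => - f lam).
Proof.
move=> fb; apply: uniformly_bounded_ext (uniformly_boundedZ (-1) fb).
by move=> lam; rewrite scaleN1r.
Qed.

Lemma uniformly_boundedX f n : uniformly_bounded f ->
  uniformly_bounded (fun lam => f lam ^+ n).
Proof.
move=> fb; elim: n => [|n ih].
  by apply: uniformly_bounded_ext (uniformly_boundedC 1) => lam; rewrite expr0 mpolyC1.
by apply: uniformly_bounded_ext (uniformly_boundedM fb ih) => lam; rewrite exprS.
Qed.

Lemma uniformly_bounded_sum (I : Type) (r : seq I) (F : I -> ('I_d -> mpoly d R) -> mpoly d R) :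
  (forall i, uniformly_bounded (F i)) ->
  uniformly_bounded (fun lam => \sum_(i <- r) F i lam).
Proof.
move=> Fb; elim: r => [|i r ih].
  by apply: uniformly_bounded_ext (uniformly_boundedC 0) => lam; rewrite big_nil mpolyC0.
by apply: uniformly_bounded_ext (uniformly_boundedD (Fb i) ih) => lam; rewrite big_cons.
Qed.

Lemma uniformly_bounded_scaled p n f g : uniformly_bounded f -> uniformly_bounded g ->
  uniformly_bounded (fun lam => scaled p n (f lam) (g lam)).
Proof.
move=> fb gb; apply: uniformly_bounded_sum => m.
apply: uniformly_boundedM; last exact: uniformly_boundedX.
by apply: uniformly_boundedM; [exact: uniformly_boundedC|exact: uniformly_boundedX].
Qed.

End UniformBounds.

Section FormBounds.
Variables (R : realType) (d : nat).
Hypothesis hd : d = 2%N \/ d = 3%N.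

Lemma uniformly_bounded_form2 (l m : 'I_d) p n :
  uniformly_bounded (fun lam : 'I_d -> mpoly d R => form2 (lam l) (lam m) p n).
Proof.
rewrite form2.unlock; have v := @uniformly_bounded_var R d.
by apply: uniformly_bounded_scaled; [apply: (uniformly_boundedD (v m)); exact: uniformly_boundedN|apply: uniformly_boundedD].
Qed.

Lemma uniformly_bounded_form3 (l m o : 'I_d) p n :
  uniformly_bounded (fun lam : 'I_d -> mpoly d R => form3 (lam l) (lam m) (lam o) p n).
Proof.
rewrite form3.unlock; have v := @uniformly_bounded_var R d.
apply: uniformly_bounded_scaled.
  apply: uniformly_boundedD; last exact: uniformly_boundedN.
  by apply: uniformly_boundedD => //; exact: uniformly_boundedN.
by apply: uniformly_boundedD => //; apply: uniformly_boundedD.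
Qed.

Lemma uniformly_bounded_facet_form i j l :
  uniformly_bounded (fun lam : 'I_d -> mpoly d R => facet_form lam i j l).
Proof.
have v := @uniformly_bounded_var R d.
have f2 := uniformly_bounded_form2; have f3 := uniformly_bounded_form3.
case: hd => e; subst d.
  by case: i => [|i] /=; [apply: uniformly_boundedN|case: (l == 0)].
case: i => [|i]; first case: j => [|n] //=.
  by case: (l == _); [apply: uniformly_boundedZ|apply: uniformly_boundedM].
rewrite /facet_form /facet_form3; case: (l == 0) => /=.
  by apply: uniformly_boundedN; apply: uniformly_boundedM.
by case: (l == 1) => /=; [|apply: uniformly_boundedZ]; apply: uniformly_boundedM.
Qed.

End FormBounds.

(** * Facets of an element *)

Lemma deg_lt0_eq0 (R : realType) d (q : mpoly d R) : deg_lt 0 q -> q = 0.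
Proof. by rewrite /deg_lt leqn0 msize_poly_eq0 => /eqP. Qed.

(** What Dirichlet's formula on a facet leaves besides the factorials of the exponents: a function
    of the total exponent, as the moment lemmas demand. *)
Definition facet_weight (R : realType) (d m : nat) : R := (m + d.-1)`!%:R^-1.

(** The counterpart on the element, where the power [e] of the opposite coordinate belongs to the
    test factor. *)
Definition cell_weight (R : realType) (d e m : nat) : R :=
  e`!%:R / (m + e + d)`!%:R.

Section FacetOfCell.
Variables (R : realType) (d : nat) (M : mesh R d).
Local Notation V := 'I_(nvert M).
Hypothesis hd : d = 2%N \/ d = 3%N.

Lemma facet_opposite (T F : {set V}) : #|T| = d.+1 -> #|F| = d -> F \subset T ->
  exists2 o, o \notin F & T = o |: F.
Proof.
move=> cT cF FT; have : #|T :\: F| == 1%N by rewrite finset.cardsDS // cT cF subSnn.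
move=> /cards1P[v e]; have : v \in T :\: F by rewrite e inE.
rewrite inE => /andP[vF vT]; exists v => //.
by rewrite -[LHS](finset.setID T F) (finset.setIidPr FT) e finset.setUC.
Qed.

Variables (T F : {set V}) (o : V).
Hypothesis cardT : #|T| = d.+1.
Hypothesis indT : affinely_independent T.
Hypothesis oF : o \notin F.
Hypothesis TE : T = o |: F.
Hypothesis orderF : [set v in forder F] = F.

Local Notation f_ l := (tnth (forder F) l).
Local Notation lam := (barycentric T).
Local Notation n_ := (facet_normal F).
Local Notation lamF := (fun l => lam (f_ l)).

Lemma facet_subset : F \subset T. Proof. by rewrite TE finset.subsetUr. Qed.

Lemma opposite_in : o \in T. Proof. by rewrite TE finset.setU11. Qed.

Lemma setD1_opposite : T :\ o = F. Proof. by rewrite TE finset.setU1K. Qed.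

Lemma card_facet : #|F| = d.
Proof. by have := cardT; rewrite TE cardsU1 oF => -[]. Qed.

Lemma facet_neq0 : F != finset.set0.
Proof. by rewrite -card_gt0 card_facet; case: hd => ->. Qed.

Lemma cell_neq0 : T != finset.set0.
Proof. by rewrite -card_gt0 cardT. Qed.

Lemma forder_uniq : uniq (forder F).
Proof.
have : #|forder F| = #|F| by rewrite -[in RHS]orderF cardsE.
by rewrite card_facet => e; apply/card_uniqP; rewrite e size_tuple.
Qed.

Lemma forder_in l : f_ l \in F.
Proof. by rewrite -[in X in _ \in X]orderF inE mem_tnth. Qed.

Lemma forder_inT l : f_ l \in T.
Proof. exact: fintype.subsetP facet_subset _ (forder_in l). Qed.

Lemma forderP v : v \in F -> exists l, v = f_ l.
Proof. by rewrite -[in X in X -> _]orderF inE => /tnthP. Qed.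

Lemma forder_inj : injective (fun l => f_ l).
Proof. by apply/tuple_uniqP/forder_uniq. Qed.

Lemma big_forder (A : Type) (idx : A) (op : Monoid.com_law idx) (G : V -> A) :
  \big[op/idx]_(v in F) G v = \big[op/idx]_l G (f_ l).
Proof.
rewrite -(big_tuple _ _ (forder F) xpredT) big_uniq ?forder_uniq //=.
by apply: eq_bigl => v; rewrite -[in LHS]orderF inE.
Qed.

Lemma big_opposite (A : Type) (idx : A) (op : Monoid.com_law idx) (G : V -> A) :
  \big[op/idx]_(v in T) G v = op (G o) (\big[op/idx]_l G (f_ l)).
Proof. by rewrite TE big_setU1 // big_forder. Qed.

Lemma barycentric_opposite x : simplex F x -> peval (lam o) x = 0.
Proof.
move=> [c [_ c1 ->]]; rewrite (barycentric_comb indT facet_subset) ?opposite_in //.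
by rewrite (negPf oF).
Qed.

Lemma sum_barycentric_facet x : peval (lam o) x = 0 ->
  \sum_l peval (lam (f_ l)) x = 1.
Proof.
move=> o0; have := congr1 (fun p => peval p x) (sum_barycentric cardT indT).
by rewrite /= peval1 peval_sum big_opposite /= o0 add0r.
Qed.

Local Notation g_ v := (bgrad T v).

(** Every [z] is a combination of the edges [vert v - vert f0] weighted by barycentric coordinates;
    against [y] only the edge to [o] survives, with weight [dot (g_ o) z]. *)
Lemma orthogonal_facet (y : 'rV[R]_d) :
  (forall v w, v \in F -> w \in F -> dot y (vert v - vert w) = 0) ->
  exists c, y = c *: g_ o.
Proof.
move=> yF; have /finset.set0Pn[f0 f0F] := facet_neq0.
have f0T : f0 \in T := fintype.subsetP facet_subset _ f0F.
exists (dot y (vert o - vert f0)); set c := dot y _.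
have h z : dot y z = c * dot (g_ o) z.
  pose x := z + vert f0.
  have -> : z = x - vert f0 by rewrite /x addrK.
  rewrite -(peval_barycentricB indT) ?opposite_in //.
  rewrite barycentric_vert ?opposite_in // (_ : (f0 == o) = false) ?subr0; last first.
    by apply: contraNF oF => /eqP <-.
  have -> : x - vert f0 = \sum_(v in T) peval (lam v) x *: (vert v - vert f0).
    apply/rowP => i; rewrite summxE.
    have e1 : x 0 i = \sum_(v in T) peval (lam v) x * vert v 0 i.
      have := congr1 (fun p => peval p x) (coord_barycentric cardT indT i).
      rewrite pevalXU peval_sum => ->; apply: eq_bigr => v _.
      by rewrite pevalZ mulrC.
    have e2 : \sum_(v in T) peval (lam v) x = 1.
      by rewrite -peval_sum (sum_barycentric cardT indT) peval1.
    rewrite [RHS](eq_bigr (fun v => peval (lam v) x * vert v 0 i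
       - peval (lam v) x * vert f0 0 i)); last first.
      by move=> v _; rewrite !mxE mulrBr.
    by rewrite sumrB -mulr_suml e2 mul1r -e1 !mxE.
  rewrite dotC dot_suml (bigD1 o) ?opposite_in //= big1 => [|v /andP[vT vo]].
    by rewrite addr0 dotZl dotC mulrC.
  rewrite dotZl dotC yF ?mulr0 //.
  by move: vT; rewrite TE finset.in_setU1 (negPf vo).
apply/eqP; rewrite -subr_eq0; apply/eqP/dot_eq0.
by rewrite dotBl dotZl h subrr.
Qed.

Lemma bgrad_opposite_facet v w : v \in F -> w \in F ->
  dot (g_ o) (vert v - vert w) = 0.
Proof.
move=> vF wF; have vT u : u \in F -> u \in T by apply/fintype.subsetP/facet_subset.
rewrite (dot_bgrad indT) ?opposite_in ?vT //.
have no u : u \in F -> (u == o) = false by move=> uF; apply: contraNF oF => /eqP <-.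
by rewrite !no // subrr.
Qed.

Lemma facet_normalP : dot n_ n_ = 1 /\
  forall v w, v \in F -> w \in F -> dot n_ (vert v - vert w) = 0.
Proof.
apply: (@xgetPex _ 0 [set n : 'rV[R]_d | dot n n = 1 /\
    forall v w, v \in F -> w \in F -> dot n (vert v - vert w) = 0]).
have /finset.set0Pn[f0 f0F] := facet_neq0.
have f0T : f0 \in T := fintype.subsetP facet_subset _ f0F.
have g0 : enorm (g_ o) != 0.
  rewrite /enorm sqrtr_eq0 -ltNge lt_neqAle dot_ge0 andbT eq_sym.
  apply/eqP => /dot_eq0 g0; have := dot_bgrad indT opposite_in opposite_in f0T.
  rewrite g0 dot0l eqxx (_ : (f0 == o) = false) ?subr0 => [/esym/eqP|].
    by rewrite oner_eq0.
  by apply: contraNF oF => /eqP <-.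
exists ((enorm (g_ o))^-1 *: g_ o); split.
  by rewrite dotZl dotZr -enorm_sqr mulrA -invfM -expr2 mulVf // expf_neq0.
by move=> v w vF wF; rewrite dotZl bgrad_opposite_facet // mulr0.
Qed.

(** Its sign tells on which side of the fixed normal the element lies; its modulus is the inverse of
    the height over [F]. *)
Definition normal_deriv : R := dot (g_ o) n_.

Lemma bgrad_opposite : g_ o = normal_deriv *: n_.
Proof.
have [nn nF] := facet_normalP; have [c e] := orthogonal_facet nF.
have c0 : c != 0.
  by apply/eqP => c0; move: nn; rewrite e c0 scale0r dot0l => /esym/eqP; rewrite oner_eq0.
have ge : g_ o = c^-1 *: n_ by rewrite e scalerA mulVf // scale1r.
by rewrite /normal_deriv ge dotZl nn mulr1 -ge.
Qed.

Lemma normal_deriv_neq0 : normal_deriv != 0.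
Proof.
have /finset.set0Pn[f0 f0F] := facet_neq0.
have f0T : f0 \in T := fintype.subsetP facet_subset _ f0F.
have := dot_bgrad indT opposite_in opposite_in f0T.
rewrite eqxx (_ : (f0 == o) = false) ?subr0; last first.
  by apply: contraNF oF => /eqP <-.
rewrite bgrad_opposite dotZl; apply: contra_eqN => /eqP ->.
by rewrite mul0r eq_sym oner_eq0.
Qed.

(** The inverse of the determinant of the edges at [o], hence up to a factorial a signed inverse
    volume. *)
Definition gdet : R := \det (\matrix_(l, c) g_ (f_ l) 0 c).

Definition edge_mx : 'M[R]_d := \matrix_(l, c) (vert (f_ l) - vert o) 0 c.

Lemma gdet_edge : gdet * \det edge_mx = 1.
Proof.
rewrite -(det_tr edge_mx) -det_mulmx -[RHS](det1 R d); congr (\det _).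
apply/matrixP => l m; rewrite !mxE.
have := dot_bgrad indT (forder_inT l) (forder_inT m) opposite_in.
rewrite (_ : (o == _) = false) ?subr0; last first.
  by apply: contraNF oF => /eqP ->; exact: forder_in.
rewrite (inj_eq forder_inj) eq_sym => <-.
by apply: eq_bigr => c _; rewrite !mxE.
Qed.

Lemma gdet_neq0 : gdet != 0.
Proof.
by apply/eqP => g0; have := gdet_edge; rewrite g0 mul0r => /esym/eqP; rewrite oner_eq0.
Qed.

Local Notation phi := (facet_basis T F).
Local Notation form := (facet_form lamF).

Lemma facet_basisE i j c : phi i j 0 c =
  \sum_l form i j l * mpolyC d (facet_dual (fun m => g_ (f_ m)) l 0 c).
Proof.
apply: facet_funE => // l e; apply: mderiv_barycentric => //.
exact: forder_inT.
Qed.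

Lemma dot_facet_basis i j x y : dot (veval (phi i j) x) y =
  \sum_l peval (form i j l) x * dot (facet_dual (fun m => g_ (f_ m)) l) y.
Proof.
rewrite /dot; under eq_bigr => c _.
  rewrite mxE facet_basisE peval_sum mulr_suml; over.
rewrite exchange_big /=; apply: eq_bigr => l _; rewrite mulr_sumr.
by apply: eq_bigr => c _; rewrite pevalM pevalC mulrA.
Qed.

Lemma dot_facet_basis_bgrad i j m x :
  dot (veval (phi i j) x) (g_ (f_ m)) = gdet * peval (form i j m) x.
Proof.
rewrite dot_facet_basis (bigD1 m) //= facet_dual_dot // eqxx mul1r.
rewrite big1 => [|l lm]; first by rewrite addr0 mulrC.
by rewrite facet_dual_dot // (negPf lm) mul0r mulr0.
Qed.

Definition facet_flux : R := - gdet / normal_deriv.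

Lemma facet_flux_neq0 : facet_flux != 0.
Proof. by rewrite mulf_neq0 ?invr_eq0 ?oppr_eq0 ?gdet_neq0 ?normal_deriv_neq0. Qed.

(** The normal is parallel to [g_ o], which is minus the sum of the gradients of the facet vertices;
    each dual vector pairs nontrivially with exactly one of these, always with value [gdet]. *)
Lemma dot_facet_dual_normal l :
  dot (facet_dual (fun m => g_ (f_ m)) l) n_ = facet_flux.
Proof.
have -> : n_ = normal_deriv^-1 *: g_ o.
  by rewrite bgrad_opposite scalerA mulVf ?scale1r ?normal_deriv_neq0.
have -> : g_ o = - \sum_m g_ (f_ m).
  by apply/eqP; rewrite -addr_eq0 -big_opposite (sum_bgrad cardT indT).
rewrite dotZr dotNr dotC dot_suml (bigD1 l) //= dotC facet_dual_dot // eqxx mul1r.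
rewrite big1 => [|m ml]; first by rewrite addr0 mulrC.
by rewrite dotC facet_dual_dot // eq_sym (negPf ml) mul0r.
Qed.

Lemma normal_trace_facet_basis i j x : simplex F x ->
  normal_trace F (phi i j) x = facet_flux * peval (facet_trace lamF i j) x.
Proof.
move=> Fx; rewrite /normal_trace dot_facet_basis -sum_facet_form //; last first.
  exact/sum_barycentric_facet/barycentric_opposite.
by rewrite mulr_sumr; apply: eq_bigr => l _; rewrite dot_facet_dual_normal mulrC.
Qed.

Lemma deg_lt_facet_basis i j c : (d == 3%N) || (j == 0%N) -> (0 < i + j)%N ->
  deg_lt (i + j).+1 (phi i j 0 c).
Proof.
move=> ij ij0; rewrite facet_basisE; apply: deg_lt_sum => l _.
rewrite mulrC mul_mpolyC; apply/deg_ltZ/deg_lt_facet_form => // m.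
exact/deg_lt_barycentric/forder_inT.
Qed.

Lemma deg_lt_trace i j : (d == 3%N) || (j == 0%N) ->
  deg_lt (i + j).+1 (facet_trace lamF i j).
Proof.
move=> ij; apply: deg_lt_facet_trace => // m.
exact/deg_lt_barycentric/forder_inT.
Qed.

Local Notation LF q := (sint F (peval q)).
Local Notation LT q := (sint T (peval q)).

Let LFD := sintD facet_neq0 cardT indT facet_subset.
Let LFZ := sintZ facet_neq0 cardT indT facet_subset.
Let LTD := sintD cell_neq0 cardT indT (fintype.subxx T).
Let LTZ := sintZ cell_neq0 cardT indT (fintype.subxx T).

Let expo (a : 'I_d -> nat) e v : nat :=
  if v == o then e else if [pick l | v == f_ l] is Some l then a l else 0.

Let expo_o a e : expo a e o = e. Proof. by rewrite /expo eqxx. Qed.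

Let expo_f a e l : expo a e (f_ l) = a l.
Proof.
rewrite /expo ifF; last by apply: contraNF oF => /eqP <-; exact: forder_in.
by case: pickP => [m /eqP/forder_inj->|/(_ l)] //; rewrite eqxx.
Qed.

Let bmon_expo a e : bmon T (expo a e) = \prod_l lam (f_ l) ^+ a l * lam o ^+ e.
Proof.
rewrite /bmon big_opposite expo_o mulrC; congr (_ * _).
by apply: eq_bigr => l _; rewrite expo_f.
Qed.

Lemma facet_moment (a : 'I_d -> nat) :
  LF (\prod_l lam (f_ l) ^+ a l * 1) =
  (\prod_l (a l)`!)%:R * facet_weight R d (\sum_l a l)%N.
Proof.
have := bmon_expo a 0; rewrite expr0 => <-.
rewrite (sint_bmon facet_neq0 indT facet_subset) /dirichlet ifT.
  rewrite !big_forder card_facet; congr (_%:R / (_ + _)`!%:R);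
    by apply: eq_bigr => l _; rewrite expo_f.
apply/forall_inP => v; rewrite TE !inE => /andP[/negPf ->].
by rewrite orbF => /eqP ->; rewrite expo_o.
Qed.

Lemma cell_moment e (a : 'I_d -> nat) :
  LT (\prod_l lam (f_ l) ^+ a l * lam o ^+ e) =
  (\prod_l (a l)`!)%:R * cell_weight R d e (\sum_l a l)%N.
Proof.
rewrite -bmon_expo (sint_bmon cell_neq0 indT (fintype.subxx T)) /dirichlet ifT.
  rewrite !big_opposite expo_o cardT /= natrM mulrA [_ * e`!%:R]mulrC.
  congr (_ * _%:R / _`!%:R); first by apply: eq_bigr => l _; rewrite expo_f.
  by rewrite [(e + _)%N]addnC; congr (_ + _ + _)%N; apply: eq_bigr => l _; rewrite expo_f.
by apply/forall_inP => v; rewrite !inE andNb.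
Qed.

(** In each barycentric monomial the power of the opposite coordinate serves as the fixed test
    factor, so the moments in the facet coordinates keep Dirichlet's form. *)
Lemma facet_basis_orthogonal i j l q : (d == 3%N) || (j == 0%N) ->
  deg_lt (i + j).-1 q -> LT (form i j l * q) = 0.
Proof.
move=> ij dq; have [ij2|ij2] := leqP 2 (i + j); last first.
  have -> : q = 0.
    by apply: deg_lt0_eq0; rewrite (_ : 0%N = (i + j).-1) //; lia.
  by rewrite mulr0 (sint0 cell_neq0 cardT indT (fintype.subxx T)).
have /(deg_lt_bspan cardT indT) bq : deg_lt (i + j - 2).+1 q.
  by rewrite (_ : (i + j - 2).+1 = (i + j).-1) //; lia.
elim: bq => [|c a p am _ IH].
  by rewrite mulr0 (sint0 cell_neq0 cardT indT (fintype.subxx T)).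
rewrite mulrDr LTD IH addr0 -scalerAr LTZ /bmon big_opposite /= [lam o ^+ _ * _]mulrC.
rewrite (facet_form_orthogonal hd LTD LTZ (cell_moment (a o))) ?mulr0 //.
move: am; rewrite big_opposite /= => am.
by apply: leq_trans (leq_add (leq_trans (leq_addl _ _) am) (leqnn 2)) _; lia.
Qed.

Lemma facet_trace_orthogonal_deg i j q : (d == 3%N) || (j == 0%N) ->
  deg_lt (i + j) q -> LF (facet_trace lamF i j * q) = 0.
Proof.
move=> ij dq; have [ij0|ij0] := posnP (i + j).
  by rewrite (deg_lt0_eq0 (_ : deg_lt 0 q)) -?ij0 // mulr0 (sint0 facet_neq0 cardT indT facet_subset).
have /(deg_lt_bspan cardT indT) bq : deg_lt (i + j).-1.+1 q by rewrite prednK.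
elim: bq => [|c a p am _ IH].
  by rewrite mulr0 (sint0 facet_neq0 cardT indT facet_subset).
rewrite mulrDr LFD IH addr0 -scalerAr LFZ /bmon big_opposite /=.
have [ao|ao] := eqVneq (a o) 0%N.
  rewrite ao expr0 mul1r -[\prod_(_ < _) _]mulr1.
  rewrite (facet_trace_orthogonal hd LFD LFZ facet_moment) ?mulr0 //.
  move: am; rewrite big_opposite /= => am.
  by apply: leq_ltn_trans (leq_trans (leq_addl _ _) am) _; rewrite prednK.
(* A positive power of the opposite coordinate vanishes on [F]. *)
set r := facet_trace _ _ _ * _.
rewrite (_ : LF r = LF 0); last first.
  apply: (sint_eq facet_neq0) => x Fx.
  by rewrite !pevalM pevalX barycentric_opposite // expr0n (negPf ao) mul0r mulr0 peval0.
by rewrite (sint0 facet_neq0 cardT indT facet_subset) mulr0.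
Qed.

Definition trace_norm (i j : nat) : R :=
  facet_norm d (facet_weight R d) i j.

Lemma trace_norm_gt0 i j : 0 < trace_norm i j.
Proof. by apply: facet_norm_gt0 => // m; rewrite invr_gt0 ltr0n fact_gt0. Qed.

(** Different total degrees are separated by orthogonality to lower degrees, equal ones by the first
    index. *)
Lemma facet_trace_gram i j i' j' :
  (d == 3%N) || (j == 0%N) -> (d == 3%N) || (j' == 0%N) ->
  LF (facet_trace lamF i j * facet_trace lamF i' j') =
  ((i == i') && (j == j'))%:R * trace_norm i j.
Proof.
move=> ij ij'; case: (ltngtP (i + j) (i' + j')) => [lt|gt|eq].
- rewrite mulrC facet_trace_orthogonal_deg //; last first.
    exact: deg_lt_le lt (deg_lt_trace _ ij).
  rewrite (_ : _ && _ = false) ?mul0r //.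
  by apply/negP => /andP[/eqP ei /eqP ej]; lia.
- rewrite facet_trace_orthogonal_deg //; last first.
    exact: deg_lt_le gt (deg_lt_trace _ ij').
  rewrite (_ : _ && _ = false) ?mul0r //.
  by apply/negP => /andP[/eqP ei /eqP ej]; lia.
have [ii|ii] := eqVneq i i'.
  have -> : j' = j by lia.
  by rewrite -ii eqxx mul1r -[X in LF X]mulr1 (facet_trace_norm hd LFD LFZ facet_moment).
rewrite -[X in LF X]mulr1 (facet_trace_disjoint hd LFD LFZ facet_moment) //.
by rewrite mul0r.
Qed.

End FacetOfCell.

(** * The traces as a basis of the polynomials on a facet *)

Section FacetSpan.
Variables (R : realType) (d : nat) (M : mesh R d).
Local Notation V := 'I_(nvert M).
Hypothesis hd : d = 2%N \/ d = 3%N.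
Variables (T F : {set V}) (o : V).
Hypothesis cardT : #|T| = d.+1.
Hypothesis indT : affinely_independent T.
Hypothesis oF : o \notin F.
Hypothesis TE : T = o |: F.
Hypothesis orderF : [set v in forder F] = F.

Local Notation f_ l := (tnth (forder F) l).
Local Notation lam := (barycentric T).
Local Notation lamF := (fun l => lam (f_ l)).
Local Notation l0 := (lam (nth o (forder F) 0)).
Local Notation l1 := (lam (nth o (forder F) 1)).
Local Notation valid j := ((d == 3%N) || (j == 0%N)).
Local Notation LF q := (sint F (peval q)).

Let F0 := facet_neq0 hd cardT oF TE.
Let FT := facet_subset TE.
Let LFD := sintD F0 cardT indT FT.
Let LFZ := sintZ F0 cardT indT FT.

(* On F the last barycentric coordinate is expressed by the others. *)
Let fspan m (q : mpoly d R) := exists s : seq (R * (nat * nat)),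
  all (fun t => (t.2.1 + t.2.2 <= m)%N && valid t.2.2) s /\
  forall x, simplex F x ->
    peval q x = \sum_(t <- s) t.1 * (peval l0 x ^+ t.2.1 * peval l1 x ^+ t.2.2).

Let fspan_ext m q r : (forall x, simplex F x -> peval r x = peval q x) ->
  fspan m q -> fspan m r.
Proof. by move=> e [s [h1 h2]]; exists s; split=> // x Fx; rewrite e ?h2. Qed.

Let fspanD m q r : fspan m q -> fspan m r -> fspan m (q + r).
Proof.
move=> [s [h1 h2]] [t [h3 h4]]; exists (s ++ t); split; first by rewrite all_cat h1.
by move=> x Fx; rewrite pevalD h2 // h4 // big_cat.
Qed.

Let fspanM m n q r : fspan m q -> fspan n r -> fspan (m + n) (q * r).
Proof.
move=> [s [h1 h2]] [t [h3 h4]].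
exists [seq (a.1 * b.1, ((a.2.1 + b.2.1)%N, (a.2.2 + b.2.2)%N)) | a <- s, b <- t].
split.
  apply/allP => _ /allpairsP[[a b] /= [/(allP h1) /andP[a1 a2] /(allP h3) /andP[b1 b2] ->]] /=.
  rewrite addnACA leq_add //=; case: eqP a2 b2 => //= _ /eqP -> /eqP ->.
  by rewrite eqxx.
move=> x Fx; rewrite pevalM h2 // h4 // big_allpairs_dep mulr_suml; apply: eq_bigr => a _.
by rewrite mulr_sumr; apply: eq_bigr => b _ /=; rewrite !exprD; ring.
Qed.

Let fspanC m c : fspan m (mpolyC d c).
Proof.
exists [:: (c, (0%N, 0%N))]; split; first by rewrite /= orbT.
by move=> x _; rewrite big_seq1 /= pevalC !expr0 !mulr1.
Qed.

Let fspan_le m n q : (m <= n)%N -> fspan m q -> fspan n q.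
Proof.
move=> mn [s [h1 h2]]; exists s; split=> //; apply: sub_all h1 => t /andP[h ->].
by rewrite (leq_trans h mn).
Qed.

Let fspanZ m c q : fspan m q -> fspan m (c *: q).
Proof. by move=> h; rewrite -mul_mpolyC -[m]add0n; apply: fspanM. Qed.

Let fspan_l0 : fspan 1 l0.
Proof.
exists [:: (1, (1%N, 0%N))]; split; first by rewrite /= orbT.
by move=> x _; rewrite big_seq1 /= expr0 expr1 mulr1 mul1r.
Qed.

Let fspan_l1 : d = 3%N -> fspan 1 l1.
Proof.
move=> d3; exists [:: (1, (0%N, 1%N))]; split; first by rewrite /= d3.
by move=> x _; rewrite big_seq1 /= expr0 expr1 !mul1r.
Qed.

Let nth_forder (l : 'I_d) : nth o (forder F) l = f_ l.
Proof. by rewrite (tnth_nth o). Qed.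

Let sum_nth m x : d = m -> simplex F x ->
  \sum_(0 <= l < m) peval (lam (nth o (forder F) l)) x = 1.
Proof.
move=> <- Fx; have o0 := barycentric_opposite indT oF TE Fx.
rewrite big_mkord -[RHS](sum_barycentric_facet cardT indT oF TE orderF o0).
by apply: eq_bigr => l _; rewrite nth_forder.
Qed.

Let fspan_lam v : v \in T -> fspan 1 (lam v).
Proof.
move=> vT; have : v \in o |: F by rewrite -TE.
rewrite finset.in_setU1 => /orP[/eqP->|].
  apply: (fspan_ext (q := mpolyC d 0)); last exact: fspanC.
  by move=> x Fx; rewrite pevalC (barycentric_opposite indT oF TE Fx).
case/(forderP orderF) => l ->; rewrite -nth_forder; have lt := ltn_ord l.
have e0 := fspanC 1 1.
case: hd => dE; have sn x := @sum_nth _ x dE.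
  have : (l < 2)%N by rewrite -dE.
  case: (l : nat) => [|[|//]] _ //.
  apply: (fspan_ext (q := mpolyC d 1 + (-1) *: l0)); last exact/fspanD/fspanZ.
  move=> x Fx; have := sn x Fx; rewrite !big_nat_recl // big_geq // addr0 /= => e.
  by rewrite pevalD pevalZ pevalC; move: e; lra.
have : (l < 3)%N by rewrite -dE.
case: (l : nat) => [|[|[|//]]] _ //; first exact: fspan_l1.
apply: (fspan_ext (q := mpolyC d 1 + (-1) *: (l0 + l1))); last first.
  by apply/fspanD/fspanZ/fspanD => //; apply: fspan_l1.
move=> x Fx; have := sn x Fx; rewrite !big_nat_recl // big_geq // addr0 /= => e.
by rewrite pevalD pevalZ pevalC pevalD; move: e; lra.
Qed.

Let fspan_deg m q : deg_lt m.+1 q -> fspan m q.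
Proof.
move=> /(deg_lt_bspan cardT indT); elim=> [|c a p am _ IH].
  by rewrite -(mpolyC0 d R); exact: fspanC.
apply/fspanD/IH/fspanZ/(fspan_le am).
apply: (big_ind2 (fun n p => fspan n p)) => [||v vT].
- by rewrite -mpolyC1; exact: fspanC.
- by move=> *; apply: fspanM.
elim: (a v) => [|n IHn]; first by rewrite expr0 -mpolyC1; exact: fspanC.
by rewrite exprS -add1n; apply: fspanM => //; apply: fspan_lam.
Qed.

Variable k : nat.
Local Notation I := ('I_k.+1 * 'I_k.+1)%type.
Local Notation D := (fun p : I => facet_trace lamF p.1 p.2).
Let mono (p : I) := l0 ^+ p.1 * l1 ^+ p.2.

Let fspan_mono q : fspan k q -> exists a : I -> R,
  forall x, simplex F x -> peval q x = peval (\sum_(p | facet_index d p) a p *: mono p) x.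
Proof.
move=> [s [h e]]; suff [a ha] : exists a : I -> R, forall x,
    \sum_(t <- s) t.1 * (peval l0 x ^+ t.2.1 * peval l1 x ^+ t.2.2) =
    peval (\sum_(p | facet_index d p) a p *: mono p) x.
  by exists a => x Fx; rewrite -ha e.
elim: s h {e} => [|[c [i j]] s IH] /=.
  move=> _; exists (fun=> 0) => x; rewrite big_nil big1 ?peval0 // => p _.
  by rewrite scale0r.
case/andP => /andP[ijk vj] /IH[a ha].
have ik : (i < k.+1)%N by lia.
have jk : (j < k.+1)%N by lia.
pose p0 : I := (Ordinal ik, Ordinal jk).
exists (fun p => (if p == p0 then c else 0) + a p) => x; rewrite big_cons ha.
under [in RHS]eq_bigr => p _ do rewrite scalerDl.
rewrite big_split pevalD; congr (_ + _).
rewrite (bigD1 p0) /= ?eqxx; last by rewrite /facet_index /= ijk.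
rewrite big1 => [|p /andP[_ /negPf ->]]; last by rewrite scale0r.
by rewrite addr0 pevalZ pevalM !pevalX.
Qed.

Let A := [set p : I | facet_index d p]%SET.
Let sumA (B : nmodType) (G : I -> B) :
  \sum_(p | facet_index d p) G p = \sum_(i < #|A|) G (enum_val i).
Proof. by rewrite -big_enum_val /=; apply: eq_bigl => p; rewrite inE. Qed.

Lemma facet_trace_gramI p p' : facet_index d p -> facet_index d p' ->
  LF (D p * D p') = (p == p')%:R * trace_norm R d p.1 p.2.
Proof.
case: p p' => [i j] [i' j'] /andP[_ v] /andP[_ v'].
by rewrite (facet_trace_gram hd cardT indT oF TE orderF).
Qed.

(** Traces and monomials carry the same index set. On [F] the traces are obtained from the monomials
    by a square matrix [B], and [B G B^T] is diagonal with positive entries; so [B] is invertible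
    and the monomials are recovered from the traces. *)
Lemma facet_trace_span q : deg_lt k.+1 q -> exists a : I -> R,
  forall x, simplex F x ->
    peval q x = \sum_(p | facet_index d p) a p * peval (D p) x.
Proof.
have hD (i : 'I_#|A|) : exists a : I -> R, forall x, simplex F x ->
    peval (D (enum_val i : I)) x = peval (\sum_(p | facet_index d p) a p *: mono p) x.
  apply/fspan_mono/fspan_deg; have := enum_valP i; rewrite inE => /andP[h v].
  by apply: (deg_lt_le _ (deg_lt_trace hd indT TE orderF _ v)).
have [a ha] := choice hD.
pose B : 'M[R]_#|A| := \matrix_(i, j) a i (enum_val j).
pose G : 'M[R]_#|A| := \matrix_(i, j) LF (mono (enum_val i) * mono (enum_val j)).
have hB (i : 'I_#|A|) x : simplex F x -> peval (D (enum_val i : I)) x =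
    peval (\sum_j B i j *: mono (enum_val j)) x.
  move=> Fx; rewrite ha // sumA; congr (peval _ x).
  by apply: eq_bigr => j _; rewrite mxE.
have unitB : B \in unitmx.
  rewrite unitmxE unitfE; suff : \det (B *m G *m B^T) != 0.
    by rewrite !det_mulmx !mulf_eq0 !negb_or => /andP[/andP[]].
  have -> : B *m G *m B^T = diag_mx (\row_(i < #|A|) trace_norm R d (enum_val i).1 (enum_val i).2).
    apply/matrixP => i j; rewrite [RHS]mxE mxE.
    transitivity (LF (D (enum_val i : I) * D (enum_val j : I))).
      pose S (i : 'I_#|A|) := \sum_l B i l *: mono (enum_val l).
      rewrite (_ : LF _ = LF (S i * S j)); last first.
        by apply: (sint_eq F0) => x Fx; rewrite !pevalM !hB.
      rewrite /S mulr_sumr (sint_sum F0 cardT indT FT); apply: eq_bigr => l _.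
      rewrite mxE -scalerAr LFZ mulrC [B^T l j]mxE; congr (_ * _).
      rewrite mulr_suml (sint_sum F0 cardT indT FT); apply: eq_bigr => m _.
      by rewrite -scalerAl LFZ [G m l]mxE.
    have v (m : 'I_#|A|) : facet_index d (enum_val m : I) by have := enum_valP m; rewrite inE.
    rewrite facet_trace_gramI // (inj_eq enum_val_inj) mxE.
    by case: eqP => _; rewrite ?mul1r ?mul0r.
  rewrite det_diag; apply/prodf_neq0 => i _; rewrite mxE.
  by rewrite gt_eqF // trace_norm_gt0.
move=> /fspan_deg/fspan_mono[b hb].
(* [enum_rank_in] takes a proof of membership; the value 0 outside the index set is arbitrary. *)
exists (fun p => if boolP (p \in A) is AltTrue h then
  \sum_i b (enum_val i) * invmx B i (enum_rank_in h p) else 0) => x Fx.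
rewrite hb // !sumA peval_sum.
have mE (j : 'I_#|A|) : peval (mono (enum_val j)) x =
    \sum_i invmx B j i * peval (D (enum_val i : I)) x.
  have := mulVmx unitB => /matrixP e.
  under eq_bigr => i _ do rewrite hB // peval_sum mulr_sumr.
  rewrite exchange_big /=.
  transitivity (\sum_(m < #|A|) (j == m)%:R * peval (mono (enum_val m)) x).
    rewrite (bigD1 j) //= eqxx mul1r big1 ?addr0 // => m.
    by rewrite eq_sym => /negPf ->; rewrite mul0r.
  apply: eq_bigr => m _; have := e j m; rewrite !mxE => <-; rewrite mulr_suml.
  by apply: eq_bigr => i _; rewrite pevalZ mulrA.
under eq_bigr => j _ do rewrite pevalZ mE mulr_sumr.
rewrite exchange_big /=; apply: eq_bigr => i _.
case: {-}_ / boolP => [h|]; last by rewrite enum_valP.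
rewrite mulr_suml; apply: eq_bigr => j _.
by rewrite enum_valK_in mulrA.
Qed.

Lemma facet_trace_coef q (a : I -> R) p : facet_index d p ->
  (forall x, simplex F x ->
    peval q x = \sum_(p | facet_index d p) a p * peval (D p) x) ->
  LF (q * D p) = a p * trace_norm R d p.1 p.2.
Proof.
move=> hp h; rewrite (_ : LF _ = LF (\sum_(p' | facet_index d p') a p' *: (D p' * D p))).
  rewrite (sint_sum F0 cardT indT FT) (bigD1 p) //= LFZ facet_trace_gramI // eqxx mul1r.
  rewrite big1 ?addr0 // => p' /andP[hp' pp'].
  by rewrite LFZ facet_trace_gramI // (negPf pp') mul0r mulr0.
apply: (sint_eq F0) => x Fx; rewrite pevalM h // mulr_suml peval_sum.
by apply: eq_bigr => p' _; rewrite pevalZ pevalM mulrA.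
Qed.

Lemma facet_trace_top_orthogonal p q : top_index d p -> deg_lt k q -> LF (D p * q) = 0.
Proof.
move=> /andP[/andP[_ v] /eqP e] dq.
by apply: (facet_trace_orthogonal_deg hd cardT indT oF TE orderF) => //; rewrite e.
Qed.

Lemma facet_trace_low p : facet_index d p -> ~~ top_index d p -> deg_lt k (D p).
Proof.
rewrite /top_index => hp; rewrite hp /= => ne; case/andP: (hp) => le v.
apply: (deg_lt_le _ (deg_lt_trace hd indT TE orderF _ v)).
by rewrite ltn_neqAle ne.
Qed.

(** Dropping the terms of top degree gives a projection, since these are orthogonal to lower
    degrees. This existence validates the [xget] in [facet_proj] for data that agree on [F] with a
    polynomial of degree at most [k]. *)
Lemma facet_projP q f : (forall x, simplex F x -> f x = peval q x) -> deg_lt k.+1 q ->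
  deg_lt k (facet_proj F k f) /\ forall r, deg_lt k r ->
    simplex_integral F (fun x => (f x - peval (facet_proj F k f) x) * peval r x) = 0.
Proof.
move=> fq dq; apply: (@xgetPex _ 0 [set p : mpoly d R | deg_lt k p /\
    forall q : mpoly d R, deg_lt k q ->
      simplex_integral F (fun x => (f x - peval p x) * peval q x) = 0]).
have [a ha] := facet_trace_span dq.
exists (\sum_(p | facet_index d p && ~~ top_index d p) a p *: D p); split.
  by apply: deg_lt_sum => p /andP[h1 h2]; apply/deg_ltZ/facet_trace_low.
move=> r dr; rewrite simplex_integralE //; apply/eqP; rewrite mulf_eq0; apply/orP; right.
rewrite (_ : sint F _ = LF (\sum_(p | top_index d p) a p *: (D p * r))).
  rewrite (sint_sum F0 cardT indT FT) big1 // => p hp.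
  by rewrite LFZ facet_trace_top_orthogonal // mulr0.
apply: (sint_eq F0) => x Fx; rewrite fq // (ha _ Fx) (bigID (fun p : I => top_index d p)) /= peval_sum.
rewrite [X in _ - X](eq_bigr _ (fun p _ => pevalZ (a p) (D p) x)).
rewrite addrK mulr_suml peval_sum; apply: eq_big => p.
  by rewrite /top_index andbA andbb.
by move=> _; rewrite pevalZ pevalM mulrA.
Qed.

Definition ntrace (u : 'rV[mpoly d R]_d) : mpoly d R :=
  \sum_c facet_normal F 0 c *: u 0 c.

Lemma ntraceE u x : normal_trace F u x = peval (ntrace u) x.
Proof.
by rewrite peval_sum; apply: eq_bigr => c _; rewrite mxE pevalZ mulrC.
Qed.

Lemma deg_lt_ntrace m u : vdeg_lt m u -> deg_lt m (ntrace u).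
Proof. by move=> h; apply: deg_lt_sum => c _; apply/deg_ltZ/h. Qed.

(** Coefficients exist: those along the trace polynomials are divided by the nonzero flux
    constant. *)
Lemma facet_coefP (u : discrete_field M) : vdeg_lt k.+1 (u T) ->
  forall x, simplex F x -> normal_trace F (u T) x =
      \sum_(p | facet_index d p)
         facet_coef k u T F p * (facet_flux T F o * peval (D p) x).
Proof.
move=> du; have nz := facet_flux_neq0 hd cardT indT oF TE orderF.
suff h : forall x, simplex F x -> normal_trace F (u T) x =
      \sum_(p | facet_index d p)
         facet_coef k u T F p * normal_trace F (facet_basis T F p.1 p.2) x.
  move=> x Fx; rewrite h //; apply: eq_bigr => p _.
  by rewrite (normal_trace_facet_basis hd cardT indT oF TE orderF).
apply: (@xgetPex _ [ffun=> 0] [set a : {ffun I -> R} |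
    forall x, simplex F x -> normal_trace F (u T) x =
      \sum_(p | facet_index d p)
         a p * normal_trace F (facet_basis T F p.1 p.2) x]).
have [a ha] := facet_trace_span (deg_lt_ntrace du).
exists [ffun p => a p / facet_flux T F o] => x Fx.
rewrite ntraceE ha //; apply: eq_bigr => p _.
by rewrite (normal_trace_facet_basis hd cardT indT oF TE orderF) // ffunE mulrA divfK.
Qed.

End FacetSpan.

(** * Independence of the normal traces from the element *)

Section FacetInvariance.
Variables (R : realType) (d : nat).
Hypothesis hd : d = 2%N \/ d = 3%N.

Lemma peval_facet_trace_eq (lam mu : 'I_d -> mpoly d R) i j x :
  (forall l, peval (lam l) x = peval (mu l) x) ->
  peval (facet_trace lam i j) x = peval (facet_trace mu i j) x.
Proof.
have f2 (l m l' m' : mpoly d R) p n : peval l x = peval l' x ->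
    peval m x = peval m' x -> peval (form2 l m p n) x = peval (form2 l' m' p n) x.
  move=> e e'; rewrite form2.unlock /scaled !peval_sum; apply: eq_bigr => t _.
  by rewrite !pevalM !pevalX !(pevalB, pevalD) e e'.
have f3 (l m q l' m' q' : mpoly d R) p n : peval l x = peval l' x ->
    peval m x = peval m' x -> peval q x = peval q' x ->
    peval (form3 l m q p n) x = peval (form3 l' m' q' p n) x.
  move=> e e' e2; rewrite form3.unlock /scaled !peval_sum; apply: eq_bigr => t _.
  by rewrite !pevalM !pevalX !(pevalB, pevalD) e e' e2.
move=> h; case: hd => e; subst d; rewrite /facet_trace.
  case: i => [|i]; rewrite /facet_trace2 ?pevalN ?peval1 // !pevalZ.
  by congr (_ * _); apply: f2.
case: i => [|i]; first case: j => [|n]; rewrite /facet_trace3 ?peval1 //.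
  exact: f3.
by rewrite !pevalZ !pevalM; congr (_ * (_ * _)); [exact: f2|exact: f3].
Qed.

Let triple_identity (A : comPzRingType) (a0 a1 a2 b0 b1 b2 n0 n1 n2 s t : A) :
  ((a1 + s * n1) * (b2 + t * n2) - (a2 + s * n2) * (b1 + t * n1)) * n0 +
  ((a2 + s * n2) * (b0 + t * n0) - (a0 + s * n0) * (b2 + t * n2)) * n1 +
  ((a0 + s * n0) * (b1 + t * n1) - (a1 + s * n1) * (b0 + t * n0)) * n2 =
  (a1 * b2 - a2 * b1) * n0 + (a2 * b0 - a0 * b2) * n1 + (a0 * b1 - a1 * b0) * n2.
Proof. by ring. Qed.

(** The pairing with [n] is a determinant with [n] as one row; multiples of [n] added to the other
    rows leave it unchanged. *)
Lemma facet_dual_normal_eq (g g' : 'I_d -> 'rV[R]_d) (t : 'I_d -> R) n l :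
  (forall m, g' m = g m + t m *: n) ->
  dot (facet_dual g' l) n = dot (facet_dual g l) n.
Proof.
move=> h; case: hd => e; subst d; rewrite /facet_dual.
  have dot2 (x : 'rV[R]_2) : dot x n = x 0 0 * n 0 0 + x 0 1 * n 0 1 by exact: sum_ord2.
  rewrite !dot2; move: l; apply: ord2P; rewrite ?facet_dual2_0 ?facet_dual2_1 h /= !rowD !rowZ; ring.
have dot3 (x : 'rV[R]_3) : dot x n = x 0 0 * n 0 0 + x 0 1 * n 0 1 + x 0 2%:R * n 0 2%:R.
  exact: sum_ord3.
have e11 : 1 + 1 = 2%:R :> 'I_3 by apply/val_inj.
have e12 : 1 + 2%:R = 0 :> 'I_3 by apply/val_inj.
have e21 : 2%:R + 1 = 0 :> 'I_3 by apply/val_inj.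
have e22 : 2%:R + 2%:R = 1 :> 'I_3 by apply/val_inj.
rewrite !dot3 /facet_dual3 !cross3E !h !add0r e11 e12 e21 e22 !rowD !rowZ.
exact: triple_identity.
Qed.

End FacetInvariance.

Section Veval.
Variables (R : realType) (d : nat).
Implicit Types u w : 'rV[mpoly d R]_d.

Lemma vevalD u w x : veval (u + w) x = veval u x + veval w x.
Proof. by apply/rowP => c; rewrite !mxE pevalD. Qed.

Lemma veval0 x : veval (0 : 'rV[mpoly d R]_d) x = 0.
Proof. by apply/rowP => c; rewrite !mxE peval0. Qed.

Lemma vevalZ a u x : veval (mpolyC d a *: u) x = a *: veval u x.
Proof. by apply/rowP => c; rewrite !mxE pevalM pevalC. Qed.

Lemma veval_sum (I : Type) (r : seq I) (P : pred I) (G : I -> 'rV[mpoly d R]_d) x :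
  veval (\sum_(i <- r | P i) G i) x = \sum_(i <- r | P i) veval (G i) x.
Proof.
by apply: (big_morph (fun u => veval u x)) => [u w|]; [exact: vevalD|exact: veval0].
Qed.

End Veval.

Lemma det_mx22 (R : realType) (A : 'M[R]_2) : \det A = A 0 0 * A 1 1 - A 0 1 * A 1 0.
Proof.
rewrite (expand_det_row _ ord0) !big_ord_recl big_ord0 /cofactor !det_mx11 !mxE.
have e0 : lift (lift ord0 ord0) 0 = 0 :> 'I_2 by apply/val_inj.
have e1 : lift ord0 0 = 1 :> 'I_2 by apply/val_inj.
have e2 : lift ord0 ord0 = 1 :> 'I_2 by apply/val_inj.
rewrite ?e0 ?e1 ?e2 addr0 /bump /=; ring.
Qed.

(** * Surface measure of facets *)

Section FacetGram.
Variables (R : realType) (d : nat) (M : mesh R d).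
Local Notation V := 'I_(nvert M).
Hypothesis hd : d = 2%N \/ d = 3%N.
Variables (T F : {set V}).
Hypothesis indT : affinely_independent T.
Hypothesis FT : F \subset T.
Hypothesis cardF : #|F| = d.

Let inT v : v \in F -> v \in T := fintype.subsetP FT v.

Let gram_identity (e f : 'rV[R]_d) :
  dot (dot e e *: f - dot e f *: e) (dot e e *: f - dot e f *: e) =
  dot e e * (dot e e * dot f f - dot e f ^+ 2).
Proof. rewrite dotBl !dotBr !dotZl !dotZr [dot f e]dotC; ring. Qed.

Let gram_gt0 (u v w : V) : u \in F -> v \in F -> w \in F ->
  u != v -> u != w -> v != w ->
  0 < dot (vert v - vert u) (vert v - vert u) * dot (vert w - vert u) (vert w - vert u) -
      dot (vert v - vert u) (vert w - vert u) ^+ 2.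
Proof.
move=> uF vF wF uv uw vw; set e := vert v - vert u; set f := vert w - vert u.
have ee : dot e e != 0.
  apply/eqP => /dot_eq0 e0; have := dot_bgrad indT (inT vF) (inT vF) (inT uF).
  by rewrite -/e e0 dotC dot0l eqxx (negPf uv) subr0 => /esym/eqP; rewrite oner_eq0.
have ee0 : 0 < dot e e by rewrite lt_neqAle eq_sym ee dot_ge0.
(* Strict Cauchy-Schwarz: [y] is a multiple of the part of [f] orthogonal to [e], and it is nonzero
   because the gradient of the coordinate of [w] pairs with it to [dot e e]. *)
pose y := dot e e *: f - dot e f *: e.
have yy : dot y y = dot e e * (dot e e * dot f f - dot e f ^+ 2).
  exact: gram_identity.
have : dot y y != 0.
  apply/eqP => /dot_eq0 y0; have : dot (bgrad T w) y = dot e e.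
    rewrite /y dotBr !dotZr !(dot_bgrad indT) ?inT // eqxx (negPf uw) (negPf vw).
    by rewrite !subr0 mulr0 subr0 mulr1.
  by rewrite y0 dotC dot0l => /esym/eqP; rewrite (negPf ee).
move=> yn; have : 0 < dot y y by rewrite lt_neqAle eq_sym yn dot_ge0.
by rewrite yy pmulr_rgt0.
Qed.

(** Positivity allows the factor to be cancelled from orthogonality relations; the upper bound gives
    the scaling of facet integrals. *)
Lemma sgram_facet h : (forall v w, v \in F -> w \in F -> enorm (vert v - vert w) <= h) ->
  0 < sgram F <= h ^+ d.-1.
Proof.
move=> hF; have uF := enum_uniq F; have memF v : v \in enum F -> v \in F.
  by rewrite mem_enum.
have h0 : 0 <= h.
  have /finset.set0Pn[v vF] : F != finset.set0 by rewrite -card_gt0 cardF; case: hd => ->.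
  exact: le_trans (enorm_ge0 _) (hF v v vF vF).
have sF : size (enum F) = d by rewrite -cardE.
rewrite /sgram; case: hd => dE; rewrite [in X in h ^+ X]dE; have := etrans sF dE.
  case eF : (enum F) => [|v [|w [|? ?]]] //= _.
  rewrite det_mx11 mxE /= -/(enorm (vert w - vert v)).
  move: uF; rewrite eF /= inE => /andP[vw _].
  have vF : v \in F by apply: memF; rewrite eF inE eqxx.
  have wF : w \in F by apply: memF; rewrite eF !inE eqxx orbT.
  rewrite expr1 hF // andbT lt_neqAle enorm_ge0 andbT eq_sym /enorm sqrtr_eq0 -ltNge.
  rewrite lt_neqAle dot_ge0 andbT eq_sym; apply/eqP => /dot_eq0 e0.
  have := dot_bgrad indT (inT wF) (inT wF) (inT vF).
  by rewrite e0 dotC dot0l eqxx (negPf vw) subr0 => /esym/eqP; rewrite oner_eq0.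
case eF : (enum F) => [|u [|v [|w [|? ?]]]] //= _.
rewrite det_mx22 !mxE /=.
move: uF; rewrite eF /= !inE negb_or => /and3P[/andP[uv uw] vw _].
have uF : u \in F by apply: memF; rewrite eF inE eqxx.
have vF : v \in F by apply: memF; rewrite eF !inE eqxx orbT.
have wF : w \in F by apply: memF; rewrite eF !inE eqxx !orbT.
have := gram_gt0 uF vF wF uv uw vw; rewrite /= expr2 => g0.
rewrite [X in _ - _ * X]dotC sqrtr_gt0 g0 /=.
rewrite -ler_sqr ?nnegrE ?sqrtr_ge0 ?exprn_ge0 // sqr_sqrtr ?(ltW g0) //.
have eh v' w' : v' \in F -> w' \in F ->
    dot (vert v' - vert w') (vert v' - vert w') <= h ^+ 2.
  by move=> v'F w'F; rewrite -enorm_sqr lerXn2r ?nnegrE ?enorm_ge0 // hF.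
apply: (@le_trans _ _ (dot (vert v - vert u) (vert v - vert u) *
  dot (vert w - vert u) (vert w - vert u))).
  by rewrite gerBl -expr2 sqr_ge0.
by rewrite [leRHS]expr2 ler_pM ?dot_ge0 ?eh.
Qed.

End FacetGram.

(** * The averaging operator *)

Section Averaging.
Variables (R : realType) (d k : nat) (M : mesh R d) (Om : set 'rV[R]_d).
Local Notation V := 'I_(nvert M).
Hypothesis hd : d = 2%N \/ d = 3%N.
Hypothesis tri : triangulation Om M.
Implicit Types (T F : {set V}).

Local Notation I := ('I_k.+1 * 'I_k.+1)%type.
Local Notation lam T F := (fun l => barycentric T (tnth (forder F) l)).

Lemma cell_facetP T F : F \in facets M -> T \in cells_at F ->
  [/\ #|T| = d.+1, affinely_independent T, [set v in forder F]%SET = F,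
      F \subset T & exists2 o, o \notin F & T = o |: F].
Proof.
case: tri => cells_simplex _ _ order FM; rewrite inE => /andP[TM FT].
have [cT iT] := cells_simplex _ TM; split=> //; first exact: order.
apply: facet_opposite => //; by move: FM; rewrite inE => /andP[/eqP].
Qed.

Lemma card_facets F : F \in facets M -> #|F| = d.
Proof. by rewrite inE => /andP[/eqP]. Qed.

Lemma cells_at_cells T F : T \in cells_at F -> T \in cells M.
Proof. by rewrite inE => /andP[]. Qed.

Lemma sgram_facet_gt0 F : F \in facets M -> 0 < sgram F.
Proof.
move=> FM; have := FM; rewrite inE => /andP[/eqP cF /exists_inP[T TM FT]].
case: tri => cells_simplex _ _ _; have [cT iT] := cells_simplex _ TM.
pose h := \sum_(v in F) \sum_(w in F) enorm (vert v - vert w).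
have hF v w : v \in F -> w \in F -> enorm (vert v - vert w) <= h.
  move=> vF wF; rewrite /h (bigD1 v) //= (bigD1 w) //= -addrA lerDl.
  by rewrite addr_ge0 // sumr_ge0 // => u _; rewrite ?enorm_ge0 // sumr_ge0 // => ? _; rewrite enorm_ge0.
by have /andP[] := sgram_facet hd iT FT cF hF.
Qed.

Lemma facet_not_set0 F : F \in facets M -> F != finset.set0.
Proof. by move=> /card_facets cF; rewrite -card_gt0 cF; case: hd => ->. Qed.

Lemma barycentric_facet_eq T T' F v x : F \in facets M ->
  T \in cells_at F -> T' \in cells_at F -> v \in F -> simplex F x ->
  peval (barycentric T v) x = peval (barycentric T' v) x.
Proof.
move=> FM TF T'F vF [c [_ c1 ->]].
have [cT iT _ FT _] := cell_facetP FM TF; have [cT' iT' _ FT' _] := cell_facetP FM T'F.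
have vT := fintype.subsetP FT _ vF; have vT' := fintype.subsetP FT' _ vF.
by rewrite (barycentric_comb iT FT) // (barycentric_comb iT' FT') // vF.
Qed.

Lemma facet_trace_cells T T' F i j x : F \in facets M ->
  T \in cells_at F -> T' \in cells_at F -> simplex F x ->
  peval (facet_trace (lam T F) i j) x = peval (facet_trace (lam T' F) i j) x.
Proof.
move=> FM TF T'F Fx; apply: peval_facet_trace_eq => // l.
have [_ _ oF _ _] := cell_facetP FM TF.
by apply: (barycentric_facet_eq FM) => //; apply: forder_in.
Qed.

(** Taken in the two elements, the gradients of a facet vertex agree along [F], so they differ by a
    multiple of the normal, which the flux does not see. *)
Lemma facet_flux_cells T T' F o o' : F \in facets M ->
  T \in cells_at F -> T' \in cells_at F ->
  o \notin F -> T = o |: F -> o' \notin F -> T' = o' |: F ->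
  facet_flux T F o = facet_flux T' F o'.
Proof.
move=> FM TF T'F oF TE oF' TE'.
have [cT iT orderF FT _] := cell_facetP FM TF; have [cT' iT' _ FT' _] := cell_facetP FM T'F.
have d0 : (0 < d)%N by case: hd => ->.
have l := Ordinal d0.
rewrite -(dot_facet_dual_normal hd cT iT oF TE orderF l).
rewrite -(dot_facet_dual_normal hd cT' iT' oF' TE' orderF l).
have h (m : 'I_d) : exists t, bgrad T (tnth (forder F) m) =
    bgrad T' (tnth (forder F) m) + t *: facet_normal F.
  have mF := forder_in orderF m.
  have [|c e] := orthogonal_facet hd cT iT oF TE
      (y := bgrad T (tnth (forder F) m) - bgrad T' (tnth (forder F) m)).
    move=> v w vF wF; have inT u : u \in F -> u \in T := fintype.subsetP FT u.
    have inT' u : u \in F -> u \in T' := fintype.subsetP FT' u.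
    by rewrite dotBl (dot_bgrad iT) ?inT // (dot_bgrad iT') ?inT' // subrr.
  exists (c * normal_deriv T F o).
  by rewrite -scalerA -(bgrad_opposite hd cT iT oF TE) -e addrC subrK.
have [t ht] := choice h.
exact: facet_dual_normal_eq ht.
Qed.

(** The vertex opposite to [F'] lies on [F], so the normal of [F'] is parallel to a gradient dual to
    the facet vectors; the flux is a multiple of the form of that vertex, which vanishes together
    with its coordinate. *)
Lemma facet_basis_other T F F' i j x : T \in cells_at F -> T \in cells_at F' ->
  F \in facets M -> F' \in facets M -> F != F' -> simplex F' x ->
  normal_trace F' (facet_basis T F i j) x = 0.
Proof.
move=> TF TF' FM FM' FF' Fx.
have [cT iT orderF FT [v vF TE]] := cell_facetP FM TF.
have [_ _ _ FT' [v' vF' TE']] := cell_facetP FM' TF'.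
have v'F : v' \in F.
  have : v' \in T by rewrite TE' finset.setU11.
  rewrite TE finset.in_setU1 => /orP[/eqP e|//].
  case/eqP: FF'; rewrite -(setD1_opposite vF TE) -(setD1_opposite vF' TE').
  by rewrite e.
have [m e] := forderP orderF v'F.
have nz := normal_deriv_neq0 hd cT iT vF' TE'.
rewrite /normal_trace (_ : facet_normal F' = (normal_deriv T F' v')^-1 *: bgrad T v'); last first.
  by rewrite (bgrad_opposite hd cT iT vF' TE') scalerA mulVf ?scale1r.
rewrite dotZr e (dot_facet_basis_bgrad hd iT TE orderF).
rewrite facet_form_root ?mulr0 // -e.
exact: (barycentric_opposite iT vF' TE').
Qed.

Variable v : discrete_field M.
Hypothesis v_poly : broken_poly k v.

(** Only the corrections attached to [F] itself have a normal component on [F]; they turn the top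
    coefficients into averages and keep the others. *)
Lemma normal_trace_RW T F o x : F \in facets M -> T \in cells_at F ->
  o \notin F -> T = o |: F -> simplex F x ->
  normal_trace F (RW k v T) x = \sum_(p : I | facet_index d p)
    (if top_index d p then avg_coef v F p else facet_coef k v T F p) *
    (facet_flux T F o * peval (facet_trace (lam T F) p.1 p.2) x).
Proof.
move=> FM TF oF TE Fx; have [cT iT orderF FT _] := cell_facetP FM TF.
have TM := cells_at_cells TF.
rewrite /normal_trace /RW vevalD dotDl -/(normal_trace F (v T) x).
rewrite (facet_coefP hd cT iT oF TE orderF (v_poly TM)) //.
rewrite veval_sum (bigD1 F) /=; last by rewrite FM FT.
rewrite dotDl dot_suml [X in _ + (_ + X)]big1 ?addr0; last first.
  move=> F' /andP[/andP[FM' FT'] FF'].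
  rewrite veval_sum dot_suml big1 // => p _; rewrite vevalZ dotZl.
  rewrite -[dot _ _]/(normal_trace F (facet_basis T F' p.1 p.2) x).
  by rewrite facet_basis_other ?mulr0 // inE TM.
rewrite veval_sum dot_suml.
rewrite [X in _ + X](_ : _ = \sum_(p : I | facet_index d p) if top_index d p then
    (avg_coef v F p - facet_coef k v T F p) *
    (facet_flux T F o * peval (facet_trace (lam T F) p.1 p.2) x) else 0); last first.
  rewrite -big_mkcondr; apply: eq_big => [p|p _]; first by rewrite /top_index andbA andbb.
  rewrite vevalZ dotZl -[dot _ _]/(normal_trace F (facet_basis T F p.1 p.2) x).
  by rewrite (normal_trace_facet_basis hd cT iT oF TE orderF).
rewrite -big_split; apply: eq_bigr => p _ /=.
by case: ifP => _; rewrite ?addr0 // -mulrDl addrC subrK.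
Qed.

Lemma broken_poly_RW : (0 < k)%N -> broken_poly k (RW k v).
Proof.
move=> k0 T TM c; rewrite /RW mxE; apply: deg_ltD; first exact: v_poly.
rewrite summxE; apply: deg_lt_sum => F /andP[FM FT].
have TF : T \in cells_at F by rewrite inE TM.
have [cT iT orderF _ [w wF TE]] := cell_facetP FM TF.
rewrite summxE; apply: deg_lt_sum => p /andP[/andP[_ val] /eqP e].
rewrite rowZ mul_mpolyC; apply: deg_ltZ.
have p0 : (0 < p.1 + p.2)%N by rewrite e.
by have := deg_lt_facet_basis hd iT TE orderF c val p0; rewrite e.
Qed.

Hypothesis v_minus : forall F g, F \in facets M -> normal_jump v F g ->
  forall x, simplex F x -> peval (facet_proj F k g) x = 0.

(** Testing the jump with a trace polynomial of degree below [k] isolates one coefficient, and the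
    integral is 0 because the projection of the jump vanishes on [F]. *)
Let low_eq0 T F (g : 'rV[R]_d -> R) (a : I -> R) p : F \in facets M -> T \in cells_at F ->
  normal_jump v F g ->
  (forall x, simplex F x -> g x = \sum_(p | facet_index d p)
     a p * peval (facet_trace (lam T F) p.1 p.2) x) ->
  facet_index d p -> ~~ top_index d p -> a p = 0.
Proof.
move=> FM TF jg ga hp hp'.
have [cT iT orderF FT [w wF TE]] := cell_facetP FM TF.
pose q := \sum_(p : I | facet_index d p) a p *: facet_trace (lam T F) p.1 p.2.
have gq x : simplex F x -> g x = peval q x.
  move=> Fx; rewrite ga // peval_sum; apply: eq_bigr => p' _.
  by rewrite pevalZ.
have dq : deg_lt k.+1 q.
  apply: deg_lt_sum => p' /andP[h1 h2]; apply: deg_ltZ.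
  by apply: (deg_lt_le _ (deg_lt_trace hd iT TE orderF _ h2)).
have [_ /(_ _ (facet_trace_low hd iT TE orderF hp hp'))] :=
  facet_projP hd cT iT wF TE orderF gq dq.
rewrite simplex_integralE ?facet_not_set0 // => /eqP.
rewrite mulf_eq0 gt_eqF ?sgram_facet_gt0 //= => /eqP.
rewrite (sint_eq (g := peval (q * facet_trace (lam T F) p.1 p.2)) (facet_not_set0 FM)).
  rewrite (facet_trace_coef (p := p) (a := a) hd cT iT wF TE orderF) //.
    by move=> /eqP; rewrite mulf_eq0 (gt_eqF (trace_norm_gt0 _ _ _ _)) orbF => /eqP.
  by move=> x Fx; rewrite -gq // ga.
by move=> x Fx; rewrite (v_minus FM jg Fx) subr0 gq // pevalM.
Qed.

Lemma low_coef_eq T T' F p : F \in facets M -> T \in cells_at F -> T' \in cells_at F ->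
  interior_facet F -> facet_index d p -> ~~ top_index d p ->
  facet_coef k v T F p = facet_coef k v T' F p.
Proof.
move=> FM TF T'F intF hp hp'; have [->//|TT'] := eqVneq T T'.
have [cT iT orderF FT [w wF TE]] := cell_facetP FM TF.
have [cT' iT' _ FT' [w' wF' TE']] := cell_facetP FM T'F.
have fe := facet_flux_cells FM TF T'F wF TE wF' TE'.
have nz := facet_flux_neq0 hd cT iT wF TE orderF.
have := @low_eq0 T F (fun x => normal_trace F (v T) x - normal_trace F (v T') x)
  (fun p => (facet_coef k v T F p - facet_coef k v T' F p) * facet_flux T F w) p FM TF.
move=> h; apply/eqP; rewrite -subr_eq0; apply/eqP.
apply: (mulIf nz); rewrite mul0r; apply: h => //.
  by rewrite /normal_jump /= intF; exists T, T'.
move=> x Fx; rewrite (facet_coefP hd cT iT wF TE orderF (v_poly (cells_at_cells TF))) //.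
rewrite (facet_coefP hd cT' iT' wF' TE' orderF (v_poly (cells_at_cells T'F))) //.
rewrite -sumrB; apply: eq_bigr => p' _.
by rewrite -(facet_trace_cells _ _ FM TF T'F Fx) -fe; ring.
Qed.

Lemma low_coef_eq0 T F p : F \in facets M -> T \in cells_at F ->
  ~~ interior_facet F -> facet_index d p -> ~~ top_index d p ->
  facet_coef k v T F p = 0.
Proof.
move=> FM TF extF hp hp'.
have [cT iT orderF FT [w wF TE]] := cell_facetP FM TF.
have nz := facet_flux_neq0 hd cT iT wF TE orderF.
apply: (mulIf nz); rewrite mul0r.
apply: (@low_eq0 T F (normal_trace F (v T))
  (fun p => facet_coef k v T F p * facet_flux T F w) p FM TF) => //.
  by rewrite /normal_jump /= (negPf extF); exists T.
move=> x Fx; rewrite (facet_coefP hd cT iT wF TE orderF (v_poly (cells_at_cells TF))) //.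
by apply: eq_bigr => p' _; rewrite mulrA.
Qed.

Lemma W_space_RW : (0 < k)%N -> W_space k (RW k v).
Proof.
move=> k0; split=> [|F g FM]; first exact: broken_poly_RW.
rewrite /normal_jump /=; case: ifPn => [intF [T [T' [TF T'F _ ->]]] x Fx|extF [T TF ->] x Fx].
  have [cT iT orderF FT [w wF TE]] := cell_facetP FM TF.
  have [cT' iT' _ FT' [w' wF' TE']] := cell_facetP FM T'F.
  rewrite (normal_trace_RW FM TF wF TE Fx) (normal_trace_RW FM T'F wF' TE' Fx).
  apply/eqP; rewrite subr_eq0; apply/eqP; apply: eq_bigr => p hp.
  rewrite -(facet_flux_cells FM TF T'F wF TE wF' TE') -(facet_trace_cells _ _ FM TF T'F Fx).
  by case: ifPn => // hp'; rewrite (low_coef_eq FM TF T'F).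
have [cT iT orderF FT [w wF TE]] := cell_facetP FM TF.
rewrite (normal_trace_RW FM TF wF TE Fx) big1 // => p hp.
rewrite /avg_coef (negPf extF); case: ifPn => [|hp']; first by rewrite mul0r.
by rewrite (low_coef_eq0 FM TF) // mul0r.
Qed.

(** Top terms integrate to 0 against [phi], and the lower coefficients agree from both sides or
    vanish on the boundary; so the two one-sided traces may come from different elements. *)
Lemma normal_moment_RW F T T' phi : F \in facets M ->
  T \in cells_at F -> T' \in cells_at F -> deg_lt k phi ->
  simplex_integral F (fun x => normal_trace F (RW k v T) x * peval phi x) =
  simplex_integral F (fun x => normal_trace F (v T') x * peval phi x).
Proof.
move=> FM TF T'F dphi.
have [cT iT orderF FT [w wF TE]] := cell_facetP FM TF.
have [cT' iT' _ FT' [w' wF' TE']] := cell_facetP FM T'F.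
have F0 := facet_not_set0 FM.
rewrite !simplex_integralE //; congr (_ * _).
pose S (a : I -> R) := \sum_(p : I | facet_index d p)
  (a p * facet_flux T F w) *: (facet_trace (lam T F) p.1 p.2 * phi).
pose a1 p := if top_index d p then avg_coef v F p else facet_coef k v T F p.
rewrite (sint_eq (g := peval (S a1)) F0); last first.
  move=> x Fx; rewrite (normal_trace_RW FM TF wF TE Fx) mulr_suml peval_sum.
  by apply: eq_bigr => p _; rewrite pevalZ pevalM !mulrA.
rewrite [RHS](sint_eq (g := peval (S (facet_coef k v T' F))) F0); last first.
  move=> x Fx; rewrite (facet_coefP hd cT' iT' wF' TE' orderF (v_poly (cells_at_cells T'F))) //.
  rewrite mulr_suml peval_sum; apply: eq_bigr => p _.
  rewrite -(facet_flux_cells FM TF T'F wF TE wF' TE') -(facet_trace_cells _ _ FM TF T'F Fx).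
  by rewrite pevalZ pevalM !mulrA.
rewrite !(sint_sum F0 cT iT FT); apply: eq_bigr => p hp.
rewrite !(sintZ F0 cT iT FT) /a1; case: ifPn => hp'.
  by rewrite (facet_trace_top_orthogonal hd cT iT wF TE orderF hp') // !mulr0.
have [intF|extF] := boolP (interior_facet F); first by rewrite (low_coef_eq FM TF T'F).
by rewrite (low_coef_eq0 FM TF) // (low_coef_eq0 FM T'F).
Qed.

Lemma cell_moment_RW T phi : T \in cells M -> vdeg_lt k.-1 phi ->
  simplex_integral T (fun x => dot (veval (RW k v T) x) (veval phi x)) =
  simplex_integral T (fun x => dot (veval (v T) x) (veval phi x)).
Proof.
move=> TM dphi.
have [cT iT] : #|T| = d.+1 /\ affinely_independent T by case: tri => h _ _ _; apply: h.
have T0 := cell_neq0 cT; have TT := fintype.subxx T.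
rewrite !simplex_integralE //; congr (_ * _).
pose S (u : 'rV[mpoly d R]_d) := \sum_c u 0 c * phi 0 c.
have SE u x : dot (veval u x) (veval phi x) = peval (S u) x.
  by rewrite peval_sum; apply: eq_bigr => c _; rewrite !mxE pevalM.
rewrite (sint_eq (g := peval (S (RW k v T))) T0) => [|x _]; last exact: SE.
rewrite [RHS](sint_eq (g := peval (S (v T))) T0) => [|x _]; last exact: SE.
have -> : S (RW k v T) = S (v T) + \sum_(F in facets M | F \subset T)
    \sum_(p : I | top_index d p) (avg_coef v F p - facet_coef k v T F p) *:
      S (facet_basis T F p.1 p.2).
  rewrite /S /RW.
  under eq_bigr => c _.
    rewrite mxE mulrDl summxE mulr_suml; over.
  rewrite big_split /=; congr (_ + _); rewrite exchange_big; apply: eq_bigr => F _ /=.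
  under eq_bigr => c _.
    rewrite summxE mulr_suml; over.
  rewrite exchange_big; apply: eq_bigr => p _ /=; rewrite scaler_sumr; apply: eq_bigr => c _.
  by rewrite rowZ mul_mpolyC scalerAl.
rewrite (sintD T0 cT iT TT) [X in _ + X](_ : _ = 0) ?addr0 //.
rewrite (sint_sum T0 cT iT TT) big1 // => F /andP[FM FT].
have TF : T \in cells_at F by rewrite inE TM.
have [_ _ orderF _ [w wF TE]] := cell_facetP FM TF.
rewrite (sint_sum T0 cT iT TT) big1 // => p /andP[/andP[_ val] /eqP e].
rewrite (sintZ T0 cT iT TT) (_ : sint T _ = 0) ?mulr0 //.
rewrite (sint_sum T0 cT iT TT) big1 // => c _.
rewrite (facet_basisE hd iT TE orderF) mulr_suml (sint_sum T0 cT iT TT) big1 // => l _.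
rewrite mulrAC mulrC mul_mpolyC (sintZ T0 cT iT TT).
rewrite (facet_basis_orthogonal hd cT iT wF TE orderF) ?mulr0 // e.
exact: dphi.
Qed.

End Averaging.

(** * Geometry of shape-regular meshes *)

Section Determinant.
Variable R : realType.

Lemma det_bound n (A : 'M[R]_n) m : (forall i j, `|A i j| <= m) ->
  `|\det A| <= n`!%:R * m ^+ n.
Proof.
move=> h; rewrite /determinant (le_trans (ler_norm_sum _ _ _)) //.
have -> : n`!%:R * m ^+ n = \sum_(s : {perm 'I_n}) m ^+ n.
  by rewrite sumr_const card_Sn mulr_natl.
apply: ler_sum => s _; rewrite normrM normrX normrN1 expr1n mul1r normr_prod.
apply: (@le_trans _ _ (\prod_(i < n) m)); last by rewrite prodr_const card_ord.
by apply: ler_prod => i _; rewrite normr_ge0 h.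
Qed.

End Determinant.

(** * Size and shape of one element *)

Section CellGeometry.
Variables (R : realType) (d : nat) (M : mesh R d).
Local Notation V := 'I_(nvert M).
Hypothesis d_gt0 : (0 < d)%N.
Variable T : {set V}.
Hypothesis cardT : #|T| = d.+1.
Hypothesis indT : affinely_independent T.

Lemma barycentric_simplex v x : v \in T -> simplex T x ->
  0 <= peval (barycentric T v) x <= 1.
Proof.
move=> vT [c [c0 c1 ->]]; rewrite (barycentric_comb indT (fintype.subxx T)) // vT.
rewrite c0 //= -c1 (bigD1 v) //= lerDl sumr_ge0 // => w /andP[wT _]; exact: c0.
Qed.

Lemma simplex_barycentric x : (forall v, v \in T -> 0 <= peval (barycentric T v) x) ->
  simplex T x.
Proof.
move=> h; exists (fun v => peval (barycentric T v) x); split=> //.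
  by rewrite -peval_sum (sum_barycentric cardT indT) peval1.
apply/rowP => i; have := congr1 (fun p => peval p x) (coord_barycentric cardT indT i).
rewrite /= pevalXU peval_sum => ->; rewrite summxE; apply: eq_bigr => v _.
by rewrite pevalZ mxE mulrC.
Qed.

Let verts := \sum_(v in T) enorm (vert v).

Let simplex_bound x : simplex T x -> enorm x <= verts.
Proof.
move=> Tx; have [c [c0 c1 e]] := Tx; rewrite e.
apply: (@le_trans _ _ (\sum_(v in T) enorm (c v *: vert v))).
  apply: (big_ind2 (fun x y => enorm x <= y)) => //.
    by rewrite /enorm dot0l sqrtr0.
  by move=> x1 y1 x2 y2 h1 h2; apply: le_trans (enormD _ _) (lerD h1 h2).
apply: ler_sum => v vT; rewrite enormZ ger0_norm ?c0 // ler_piMl ?enorm_ge0 //.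
by rewrite -c1 (bigD1 v) //= lerDl sumr_ge0 // => w /andP[wT _]; exact: c0.
Qed.

Let T0 := cell_neq0 cardT.

Lemma diameter_ge x y : simplex T x -> simplex T y -> enorm (x - y) <= diameter T.
Proof.
move=> Tx Ty; apply: ub_le_sup; last by exists x, y.
exists (verts + verts) => _ [a [b [Ta Tb ->]]].
by rewrite (le_trans (enormD _ _)) // enormN lerD ?simplex_bound.
Qed.

Lemma edge_le_diameter v w : v \in T -> w \in T -> enorm (vert v - vert w) <= diameter T.
Proof. by move=> vT wT; apply: diameter_ge; apply: simplex_vert. Qed.

(** Along the edge the coordinate of [v] changes by 1, at most the norm of its gradient times the
    length. *)
Lemma enorm_edge_gt0 v w : v \in T -> w \in T -> v != w ->
  1 <= enorm (bgrad T v) * enorm (vert v - vert w).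
Proof.
move=> vT wT vw; have := dot_bgrad indT vT vT wT.
rewrite eqxx eq_sym (negPf vw) subr0 => e; rewrite -[leLHS]e.
exact: le_trans (ler_norm _) (dot_le_enorm _ _).
Qed.

Lemma diameter_gt0 : 0 < diameter T.
Proof.
have : (1 < #|T|)%N by rewrite cardT.
case/card_gt1P => v [w [vT wT vw]]; have := enorm_edge_gt0 vT wT vw.
move=> h1; rewrite ltNge; apply/negP => h0; move: h1.
rewrite leNgt => /negP; apply; apply: le_lt_trans ltr01.
rewrite mulr_ge0_le0 ?enorm_ge0 //.
exact: le_trans (edge_le_diameter vT wT) h0.
Qed.

Let balls := [set r : R | 0 <= r /\ exists x, forall y, enorm (y - x) <= r -> simplex T y].

Let balls0 : balls 0.
Proof.
split=> //; have /finset.set0Pn[v vT] := T0; exists (vert v) => y h.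
have : enorm (y - vert v) = 0 by apply/eqP; rewrite eq_le h enorm_ge0.
move=> e; have /dot_eq0 /eqP : dot (y - vert v) (y - vert v) = 0.
  by rewrite -enorm_sqr e expr0n.
by rewrite subr_eq0 => /eqP ->; apply: simplex_vert.
Qed.

(** Moving from the centre by [r] against the gradient stays in the simplex and lowers the
    coordinate of [v] by [r] times the norm of the gradient, while the coordinate stays within
    [[0, 1]]. *)
Let balls_bound r v : v \in T -> balls r -> r * enorm (bgrad T v) <= 1.
Proof.
move=> vT [r0 [x hx]]; set g := bgrad T v; set e := enorm g.
have [e0|e0] := eqVneq e 0; first by rewrite e0 mulr0.
have Tx : simplex T x by apply: hx; rewrite subrr /enorm dot0l sqrtr0.
pose y := x - (r / e) *: g.
have Ty : simplex T y.
  apply: hx; rewrite /y addrC addKr enormN enormZ -/e ger0_norm ?divfK //.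
  by rewrite divr_ge0 // enorm_ge0.
have /andP[_ l1] := barycentric_simplex vT Tx.
have /andP[l0 _] := barycentric_simplex vT Ty.
have := peval_barycentricB indT x y vT.
rewrite (_ : x - y = (r / e) *: g); last by rewrite /y opprB addrC subrK.
rewrite dotZr -enorm_sqr -/e (_ : r / e * e ^+ 2 = r * e); last by field.
by move=> <-; rewrite lerBlDr (le_trans l1) // lerDl.
Qed.

Lemma bgrad_inradius v : v \in T -> enorm (bgrad T v) * inradius T <= 1.
Proof.
move=> vT; have [e0|e0] := eqVneq (enorm (bgrad T v)) 0; first by rewrite e0 mul0r.
have ep : 0 < enorm (bgrad T v) by rewrite lt_neqAle eq_sym e0 enorm_ge0.
rewrite mulrC -ler_pdivlMr //; apply: ge_sup; first by exists 0.
by move=> r br; rewrite ler_pdivlMr // balls_bound.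
Qed.

(** The supremum has its meaning only for a bounded set: the bound comes from a vertex with nonzero
    gradient, and 0 is an admissible radius. *)
Lemma inradius_ge0 : 0 <= inradius T.
Proof.
apply: ub_le_sup; last exact: balls0.
have : (1 < #|T|)%N by rewrite cardT.
case/card_gt1P => v [w [vT wT vw]].
have ep : 0 < enorm (bgrad T v).
  rewrite lt_neqAle enorm_ge0 andbT; apply: contraTneq (enorm_edge_gt0 vT wT vw) => <-.
  by rewrite mul0r -ltNge.
exists (enorm (bgrad T v))^-1 => r br.
by rewrite -[leRHS]mul1r ler_pdivlMr // balls_bound.
Qed.

Variable sigma : R.
Hypothesis regular : diameter T <= sigma * inradius T.

Lemma regularity_gt0 : 0 < sigma.
Proof.
have := lt_le_trans diameter_gt0 regular.
by case: (ltrgtP sigma 0) => // [s0|->]; rewrite ?mul0r ?ltxx // nmulr_rgt0 // ltNge inradius_ge0.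
Qed.

(** The norm of a gradient times the inradius is at most 1, and shape regularity trades the inradius
    for [diameter T / sigma]. *)
Lemma enorm_bgrad v : v \in T -> enorm (bgrad T v) <= sigma / diameter T.
Proof.
move=> vT; rewrite ler_pdivlMr ?diameter_gt0 //.
apply: le_trans (ler_wpM2l (enorm_ge0 _) regular) _.
by rewrite mulrCA ler_piMr ?bgrad_inradius // ltW // regularity_gt0.
Qed.

Lemma regularity_edge v w : v \in T -> w \in T -> v != w ->
  diameter T <= sigma * enorm (vert v - vert w).
Proof.
move=> vT wT vw; have := enorm_edge_gt0 vT wT vw.
have := ler_wpM2r (enorm_ge0 (vert v - vert w)) (enorm_bgrad vT).
move=> h /le_trans /(_ h); rewrite mulrAC ler_pdivlMr ?diameter_gt0 // mul1r.
by [].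
Qed.

Let edges (v0 : V) (s : seq V) : 'M[R]_d := \matrix_(i, c) (vert (nth v0 s i) - vert v0) 0 c.

(** The Gram determinant is the square of the edge determinant, whose inverse is the determinant of
    the gradients; an upper bound of the gradients thus bounds the volume from below. *)
Let edge_bound v0 s : enum T = v0 :: s ->
  sgram T = `|\det (edges v0 s)| /\
  \det (\matrix_(i < d, c < d) bgrad T (nth v0 s i) 0 c) * \det (edges v0 s) = 1.
Proof.
move=> eT; have us := enum_uniq T; rewrite eT /= in us.
have /andP[v0s us'] := us.
have ss : size s = d by have := cardE T; rewrite cardT eT /= => -[].
have inT v : v \in v0 :: s -> v \in T by rewrite -eT mem_enum.
split.
  rewrite /sgram eT /=; set E := [seq _ | b <- _].
  have sE : size E = d by rewrite !size_map.
  have -> : \det (\matrix_(i < size E, j < size E) dot E`_i E`_j) =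
      \det (\matrix_(i < d, j < d) dot E`_i E`_j) by rewrite sE.
  have -> : \matrix_(i < d, j < d) dot E`_i E`_j = edges v0 s *m (edges v0 s)^T.
    apply/matrixP => i j; rewrite !mxE; apply: eq_bigr => c _.
    by rewrite !mxE /E -!map_comp !(nth_map v0) ?ss //= !mxE.
  by rewrite det_mulmx det_tr -expr2 sqrtr_sqr.
rewrite -[\det (edges _ _)]det_tr -det_mulmx -[RHS](det1 R d); congr (\det _).
apply/matrixP => i j; rewrite !mxE.
have iT l : (l < d)%N -> nth v0 s l \in T.
  by move=> ld; apply: inT; rewrite inE mem_nth ?orbT // ss.
have := dot_bgrad indT (iT i (ltn_ord i)) (iT j (ltn_ord j)) (inT v0 (mem_head _ _)).
rewrite nth_uniq ?ss // (_ : (v0 == _) = false) ?subr0; last first.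
  by apply: contraNF v0s => /eqP ->; rewrite mem_nth ?ss.
rewrite eq_sym => <-.
by apply: eq_bigr => c _; rewrite !mxE.
Qed.

Lemma sgram_cell : d`!%:R^-1 * (diameter T / sigma) ^+ d <= sgram T <= d`!%:R * diameter T ^+ d.
Proof.
case eT : (enum T) => [|v0 s].
  by have := cardE T; rewrite cardT eT.
have inT v : v \in v0 :: s -> v \in T by rewrite -eT mem_enum.
have ss : size s = d by have := cardE T; rewrite cardT eT /= => -[].
have iT l : (l < d)%N -> nth v0 s l \in T.
  by move=> ld; apply: inT; rewrite inE mem_nth ?orbT // ss.
have [-> e] := edge_bound eT; apply/andP; split; last first.
  apply: det_bound => i j; rewrite mxE; apply: le_trans (coord_le_enorm _ _) _.
  by apply: edge_le_diameter; rewrite ?iT ?inT ?mem_head.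
set G := \matrix_(i, c) _ in e.
have : `|\det G| <= d`!%:R * (sigma / diameter T) ^+ d.
  apply: det_bound => i j; rewrite mxE; apply: le_trans (coord_le_enorm _ _) _.
  exact/enorm_bgrad/iT.
have := congr1 Num.norm e; rewrite normrM normr1 => e1.
have G0 : 0 < `|\det G|.
  by rewrite normr_gt0; apply: contra_eq_neq e => ->; rewrite mul0r eq_sym oner_eq0.
rewrite (_ : `|\det (edges v0 s)| = `|\det G|^-1); last first.
  by apply: (mulfI (lt0r_neq0 G0)); rewrite e1 mulfV // lt0r_neq0.
move=> h; rewrite -[diameter T / sigma]invf_div exprVn -invfM lef_pV2 // ?posrE //.
by rewrite mulr_gt0 ?ltr0n ?fact_gt0 // exprn_gt0 // divr_gt0 ?diameter_gt0 ?regularity_gt0.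
Qed.

End CellGeometry.

(** * Neighbouring elements *)

Section Adjacency.
Variables (R : realType) (d : nat) (M : mesh R d) (Om : set 'rV[R]_d).
Local Notation V := 'I_(nvert M).
Hypothesis hd : d = 2%N \/ d = 3%N.
Hypothesis tri : triangulation Om M.
Implicit Types (T F : {set V}).

(* Otherwise a small step from the barycenter of F towards o would stay in both
   cells without staying in F. *)
Lemma opposite_side T T' F o o' : F \in facets M -> T \in cells_at F ->
  T' \in cells_at F -> T != T' -> o \notin F -> T = o |: F ->
  o' \notin F -> T' = o' |: F ->
  peval (barycentric T' o') (vert o) <= 0.
Proof.
move=> FM TF T'F TT' oF TE oF' TE'; rewrite leNgt; apply/negP => pos.
have [cT iT orderF FT _] := cell_facetP tri FM TF.
have [cT' iT' _ FT' _] := cell_facetP tri FM T'F.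
have cF := card_facets FM; have d0 : (0 < d)%N by case: hd => ->.
have oT := opposite_in TE; have oT' := opposite_in TE'.
have capF : T :&: T' = F.
  apply/eqP; rewrite eq_sym eqEcard finset.subsetI FT FT' cF -ltnS -cT /=.
  apply: proper_card; rewrite properE finset.subsetIl /=; apply: contra TT' => /finset.subsetIP[_ s].
  by rewrite eqEcard s cT cT' leqnn.
pose S : R := \sum_(v in F) `|peval (barycentric T' v) (vert o)|.
have S0 : 0 <= S by apply: sumr_ge0.
have dr : 0 < d%:R :> R by rewrite ltr0n.
(* This [e] solves [1 - e = e d S]: the weight [(1 - e) / d] of each facet vertex equals [e S],
   which compensates negative coordinates of [o] with respect to [T']. *)
pose e : R := (1 + d%:R * S)^-1.
have D0 : 0 < 1 + d%:R * S by rewrite ltr_pwDl // mulr_ge0 // ltW.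
have e0 : 0 < e by rewrite invr_gt0.
have eS : e * (1 + d%:R * S) = 1 by rewrite mulVf // lt0r_neq0.
pose c v : R := if v == o then e else (1 - e) / d%:R.
have cF' v : v \in F -> c v = (1 - e) / d%:R.
  by move=> vF; rewrite /c ifF //; apply: contraNF oF => /eqP <-.
have co : c o = e by rewrite /c eqxx.
have c1 : \sum_(v in T) c v = 1.
  rewrite TE big_setU1 //= co (eq_bigr _ cF') sumr_const cF -[_ *+ d]mulr_natr divfK ?lt0r_neq0 //.
  by rewrite addrC subrK.
pose x := \sum_(v in T) c v *: vert v.
have e1 : e <= 1 by rewrite -eS ler_peMr ?(ltW e0) // lerDl mulr_ge0 // ltW.
have Tx : simplex T x.
  exists c; split=> // v _; rewrite /c; case: ifP => _; first exact: ltW.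
  by apply: divr_ge0; [rewrite subr_ge0|exact: ltW].
have lx v : v \in T' -> peval (barycentric T' v) x =
    e * peval (barycentric T' v) (vert o) + (v != o')%:R * ((1 - e) / d%:R).
  move=> vT'; rewrite peval_affine //; last exact: (deg_lt_barycentric iT' vT').
  rewrite TE big_setU1 //= co; congr (_ + _).
  have [->|vo] := eqVneq v o'.
    rewrite mul0r big1 // => w wF; rewrite (barycentric_vert iT') //; last first.
      exact: fintype.subsetP FT' _ wF.
    by rewrite (_ : (w == o') = false) ?mulr0 //; apply: contraNF oF' => /eqP <-.
  have vF : v \in F by move: vT'; rewrite TE' finset.in_setU1 (negPf vo).
  rewrite (bigD1 v) //= big1 => [|w /andP[wF wv]].
    by rewrite (barycentric_vert iT') // eqxx cF' // mulr1 addr0 mul1r.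
  rewrite (barycentric_vert iT') ?(negPf wv) ?mulr0 //.
  exact: fintype.subsetP FT' _ wF.
have T'x : simplex T' x.
  apply: (simplex_barycentric cT' iT') => v vT'; rewrite lx //.
  have [->|vo] := eqVneq v o'; first by rewrite mul0r addr0 mulr_ge0 ?(ltW e0) ?(ltW pos).
  have vF : v \in F by move: vT'; rewrite TE' finset.in_setU1 (negPf vo).
  rewrite mul1r -(pmulr_lge0 _ dr) mulrDl divfK ?lt0r_neq0 //.
  have : `|peval (barycentric T' v) (vert o)| <= S.
    by rewrite /S (bigD1 v) //= lerDl sumr_ge0.
  rewrite ler_norml => /andP[h _]; have := ler_wpM2l (mulr_ge0 (ltW dr) (ltW e0)) h.
  move: eS; move: (peval _ _) => t; lra.
(* Conformity puts the point in [F], where the coordinate of [o] is 0, although it equals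
   [e > 0]. *)
have : simplex F x by case: tri => _ cap _ _; rewrite -capF -cap ?(cells_at_cells TF) ?(cells_at_cells T'F).
move/(barycentric_opposite iT oF TE); rewrite (barycentric_comb iT (fintype.subxx T)) //.
by rewrite oT co => e00; rewrite e00 ltxx in e0.
Qed.

(** From a vertex of [F] to [o], the coordinate of [o] rises by 1 and that of [o'] does not rise;
    both changes are the normal derivative times the same normal component. *)
Lemma normal_deriv_opposite T T' F o o' : F \in facets M -> T \in cells_at F ->
  T' \in cells_at F -> T != T' -> o \notin F -> T = o |: F ->
  o' \notin F -> T' = o' |: F ->
  normal_deriv T F o * normal_deriv T' F o' < 0.
Proof.
move=> FM TF T'F TT' oF TE oF' TE'.
have [cT iT orderF FT _] := cell_facetP tri FM TF.
have [cT' iT' _ FT' _] := cell_facetP tri FM T'F.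
have n0 := normal_deriv_neq0 hd cT iT oF TE.
have n0' := normal_deriv_neq0 hd cT' iT' oF' TE'.
have /finset.set0Pn[f fF] := facet_neq0 hd cT oF TE.
have nof u : u \notin F -> (f == u) = false by move=> uF; apply: contraNF uF => /eqP <-.
have side := opposite_side FM TF T'F TT' oF TE oF' TE'.
have := peval_barycentricB iT' (vert o) (vert f) (opposite_in TE').
rewrite (barycentric_vert (w := f) iT') ?(opposite_in TE') ?(fintype.subsetP FT') // nof // subr0.
rewrite (bgrad_opposite hd cT' iT' oF' TE') dotZl => e'.
have := dot_bgrad iT (opposite_in TE) (opposite_in TE) (fintype.subsetP FT _ fF).
rewrite eqxx nof // subr0 (bgrad_opposite hd cT iT oF TE) dotZl => e.
rewrite lt_neqAle mulf_neq0 //=; move: side; rewrite e'.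
move=> side; have := ler_wpM2l (sqr_ge0 (normal_deriv T F o)) side.
rewrite mulr0; congr (_ <= _); rewrite -[RHS]mulr1 -[1]/(true%:R) -e; ring.
Qed.

(** Of three nonzero signs two agree, while any two elements at [F] have normal derivatives of
    opposite sign. The bound limits both the average and the overlap in (4). *)
Lemma card_cells_at F : F \in facets M -> (#|cells_at F| <= 2)%N.
Proof.
move=> FM; rewrite leqNgt; apply/negP => /card_gt2P[T1 [T2 [T3 [[T1F T2F T3F] [n12 n23 n31]]]]].
have [_ _ _ _ [w1 w1F T1E]] := cell_facetP tri FM T1F.
have [_ _ _ _ [w2 w2F T2E]] := cell_facetP tri FM T2F.
have [_ _ _ _ [w3 w3F T3E]] := cell_facetP tri FM T3F.
have h12 := normal_deriv_opposite FM T1F T2F n12 w1F T1E w2F T2E.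
have h23 := normal_deriv_opposite FM T2F T3F n23 w2F T2E w3F T3E.
have h31 := normal_deriv_opposite FM T3F T1F n31 w3F T3E w1F T1E.
move: h12 h23 h31; move: (normal_deriv _ _ _) (normal_deriv _ _ _) (normal_deriv _ _ _).
move=> a b c ab bc ca.
have : 0 < (c * b) * (b * a) by rewrite (nmulr_lgt0 _ bc).
rewrite (_ : _ * _ = b ^+ 2 * (a * c)); last by ring.
by move=> h; have := mulr_ge0_le0 (sqr_ge0 b) (ltW ca); rewrite leNgt h.
Qed.

(** The two elements share an edge of [F]: regularity of [T] bounds its diameter by this edge, and
    the edge lies in [T']. *)
Lemma adjacent_diameter sigma T T' F : shape_regular sigma M -> F \in facets M ->
  T \in cells_at F -> T' \in cells_at F -> diameter T <= sigma * diameter T'.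
Proof.
move=> reg FM TF T'F.
have [cT iT orderF FT _] := cell_facetP tri FM TF.
have [cT' iT' _ FT' _] := cell_facetP tri FM T'F.
have d0 : (0 < d)%N by case: hd => ->.
have regT := reg _ (cells_at_cells TF).
have : (1 < #|F|)%N by rewrite (card_facets FM); case: hd => ->.
case/card_gt1P => v [w [vF wF vw]].
have vT := fintype.subsetP FT _ vF; have wT := fintype.subsetP FT _ wF.
apply: le_trans (regularity_edge d0 cT iT regT vT wT vw) _.
rewrite ler_wpM2l //; first exact: ltW (regularity_gt0 d0 cT iT regT).
by apply: edge_le_diameter => //; [exact: (fintype.subsetP FT' _ vF)|exact: (fintype.subsetP FT' _ wF)].
Qed.

End Adjacency.

(** * Bounds of the facet functions *)

Section FacetBasisBounds.
Variables (R : realType) (d k : nat).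
Hypothesis hd : d = 2%N \/ d = 3%N.
Local Notation I := ('I_k.+1 * 'I_k.+1)%type.

Lemma sum_sqr_le (J : finType) (P : pred J) (a : J -> R) :
  (\sum_(i | P i) a i) ^+ 2 <= #|P|%:R * \sum_(i | P i) a i ^+ 2.
Proof.
pose x : 'rV[R]_#|P| := \row_i a (enum_val i).
have := cauchy_schwarz x (const_mx 1).
have -> : dot x (const_mx 1) = \sum_(i | P i) a i.
  by rewrite [RHS](big_enum_val a); apply: eq_bigr => i _; rewrite !mxE mulr1.
have -> : dot x x = \sum_(i | P i) a i ^+ 2.
  by rewrite [RHS](big_enum_val (fun i => a i ^+ 2)); apply: eq_bigr => i _; rewrite !mxE expr2.
have -> : dot (const_mx 1 : 'rV[R]_#|P|) (const_mx 1) = #|P|%:R.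
  rewrite /dot (eq_bigr (fun=> 1)) => [|i _]; last by rewrite !mxE mulr1.
  by rewrite sumr_const card_ord.
by rewrite mulrC.
Qed.

Lemma facet_dual_bound (g : 'I_d -> 'rV[R]_d) t l c : 0 <= t ->
  (forall m c, `|g m 0 c| <= t) -> `|facet_dual g l 0 c| <= 2 * t ^+ d.-1.
Proof.
move=> t0 h; case: hd => e; subst d; rewrite /facet_dual.
  have t2 : t <= 2 * t ^+ 1 by rewrite expr1 ler_peMl // ler1n.
  move: l c; apply: ord2P => c; rewrite ?facet_dual2_0 ?facet_dual2_1;
    by case: (c == 0); rewrite ?normrN (le_trans (h _ _)).
rewrite /facet_dual3 cross3E (le_trans (ler_normB _ _)) // !normrM mulr_natl mulr2n expr2.
by rewrite lerD // ler_pM.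
Qed.

Lemma facet_form_bounds : exists2 C : R, 0 <= C &
  forall (p : I) (l : 'I_d) (lam : 'I_d -> mpoly d R) x h,
    (forall l, `|peval (lam l) x| <= 1) -> 0 <= h ->
    (forall l c, `|peval (mderiv c (lam l)) x| <= h) ->
    `|peval (facet_form lam p.1 p.2 l) x| <= C /\
    forall c, `|peval (mderiv c (facet_form lam p.1 p.2 l)) x| <= C * h.
Proof.
have ex (q : I * 'I_d) : exists C : R, 0 <= C /\ forall (lam : 'I_d -> mpoly d R) x h,
    (forall l, `|peval (lam l) x| <= 1) -> 0 <= h ->
    (forall l c, `|peval (mderiv c (lam l)) x| <= h) ->
    `|peval (facet_form lam q.1.1 q.1.2 q.2) x| <= C /\
    forall c, `|peval (mderiv c (facet_form lam q.1.1 q.1.2 q.2)) x| <= C * h.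
  by have [C C0 hC] := uniformly_bounded_facet_form R hd q.1.1 q.1.2 q.2; exists C.
have [C hC] := choice ex; have C0 q : 0 <= C q by have [] := hC q.
exists (\sum_q C q); first by apply: sumr_ge0.
move=> p l lam x h l1 h0 dl; have [_ /(_ _ _ _ l1 h0 dl) [/= h1 h2]] := hC (p, l).
have le : C (p, l) <= \sum_q C q by rewrite (bigD1 (p, l)) //= lerDl sumr_ge0.
split=> [|c]; first exact: le_trans le.
by apply: le_trans (h2 c) _; rewrite ler_wpM2r.
Qed.

(** The forms are bounded and the dual vectors are constants of order [(sigma / h) ^ (d - 1)]; a
    derivative falls on the forms and adds one factor. [B] is chosen before the mesh, the element
    and [sigma]. *)
Lemma facet_basis_bounds : exists2 B : R, 0 <= B &
  forall (M : mesh R d) (T F : {set 'I_(nvert M)}) o sigma, #|T| = d.+1 -> affinely_independent T ->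
    T = o |: F -> [set v in forder F]%SET = F ->
    diameter T <= sigma * inradius T -> forall (p : I) x c, simplex T x ->
    `|peval (facet_basis T F p.1 p.2 0 c) x| <= B * (sigma / diameter T) ^+ d.-1 /\
    forall j, `|peval (mderiv j (facet_basis T F p.1 p.2 0 c)) x| <=
      B * (sigma / diameter T) ^+ d.
Proof.
have [C C0 hC] := facet_form_bounds.
exists (d%:R * (C * 2)); first by rewrite !mulr_ge0.
move=> M T F o sigma cT iT TE orderF reg p x c Tx; set t := sigma / _.
have d0 : (0 < d)%N by case: hd => ->.
have t0 : 0 <= t.
  by rewrite divr_ge0 ?(ltW (regularity_gt0 d0 cT iT reg)) ?(ltW (diameter_gt0 d0 cT iT)).
have gt v e : v \in T -> `|bgrad T v 0 e| <= t.
  by move=> vT; apply: le_trans (coord_le_enorm _ _) (enorm_bgrad d0 cT iT reg vT).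
have fT l : tnth (forder F) l \in T := forder_inT TE orderF l.
have l1 l : `|peval (barycentric T (tnth (forder F) l)) x| <= 1.
  by have /andP[h0 h1] := barycentric_simplex iT (fT l) Tx; rewrite ger0_norm.
have dl l e : `|peval (mderiv e (barycentric T (tnth (forder F) l))) x| <= t.
  by rewrite (mderiv_barycentric iT) // pevalC gt.
have dual l e : `|facet_dual (fun m => bgrad T (tnth (forder F) m)) l 0 e| <= 2 * t ^+ d.-1.
  by apply: facet_dual_bound => // m e'; apply: gt.
have sum_bound (G : 'I_d -> R) s : (forall l, `|G l| <= s) -> `|\sum_l G l| <= d%:R * s.
  move=> h; apply: le_trans (ler_norm_sum _ _ _) _.
  rewrite mulr_natl -[in leRHS](card_ord d) -sumr_const; exact: ler_sum.
have form l := hC p l _ _ _ l1 t0 dl.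
rewrite (facet_basisE hd iT TE orderF); split=> [|j].
  rewrite peval_sum -!mulrA; apply: sum_bound => l; rewrite pevalM pevalC normrM.
  by apply: ler_pM => //; have [] := form l.
rewrite raddf_sum peval_sum -[d in t ^+ d](prednK d0) -!mulrA; apply: sum_bound => l.
rewrite /= mderivM mderivC mulr0 addr0 pevalM pevalC normrM exprS.
rewrite (_ : C * _ = (C * t) * (2 * t ^+ d.-1)); last by ring.
by apply: ler_pM => //; have [] := form l.
Qed.

End FacetBasisBounds.

(** * Bound of a facet coefficient by the gradient *)

Section CoefBound.
Variables (R : realType) (d k : nat) (M : mesh R d).
Local Notation V := 'I_(nvert M).
Local Notation I := ('I_k.+1 * 'I_k.+1)%type.
Hypothesis hd : d = 2%N \/ d = 3%N.
Variables (T F : {set V}) (o : V).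
Hypothesis cardT : #|T| = d.+1.
Hypothesis indT : affinely_independent T.
Hypothesis oF : o \notin F.
Hypothesis TE : T = o |: F.
Hypothesis orderF : [set v in forder F]%SET = F.

Local Notation lamF := (fun l => barycentric T (tnth (forder F) l)).
Local Notation phi p := (facet_basis T F p.1 p.2).
Local Notation D p := (facet_trace lamF p.1 p.2).
Local Notation LT q := (sint T (peval q)).
Local Notation LF q := (sint F (peval q)).

Let d0 : (0 < d)%N. Proof. by case: hd => ->. Qed.
Let T0 := cell_neq0 cardT.
Let TT := fintype.subxx T.

Definition gradsq (u : 'rV[mpoly d R]_d) : mpoly d R :=
  \sum_i \sum_j mderiv j (u 0 i) ^+ 2.

Lemma gradsqE u x : peval (gradsq u) x = \sum_i \sum_j (peval (mderiv j (u 0 i)) x) ^+ 2.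
Proof.
rewrite peval_sum; apply: eq_bigr => i _; rewrite peval_sum; apply: eq_bigr => j _.
exact: pevalX.
Qed.

Variable f : mpoly d R.
Variable p : I.
Hypothesis p_valid : facet_index d p.
Hypothesis p_gt0 : (0 < p.1 + p.2)%N.

(** With zero divergence and zero flux through the other facets, only [F] contributes. The product
    of the two constants is [- gdet], which is nonzero, so the coefficient can be recovered. *)
Lemma facet_divergence :
  LT (\sum_j mderiv j f * phi p 0 j) =
  - (normal_deriv T F o * facet_flux T F o) * LF (f * D p).
Proof.
have [_ val] := andP p_valid.
have -> : \sum_j mderiv j f * phi p 0 j = \sum_j mderiv j (f * phi p 0 j).
  under [RHS]eq_bigr => j _ do rewrite mderivM.
  by rewrite big_split /= -[X in _ = _ + X]mulr_sumr div_facet_fun // mulr0 addr0.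
rewrite (sint_sum T0 cardT indT TT).
rewrite (eq_bigr _ (fun j _ => sint_mderiv cardT indT d0 j (f * phi p 0 j))) sumrN.
rewrite mulNr; congr (- _); rewrite exchange_big /=.
have sintT v : v \in T -> \sum_j bgrad T v 0 j * sint (T :\ v) (peval (f * phi p 0 j)) =
    sint (T :\ v) (fun x => peval f x * dot (veval (phi p) x) (bgrad T v)).
  move=> vT; have sub : T :\ v \subset T by apply: subsetDl.
  have ne : T :\ v != finset.set0.
    by rewrite -card_gt0; have := cardsD1 v T; rewrite vT cardT add1n => -[<-].
  rewrite [RHS](sint_eq (g := peval (\sum_j bgrad T v 0 j *: (f * phi p 0 j))) ne).
    by rewrite (sint_sum ne cardT indT sub); apply: eq_bigr => j _; rewrite (sintZ ne cardT indT sub).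
  move=> x _; rewrite peval_sum mulr_sumr; apply: eq_bigr => j _.
  by rewrite pevalZ pevalM !mxE; ring.
rewrite (eq_bigr _ sintT) (bigD1 o) ?(opposite_in TE) //= big1 ?addr0; last first.
  move=> v /andP[vT vo]; have vF : v \in F by move: vT; rewrite TE finset.in_setU1 (negPf vo).
  have [m e] := forderP orderF vF.
  have ne : T :\ v != finset.set0.
    by rewrite -card_gt0; have := cardsD1 v T; rewrite vT cardT add1n => -[<-].
  have sub : T :\ v \subset T by apply: subsetDl.
  rewrite (sint_eq (g := peval 0) ne) ?(sint0 ne cardT indT sub) // => x [c [_ c1 ->]].
  set y := \sum_(_ in _) _; have ly : peval (barycentric T v) y = 0.
    by rewrite (barycentric_comb indT sub) // in_setD1 eqxx.
  rewrite peval0 {1}e (dot_facet_basis_bgrad hd indT TE orderF) facet_form_root ?mulr0 //.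
  by rewrite -e.
rewrite (setD1_opposite oF TE).
have F0 := facet_neq0 hd cardT oF TE; have FT := facet_subset TE.
rewrite -(sintZ F0 cardT indT FT); apply: (sint_eq F0) => x Fx.
rewrite (bgrad_opposite hd cardT indT oF TE) dotZr -[dot _ _]/(normal_trace F (phi p) x).
rewrite (normal_trace_facet_basis hd cardT indT oF TE orderF) // pevalZ pevalM; ring.
Qed.

Lemma sint_cell_le q C : 0 <= C -> (forall x, simplex T x -> peval q x <= C) -> LT q <= C.
Proof.
move=> C0 h; have := @sint_le _ _ _ _ T0 _ cardT indT TT q (mpolyC d C).
rewrite (sint_const T0 cardT indT TT) => le; apply: le_trans (le _) _.
  by move=> x Tx; rewrite pevalC h.
by rewrite ler_piMr // invf_le1 ?ler1n ?ltr0n fact_gt0.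
Qed.

(** [f] is the component of [u] along a constant unit vector, so Cauchy-Schwarz bounds its
    derivatives by those of [u]. *)
Lemma sum_dtrace_le (u : 'rV[mpoly d R]_d) : f = ntrace F u ->
  \sum_j LT (mderiv j f ^+ 2) <= LT (gradsq u).
Proof.
move=> fE; rewrite -(sint_sum T0 cardT indT TT); apply: (sint_le T0 cardT indT TT) => x _.
rewrite peval_sum gradsqE exchange_big /=; apply: ler_sum => j _.
have [nn _] := facet_normalP hd cardT indT oF TE.
have := cauchy_schwarz (facet_normal F) (\row_i peval (mderiv j (u 0 i)) x).
rewrite nn mul1r; set y := \row_i _.
have -> : dot y y = \sum_i peval (mderiv j (u 0 i)) x ^+ 2.
  by apply: eq_bigr => i _; rewrite !mxE expr2.
rewrite pevalX; congr (_ ^+ 2 <= _); rewrite fE /ntrace raddf_sum peval_sum; apply: eq_bigr => i _.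
by rewrite /= mderivZ pevalZ mxE.
Qed.

Variables (sigma B : R).
Hypothesis regular : diameter T <= sigma * inradius T.
Local Notation h := (diameter T).
Hypothesis B_ge0 : 0 <= B.
Hypothesis phi_bound : forall x c, simplex T x ->
  `|peval (phi p 0 c) x| <= B * (sigma / h) ^+ d.-1.

Let h0 : 0 < h := diameter_gt0 d0 cardT indT.
Let s0 : 0 < sigma := regularity_gt0 d0 cardT indT regular.
Let t := sigma / h.
Let t0 : 0 <= t. Proof. by rewrite divr_ge0 ?ltW. Qed.

Lemma divergence_bound (u : 'rV[mpoly d R]_d) : f = ntrace F u ->
  LT (\sum_j mderiv j f * phi p 0 j) ^+ 2 <= d%:R * ((B * t ^+ d.-1) ^+ 2 * LT (gradsq u)).
Proof.
move=> fE; rewrite (sint_sum T0 cardT indT TT).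
apply: le_trans (sum_sqr_le _ _) _; rewrite card_ord ler_wpM2l ?ler0n //.
apply: le_trans (ler_wpM2l (sqr_ge0 _) (sum_dtrace_le fE)).
rewrite mulr_sumr; apply: ler_sum => j _.
apply: le_trans (sint_sqr_le T0 cardT indT TT _ _) _.
rewrite mulrC ler_wpM2r //.
  by apply: (sint_ge0 T0) => x _; rewrite pevalX sqr_ge0.
apply: sint_cell_le => [|x Tx]; first exact: sqr_ge0.
by rewrite pevalX -[leLHS]real_normK ?num_real // lerXn2r ?nnegrE ?mulr_ge0 ?exprn_ge0 ?phi_bound.
Qed.

Lemma inv_gdet_bound : `|(gdet T F)^-1| <= d`!%:R * h ^+ d.
Proof.
have -> : (gdet T F)^-1 = \det (edge_mx F o).
  have e := gdet_edge cardT indT oF TE orderF; have g0 := gdet_neq0 cardT indT oF TE orderF.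
  by apply: (mulfI g0); rewrite e mulfV.
apply: det_bound => i j; rewrite mxE; apply: le_trans (coord_le_enorm _ _) _.
by apply: edge_le_diameter => //; [exact: (forder_inT TE orderF)|exact: (opposite_in TE)].
Qed.

Lemma normal_deriv_bound : `|normal_deriv T F o| <= t.
Proof.
have [nn _] := facet_normalP hd cardT indT oF TE.
apply: le_trans (dot_le_enorm _ _) _; rewrite [enorm (facet_normal F)]/enorm nn sqrtr1 mulr1.
exact: (enorm_bgrad d0 cardT indT regular (opposite_in TE)).
Qed.

(** Powers of [h]: [-2 (d - 1)] from the squared divergence integral, [-2] from the normal
    derivative and [4 d] from [gdet] to the power -4, in all [2 d]. As [sint] omits the volume, this
    is [h ^ d] times the gradient energy. *)
Lemma facet_coef_bound (u : discrete_field M) : vdeg_lt k.+1 (u T) -> f = ntrace F (u T) ->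
  facet_coef k u T F p ^+ 2 <=
  d%:R * B ^+ 2 * (d`!%:R) ^+ 4 * sigma ^+ (d + d) * (trace_norm R d p.1 p.2)^-1 ^+ 2 *
  h ^+ (d + d) * LT (gradsq (u T)).
Proof.
move=> du fE; set a := facet_coef _ _ _ _ _; set c := trace_norm R d p.1 p.2.
set G := LT (gradsq _).
have c0 : c != 0 by rewrite gt_eqF // trace_norm_gt0.
have g0 := gdet_neq0 cardT indT oF TE orderF.
have n0 := normal_deriv_neq0 hd cardT indT oF TE.
have := facet_divergence; set X := LT _; set nu := normal_deriv T F o in n0 *.
set dl := gdet T F in g0.
have -> : LF (f * D p) = a * facet_flux T F o * c.
  apply: (facet_trace_coef hd cardT indT oF TE orderF
    (a := fun p => facet_coef k u T F p * facet_flux T F o)) => // x Fx.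
  rewrite fE -ntraceE (facet_coefP hd cardT indT oF TE orderF du) //.
  by apply: eq_bigr => q _; rewrite mulrA.
rewrite /facet_flux -/dl -/nu => XE.
(* Of the two factors [gdet], one comes from the divergence identity and one from the flux constant
   that links [a] to the trace polynomial. *)
have aE : a = - X * nu * dl^-1 ^+ 2 * c^-1.
  rewrite XE; field; by rewrite g0 n0 c0.
have X2 : X ^+ 2 <= d%:R * ((B * t ^+ d.-1) ^+ 2 * G) := divergence_bound fE.
have nu2 : nu ^+ 2 <= t ^+ 2.
  by rewrite -[leLHS]real_normK ?num_real // lerXn2r ?nnegrE ?normal_deriv_bound.
have dl4 : dl^-1 ^+ 4 <= (d`!%:R * h ^+ d) ^+ 4.
  rewrite -[leLHS]ger0_norm ?exprn_even_ge0 // normrX lerXn2r ?nnegrE ?inv_gdet_bound //.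
  by rewrite mulr_ge0 ?exprn_ge0 ?ltW.
have -> : a ^+ 2 = X ^+ 2 * nu ^+ 2 * dl^-1 ^+ 4 * c^-1 ^+ 2 by rewrite aE; ring.
have G0 : 0 <= G.
  apply: (sint_ge0 T0) => x _; rewrite gradsqE.
  by apply: sumr_ge0 => i _; apply: sumr_ge0 => j _; apply: sqr_ge0.
have : X ^+ 2 * nu ^+ 2 * dl^-1 ^+ 4 * c^-1 ^+ 2 <=
    d%:R * ((B * t ^+ d.-1) ^+ 2 * G) * t ^+ 2 * (d`!%:R * h ^+ d) ^+ 4 * c^-1 ^+ 2.
  rewrite ler_wpM2r ?sqr_ge0 // ler_pM ?exprn_even_ge0 //.
    by rewrite mulr_ge0 ?sqr_ge0.
  by rewrite ler_pM ?sqr_ge0.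
move/le_trans; apply; rewrite le_eqVlt; apply/orP; left; apply/eqP.
have tE : t ^+ d.-1 * t = sigma ^+ d / h ^+ d by rewrite -exprSr prednK // expr_div_n.
have hn : h ^+ d != 0 by rewrite expf_neq0 // gt_eqF.
rewrite (_ : d%:R * ((B * t ^+ d.-1) ^+ 2 * G) * t ^+ 2 * (d`!%:R * h ^+ d) ^+ 4 * c^-1 ^+ 2 =
  d%:R * B ^+ 2 * d`!%:R ^+ 4 * (t ^+ d.-1 * t * h ^+ d) ^+ 2 * c^-1 ^+ 2 * (h ^+ d) ^+ 2 * G); last first.
  by move: (t ^+ d.-1) (h ^+ d) => *; ring.
rewrite tE divfK // !exprD -!expr2; move: (sigma ^+ d) (h ^+ d) => *; ring.
Qed.

End CoefBound.

(** * Stability of the averaging operator *)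

Section ProjectionStability.
Variables (R : realType) (d k : nat) (M : mesh R d).
Local Notation V := 'I_(nvert M).
Hypothesis hd : d = 2%N \/ d = 3%N.
Variables (T F : {set V}) (o : V).
Hypothesis cardT : #|T| = d.+1.
Hypothesis indT : affinely_independent T.
Hypothesis oF : o \notin F.
Hypothesis TE : T = o |: F.
Hypothesis orderF : [set v in forder F]%SET = F.
Hypothesis F_pos : 0 < sgram F.

Local Notation LF q := (sint F (peval q)).
Let F0 := facet_neq0 hd cardT oF TE.
Let FT := facet_subset TE.

(* The projections of two traces differ by a projection of their difference,
   although the representatives of the projections are arbitrary. *)
Lemma facet_proj_stable (f g : 'rV[R]_d -> R) a b :
  (forall x, simplex F x -> f x = peval a x) ->
  (forall x, simplex F x -> g x = peval b x) ->
  deg_lt k.+1 a -> deg_lt k.+1 b ->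
  LF (facet_proj F k f ^+ 2) <=
  2 * LF (facet_proj F k g ^+ 2) + 2 * LF ((a - b) ^+ 2).
Proof.
move=> fa gb da db.
have [dP1 oP1] := facet_projP hd cardT indT oF TE orderF fa da.
have [dP0 oP0] := facet_projP hd cardT indT oF TE orderF gb db.
set P1 := facet_proj F k f in dP1 oP1 *; set P0 := facet_proj F k g in dP0 oP0 *.
have orth (e : 'rV[R]_d -> R) c P r : (forall x, simplex F x -> e x = peval c x) ->
    simplex_integral F (fun x => (e x - peval P x) * peval r x) = 0 ->
    LF (c * r) = LF (P * r).
  move=> ec; rewrite simplex_integralE // => /eqP; rewrite mulf_eq0 gt_eqF //= => /eqP.
  rewrite (sint_eq (g := peval (c * r - P * r)) F0) => [|x Fx].
    by rewrite (sintB F0 cardT indT FT) => /eqP; rewrite subr_eq0 => /eqP.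
  by rewrite ec // pevalB !pevalM mulrBl.
pose q := P1 - P0; have dq : deg_lt k q := deg_ltB dP1 dP0.
have e : LF ((a - b) * q) = LF (q ^+ 2).
  rewrite expr2 {2}/q !mulrBl !(sintB F0 cardT indT FT).
  by rewrite (orth _ _ _ _ fa (oP1 _ dq)) (orth _ _ _ _ gb (oP0 _ dq)).
have q0 : 0 <= LF (q ^+ 2) by apply: (sint_ge0 F0) => x _; rewrite pevalX sqr_ge0.
have le : LF (q ^+ 2) <= LF ((a - b) ^+ 2).
  have := sint_sqr_le F0 cardT indT FT (a - b) q; rewrite e expr2.
  have [->|qn] := eqVneq (LF (q ^+ 2)) 0.
    by move=> _; apply: (sint_ge0 F0) => x _; rewrite pevalX sqr_ge0.
  by rewrite ler_pM2r // lt_neqAle eq_sym qn.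
apply: (@le_trans _ _ (2 * LF (P0 ^+ 2) + 2 * LF (q ^+ 2))); last first.
  by rewrite lerD2l ler_wpM2l.
rewrite -!(sintZ F0 cardT indT FT) -(sintD F0 cardT indT FT).
apply: (sint_le F0 cardT indT FT) => x _; rewrite pevalD !pevalZ !pevalX /q pevalB.
rewrite -subr_ge0; move: (peval P1 x) (peval P0 x) => s t.
by rewrite (_ : _ - _ = (s - 2 * t) ^+ 2) ?sqr_ge0 //; ring.
Qed.

Lemma sint_facet_le q C : 0 <= C -> (forall x, simplex F x -> peval q x <= C) -> LF q <= C.
Proof.
move=> C0 h; have := @sint_le _ _ _ _ F0 _ cardT indT FT q (mpolyC d C).
rewrite (sint_const F0 cardT indT FT) => le; apply: le_trans (le _) _.
  by move=> x Fx; rewrite pevalC h.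
by rewrite ler_piMr // invf_le1 ?ler1n ?ltr0n fact_gt0.
Qed.

Lemma sint_sum_le (a b c : 'I_d -> mpoly d R) :
  (forall i, LF (a i) <= 2 * LF (b i) + 2 * LF (c i)) ->
  LF (\sum_i a i) <= 2 * LF (\sum_i b i) + 2 * LF (\sum_i c i).
Proof.
move=> abc; rewrite (sint_sum F0 cardT indT FT _ _ a) (sint_sum F0 cardT indT FT _ _ b).
rewrite (sint_sum F0 cardT indT FT _ _ c) !mulr_sumr -big_split.
by apply: ler_sum => i _; apply: abc.
Qed.

Lemma dot_tangential_le (x : 'rV[R]_d) :
  dot (tangential (facet_normal F) x) (tangential (facet_normal F) x) <= dot x x.
Proof.
have [nn _] := facet_normalP hd cardT indT oF TE.
rewrite /tangential dotBl !dotBr !dotZr !dotZl nn [dot (facet_normal F) x]dotC.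
rewrite -subr_ge0 (_ : _ - _ = dot x (facet_normal F) ^+ 2) ?sqr_ge0 //; ring.
Qed.

End ProjectionStability.

Section Stability.
Variables (R : realType) (d k : nat).
Hypothesis hd : d = 2%N \/ d = 3%N.
Hypothesis k_gt0 : (0 < k)%N.
Local Notation I := ('I_k.+1 * 'I_k.+1)%type.
Variables (sigma B : R).
Hypothesis B_ge0 : 0 <= B.
Hypothesis basis_bound : forall (M : mesh R d) (T F : {set 'I_(nvert M)}) o sigma,
  #|T| = d.+1 -> affinely_independent T -> T = o |: F -> [set v in forder F]%SET = F ->
  diameter T <= sigma * inradius T -> forall (p : I) x c, simplex T x ->
  `|peval (facet_basis T F p.1 p.2 0 c) x| <= B * (sigma / diameter T) ^+ d.-1 /\
  forall j, `|peval (mderiv j (facet_basis T F p.1 p.2 0 c)) x| <=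
    B * (sigma / diameter T) ^+ d.
Variables (M : mesh R d) (Om : set 'rV[R]_d).
Hypothesis tri : triangulation Om M.
Hypothesis reg : shape_regular sigma M.
Local Notation V := 'I_(nvert M).
Implicit Types (T F : {set V}).
Variable u : discrete_field M * discrete_field M.
Hypothesis u_U : U_space k u.
Local Notation v := u.1.
Local Notation h T := (diameter T).
Local Notation LT T q := (sint T (peval q)).

Let v_poly : broken_poly k v. Proof. by case: u_U => -[]. Qed.
Let d0 : (0 < d)%N. Proof. by case: hd => ->. Qed.

Let cellP T : T \in cells M -> #|T| = d.+1 /\ affinely_independent T.
Proof. by move=> TM; case: tri => H _ _ _; apply: H. Qed.
Let h_gt0 T : T \in cells M -> 0 < h T.
Proof. by move=> /cellP[cT iT]; apply: diameter_gt0. Qed.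
Let sigma_gt0 T : T \in cells M -> 0 < sigma.
Proof. by move=> TM; have [cT iT] := cellP TM; apply: regularity_gt0 (reg TM). Qed.

Definition grad_energy T (w : discrete_field M) : R := simplex_integral T (fun x =>
  \sum_i \sum_j (peval (mderiv j (w T 0 i)) x) ^+ 2).

Let grad_energyE T w : T \in cells M -> grad_energy T w = sgram T * LT T (gradsq (w T)).
Proof.
move=> TM; have [cT iT] := cellP TM; rewrite /grad_energy simplex_integralE ?cell_neq0 //.
by congr (_ * _); apply: (sint_eq (cell_neq0 cT)) => x _; rewrite gradsqE.
Qed.

Let gradsq_ge0 T w : T \in cells M -> 0 <= LT T (gradsq w).
Proof.
move=> TM; have [cT iT] := cellP TM; apply: (sint_ge0 (cell_neq0 cT)) => x _.
by rewrite gradsqE; do 2! (apply: sumr_ge0 => ? _); apply: sqr_ge0.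
Qed.

Let grad_energy_ge0 T w : T \in cells M -> 0 <= grad_energy T w.
Proof. by move=> TM; rewrite grad_energyE // mulr_ge0 ?sgram_ge0 ?gradsq_ge0. Qed.

Definition coef_change T F (p : I) : R := avg_coef v F p - facet_coef k v T F p.

Definition change_energy T : R := \sum_(F in facets M | F \subset T)
  \sum_(p : I | top_index d p) coef_change T F p ^+ 2.

Let change_energy_ge0 T : 0 <= change_energy T.
Proof. by do 2! (apply: sumr_ge0 => ? _); apply: sqr_ge0. Qed.

(** The number of subsets of the [d + 1] vertices, a crude bound for the number of facets of an
    element. *)
Let nF : R := (2 ^ d.+1)%:R.
Let nI : R := #|{: I}|%:R.
Let nF0 : 0 <= nF := ler0n _ _.
Let nI0 : 0 <= nI := ler0n _ _.

Let card_facets_of T : T \in cells M ->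
  #|[pred F in facets M | F \subset T]|%:R <= nF.
Proof.
move=> /cellP[cT _]; rewrite ler_nat -cT -card_powerset; apply: subset_leq_card.
by apply/fintype.subsetP => F; rewrite !inE => /andP[].
Qed.

Let change_bound T (y : {set V} -> I -> R) C : T \in cells M -> 0 <= C ->
  (forall F p, F \in facets M -> F \subset T -> `|y F p| <= C) ->
  (\sum_(F in facets M | F \subset T) \sum_(p : I | top_index d p)
     coef_change T F p * y F p) ^+ 2 <= nF * nI * C ^+ 2 * change_energy T.
Proof.
move=> TM C0 yC; apply: le_trans (sum_sqr_le _ _) _.
apply: (@le_trans _ _ (nF * \sum_(F in facets M | F \subset T)
    (\sum_(p : I | top_index d p) coef_change T F p * y F p) ^+ 2)).
  by rewrite ler_wpM2r ?card_facets_of // sumr_ge0 // => ? _; apply: sqr_ge0.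
rewrite -!mulrA ler_wpM2l // /change_energy !mulr_sumr; apply: ler_sum => F /andP[FM FT].
apply: le_trans (sum_sqr_le _ _) _.
apply: (@le_trans _ _ (nI * \sum_(p : I | top_index d p) (coef_change T F p * y F p) ^+ 2)).
  rewrite ler_wpM2r //; first by apply: sumr_ge0 => ? _; apply: sqr_ge0.
  by rewrite ler_nat max_card.
rewrite ler_wpM2l // mulrA -expr2 mulr_sumr; apply: ler_sum => p _.
rewrite exprMn mulrC ler_wpM2r ?sqr_ge0 // -[leLHS]real_normK ?num_real //.
by rewrite lerXn2r ?nnegrE // yC.
Qed.

Let cell_of_facet T F : T \in cells M -> F \in facets M -> F \subset T -> T \in cells_at F.
Proof. by move=> TM _ FT; rewrite inE TM. Qed.

Definition correction T : 'rV[mpoly d R]_d :=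
  \sum_(F in facets M | F \subset T) \sum_(p : I | top_index d p)
    mpolyC d (coef_change T F p) *: facet_basis T F p.1 p.2.

Let correctionE T i : correction T 0 i = \sum_(F in facets M | F \subset T)
  \sum_(p : I | top_index d p) coef_change T F p *: facet_basis T F p.1 p.2 0 i.
Proof.
rewrite /correction summxE; apply: eq_bigr => F _; rewrite summxE; apply: eq_bigr => p _.
by rewrite rowZ mul_mpolyC.
Qed.

Let RW_correction T : RW k v T = v T + correction T. Proof. by []. Qed.

Let tau T := sigma / h T.
Let tau_ge0 T : T \in cells M -> 0 <= tau T.
Proof. by move=> TM; rewrite divr_ge0 // ltW ?h_gt0 // (sigma_gt0 TM). Qed.

Let phiB T F (p : I) x c : T \in cells M -> F \in facets M -> F \subset T -> simplex T x ->
  `|peval (facet_basis T F p.1 p.2 0 c) x| <= B * tau T ^+ d.-1 /\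
  forall j, `|peval (mderiv j (facet_basis T F p.1 p.2 0 c)) x| <= B * tau T ^+ d.
Proof.
move=> TM FM FT Tx; have [cT iT orderF _ [w wF TE]] := cell_facetP tri FM (cell_of_facet TM FM FT).
exact: (basis_bound cT iT TE orderF (reg TM)).
Qed.

Let correction_bound T i x : T \in cells M -> simplex T x ->
  peval (correction T 0 i) x ^+ 2 <= nF * nI * (B * tau T ^+ d.-1) ^+ 2 * change_energy T.
Proof.
move=> TM Tx; rewrite correctionE.
rewrite (_ : peval _ x = \sum_(F in facets M | F \subset T) \sum_(p : I | top_index d p)
    coef_change T F p * peval (facet_basis T F p.1 p.2 0 i) x); last first.
  rewrite peval_sum; apply: eq_bigr => F _; rewrite peval_sum; apply: eq_bigr => p _.
  exact: pevalZ.
apply: (change_bound (y := fun F p => peval (facet_basis T F p.1 p.2 0 i) x)) => //.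
  by rewrite mulr_ge0 ?exprn_ge0 ?tau_ge0.
by move=> F p FM FT; have [] := phiB p i TM FM FT Tx.
Qed.

Let dcorrection_bound T i j x : T \in cells M -> simplex T x ->
  peval (mderiv j (correction T 0 i)) x ^+ 2 <=
  nF * nI * (B * tau T ^+ d) ^+ 2 * change_energy T.
Proof.
move=> TM Tx; rewrite correctionE.
rewrite (_ : peval _ x = \sum_(F in facets M | F \subset T) \sum_(p : I | top_index d p)
    coef_change T F p * peval (mderiv j (facet_basis T F p.1 p.2 0 i)) x); last first.
  rewrite raddf_sum peval_sum; apply: eq_bigr => F _.
  rewrite /= raddf_sum peval_sum; apply: eq_bigr => p _.
  by rewrite /= mderivZ pevalZ.
apply: (change_bound (y := fun F p => peval (mderiv j (facet_basis T F p.1 p.2 0 i)) x)) => //.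
  by rewrite mulr_ge0 ?exprn_ge0 ?tau_ge0.
by move=> F p FM FT; have [] := phiB p i TM FM FT Tx.
Qed.

Let sum_cst (X : R) : d%:R * X = \sum_(i < d) X.
Proof. by rewrite sumr_const card_ord mulr_natl. Qed.

Definition cell_const : R :=
  d`!%:R * (2 * (d%:R * (d%:R * (nF * nI * (B * sigma ^+ d) ^+ 2)))).

(** The factor 2 is that of [(a + b) ^ 2 <= 2 a ^ 2 + 2 b ^ 2]. Squared gradients of the facet
    functions are of order [h ^ (-2 d)] and the volume of order [h ^ d], which leaves
    [h ^ (- d)]. *)
Lemma cell_term T : T \in cells M ->
  grad_energy T (RW k v) <= 2 * grad_energy T v + cell_const * (change_energy T / h T ^+ d).
Proof.
move=> TM; have [cT iT] := cellP TM; have T0 := cell_neq0 cT; have TT := fintype.subxx T.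
rewrite !grad_energyE //.
set E := change_energy T; set X := nF * nI * (B * tau T ^+ d) ^+ 2 * E.
have X0 : 0 <= X := mulr_ge0 (mulr_ge0 (mulr_ge0 nF0 nI0) (sqr_ge0 _)) (change_energy_ge0 T).
have dX0 : 0 <= 2 * (d%:R * (d%:R * X)) :=
  mulr_ge0 (ler0n R 2) (mulr_ge0 (ler0n R d) (mulr_ge0 (ler0n R d) X0)).
have le : LT T (gradsq (RW k v T)) <= 2 * LT T (gradsq (v T)) + 2 * (d%:R * (d%:R * X)).
  rewrite -lerBlDl -(sintZ T0 cT iT TT) -(sintB T0 cT iT TT).
  apply: (sint_cell_le cT iT) => [|x Tx]; first exact: dX0.
  rewrite pevalB pevalZ !gradsqE lerBlDl.
  have -> : d%:R * (d%:R * X) = \sum_(i < d) \sum_(j < d) X.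
    by rewrite -!sum_cst.
  rewrite -mulrDr -big_split mulr_sumr; apply: ler_sum => i _ /=.
  rewrite -big_split mulr_sumr; apply: ler_sum => j _ /=.
  rewrite RW_correction rowD mderivD pevalD.
  have := dcorrection_bound i j TM Tx; rewrite -/E -/X.
  move: (peval _ x) (peval _ x) => b a ab; apply: (@le_trans _ _ (2 * (b ^+ 2 + a ^+ 2))).
    by rewrite -subr_ge0 (_ : _ - _ = (a - b) ^+ 2) ?sqr_ge0 //; ring.
  by rewrite ler_wpM2l // lerD2l.
apply: le_trans (ler_wpM2l (sgram_ge0 T) le) _.
rewrite mulrDr mulrCA lerD2l.
have /andP[_ sg] := sgram_cell d0 cT iT (reg TM).
apply: le_trans (ler_wpM2r dX0 sg) _.
have hn : h T ^+ d != 0 by rewrite expf_neq0 // gt_eqF // h_gt0.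
rewrite /X /tau /cell_const expr_div_n le_eqVlt; apply/orP; left; apply/eqP.
by move: (sigma ^+ d) (h T ^+ d) hn => s t t0; field.
Qed.

Lemma simplex_facet T F x : T \in cells M -> F \subset T -> simplex F x -> simplex T x.
Proof.
move=> TM FT [c [c0 c1 ->]]; have [cT iT] := cellP TM.
apply: (simplex_barycentric cT iT) => w wT; rewrite (barycentric_comb iT FT) //.
by case: ifP => [wF|]; rewrite ?c0.
Qed.

Definition jump_energy T F (w : discrete_field M * discrete_field M) : R :=
  simplex_integral F (fun x => enorm (veval (facet_vproj F k (tangential_jump w T F)) x) ^+ 2).

Let jump_energyE T F w : F \in facets M -> jump_energy T F w = sgram F *
  sint F (peval (\sum_i facet_proj F k (fun x => tangential_jump w T F x 0 i) ^+ 2)).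
Proof.
move=> FM; rewrite /jump_energy simplex_integralE ?(facet_not_set0 hd) //.
congr (_ * _); apply: (sint_eq (facet_not_set0 hd FM)) => x _.
rewrite enorm_sqr peval_sum; apply: eq_bigr => i _.
by rewrite /veval /facet_vproj !mxE pevalX expr2.
Qed.

Let jump_energy_ge0 T F w : F \in facets M -> 0 <= jump_energy T F w.
Proof.
move=> FM; rewrite jump_energyE // mulr_ge0 ?sgram_ge0 //.
apply: (sint_ge0 (facet_not_set0 hd FM)) => x _; rewrite peval_sum; apply: sumr_ge0 => i _.
by rewrite pevalX sqr_ge0.
Qed.

Definition facet_const : R := 2 * (d%:R * (nF * nI * (B * sigma ^+ d.-1) ^+ 2)).

(** Powers of [h]: [-1] from the weight, [d - 1] from the facet measure, [-2 (d - 1)] from the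
    squared facet functions, in all [- d] as on the element. The facet unknown [u.2] is common to
    both jumps and cancels in their difference. *)
Lemma facet_term T F : T \in cells M -> F \in facets M -> F \subset T ->
  (h T)^-1 * jump_energy T F (RU k u) <=
  2 * ((h T)^-1 * jump_energy T F u) + facet_const * (change_energy T / h T ^+ d).
Proof.
move=> TM FM FT; have TF := cell_of_facet TM FM FT.
have [cT iT orderF _ [w wF TE]] := cell_facetP tri FM TF.
have F0 := facet_not_set0 hd FM; have sgF := sgram_facet_gt0 hd tri FM.
rewrite !jump_energyE //.
set n := facet_normal F.
pose jump (y : 'rV[mpoly d R]_d) i := y 0 i - n 0 i *: ntrace F y - u.2 F 0 i.
have uF : vdeg_lt k (u.2 F) by case: u_U => _ /(_ _ FM)[].
have dj y i : vdeg_lt k.+1 y -> deg_lt k.+1 (jump y i).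
  move=> dy; apply: deg_ltB; last exact: deg_lt_le (leqnSn k) (uF i).
  by apply: deg_ltB => //; apply/deg_ltZ/deg_lt_ntrace.
have jE (y : discrete_field M) i x :
    tangential_jump (y, u.2) T F x 0 i = peval (jump (y T) i) x.
  by rewrite /tangential_jump /tangential !mxE /= !pevalB pevalZ -ntraceE mulrC.
set E := change_energy T.
pose X := nF * nI * (B * tau T ^+ d.-1) ^+ 2 * E.
have X0 : 0 <= X := mulr_ge0 (mulr_ge0 (mulr_ge0 nF0 nI0) (sqr_ge0 _)) (change_energy_ge0 T).
have dX0 : 0 <= 2 * (d%:R * X) := mulr_ge0 (ler0n R 2) (mulr_ge0 (ler0n R d) X0).
pose e i := jump (RW k v T) i - jump (v T) i.
have eE i x : peval (e i) x = tangential n (veval (correction T) x) 0 i.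
  rewrite /e pevalB -!jE /tangential_jump /= RW_correction vevalD /tangential dotDl -/n.
  move: (veval (v T) x) (veval (correction T) x) (veval (u.2 F) x) => a b c.
  rewrite !(rowB, rowD, rowZ); move: (dot _ _) (dot _ _) => s t.
  by ring.
have le : sint F (peval (\sum_i facet_proj F k (fun x => tangential_jump (RU k u) T F x 0 i) ^+ 2))
    <= 2 * sint F (peval (\sum_i facet_proj F k (fun x => tangential_jump u T F x 0 i) ^+ 2))
       + 2 * (d%:R * X).
  have dRW := @broken_poly_RW _ _ _ _ _ hd tri _ v_poly k_gt0 _ TM.
  apply: (@le_trans _ _ (2 * sint F (peval (\sum_i facet_proj F k (fun x => tangential_jump u T F x 0 i) ^+ 2))
     + 2 * sint F (peval (\sum_i e i ^+ 2)))).
    apply: (sint_sum_le hd cT iT wF TE) => i.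
    apply: (facet_proj_stable hd cT iT wF TE orderF sgF); rewrite ?dj //.
    - by move=> x _; rewrite -jE.
    - by move=> x _; rewrite -jE -surjective_pairing.
    - exact: dj.
    - exact/dj/v_poly.
  rewrite lerD2l ler_wpM2l //.
  apply: (sint_facet_le hd cT iT wF TE) => [|x Fx]; first exact: (mulr_ge0 (ler0n R d) X0).
  rewrite peval_sum (eq_bigr (fun i => tangential n (veval (correction T) x) 0 i *
     tangential n (veval (correction T) x) 0 i)); last by move=> i _; rewrite pevalX eE expr2.
  apply: le_trans (dot_tangential_le hd cT iT wF TE _) _.
  have -> : d%:R * X = \sum_(i < d) X by exact: sum_cst.
  apply: ler_sum => i _; rewrite mxE -expr2.
  exact/correction_bound/(simplex_facet TM FT).
have hF y z : y \in F -> z \in F -> enorm (vert y - vert z) <= h T.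
  by move=> yF zF; apply: edge_le_diameter => //; apply: fintype.subsetP FT _ _.
have /andP[_ sg] := sgram_facet hd iT FT (card_facets FM) hF.
have h0 := h_gt0 TM; have hi : 0 <= (h T)^-1 by rewrite invr_ge0 ltW.
suff fin (S0 S1 : R) : S1 <= 2 * S0 + 2 * (d%:R * X) ->
    (h T)^-1 * (sgram F * S1) <=
    2 * ((h T)^-1 * (sgram F * S0)) + facet_const * (E / h T ^+ d) by exact: (fin _ _ le).
move=> {}le.
apply: le_trans (ler_wpM2l hi (ler_wpM2l (sgram_ge0 F) le)) _.
rewrite [leLHS](_ : _ = 2 * ((h T)^-1 * (sgram F * S0)) +
  (h T)^-1 * (sgram F * (2 * (d%:R * X)))); last by ring.
rewrite lerD2l; apply: le_trans (ler_wpM2l hi (ler_wpM2r dX0 sg)) _.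
have hn := gt_eqF h0; have hn' : h T ^+ d.-1 != 0 by rewrite expf_neq0 // hn.
have hdE : h T ^+ d = h T * h T ^+ d.-1 by rewrite -exprS prednK.
rewrite hdE /X /tau /facet_const expr_div_n.
rewrite le_eqVlt; apply/orP; left; apply/eqP.
by field; rewrite hn' hn.
Qed.

(** The average and the own coefficient are each at most the sum [S] of the moduli at [F], which
    gives [4 S ^ 2]; at most two elements give another factor 2. A boundary average is 0 and fits
    the same bound. *)
Lemma coef_change_le T F p : F \in facets M -> T \in cells_at F ->
  coef_change T F p ^+ 2 <= 8 * \sum_(T' in cells_at F) facet_coef k v T' F p ^+ 2.
Proof.
move=> FM TF; set a := fun T' => facet_coef k v T' F p.
pose S := \sum_(T' in cells_at F) `|a T'|.
have S0 : 0 <= S by apply: sumr_ge0.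
have aS : `|a T| <= S by rewrite /S (bigD1 T) //= lerDl sumr_ge0.
have avgS : `|avg_coef v F p| <= S.
  rewrite /avg_coef; case: ifP => _; last by rewrite normr0.
  have h2 : `|2^-1 : R| <= 1 by rewrite ger0_norm ?invr_ge0 // invf_le1 // ler1n.
  rewrite normrM -[leRHS]mul1r; apply: ler_pM => //.
  exact: ler_norm_sum.
have le : `|coef_change T F p| <= 2 * S.
  by rewrite mulr_natl mulr2n (le_trans (ler_normB _ _)) // lerD.
have card2 : #|[pred T' in cells_at F]|%:R <= 2 :> R.
  by rewrite ler_nat; apply: leq_trans (card_cells_at hd tri FM); apply: eq_leq; apply: eq_card.
rewrite -[leLHS]real_normK ?num_real //.
apply: (@le_trans _ _ ((2 * S) ^+ 2)).
  by rewrite lerXn2r ?nnegrE // mulr_ge0.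
have SS : S ^+ 2 <= 2 * \sum_(T' in cells_at F) a T' ^+ 2.
  apply: le_trans (sum_sqr_le _ _) _.
  rewrite (eq_bigr (fun T' => a T' ^+ 2)) => [|T' _]; last by rewrite real_normK ?num_real.
  by rewrite ler_wpM2r // sumr_ge0 // => T' _; apply: sqr_ge0.
rewrite exprMn (_ : 8 * _ = 2 ^+ 2 * (2 * \sum_(T' in cells_at F) a T' ^+ 2)); last by ring.
by rewrite ler_wpM2l.
Qed.

Let inv_norms : R := \sum_(p : I) (trace_norm R d p.1 p.2)^-1 ^+ 2.

Definition coef_const : R :=
  d%:R * B ^+ 2 * (d`!%:R) ^+ 4 * sigma ^+ (d + d) * inv_norms * (d`!%:R * sigma ^+ d).

Let sigma_pow_ge0 T n : T \in cells M -> 0 <= sigma ^+ n.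
Proof. by move=> TM; rewrite exprn_ge0 // ltW // (sigma_gt0 TM). Qed.

Let inv_norms_ge0 : 0 <= inv_norms.
Proof. by apply: sumr_ge0 => p _; apply: sqr_ge0. Qed.

Let coef_const_ge0 T : T \in cells M -> 0 <= coef_const.
Proof.
move=> TM; have s n := sigma_pow_ge0 n TM; have e : 0 <= d`!%:R ^+ 4 :> R by rewrite exprn_ge0.
rewrite /coef_const; apply: mulr_ge0; last by rewrite mulr_ge0.
apply: mulr_ge0 inv_norms_ge0; apply: mulr_ge0 (s _); apply: mulr_ge0 e.
by apply: mulr_ge0 (sqr_ge0 _).
Qed.

(** The lower volume bound converts one of the two factors [h ^ d] into [sgram T], restoring the
    full gradient energy; [inv_norms] removes the dependence on the index. *)
Lemma facet_coef_energy T F (p : I) : F \in facets M -> T \in cells_at F -> top_index d p ->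
  facet_coef k v T F p ^+ 2 <= coef_const * (h T ^+ d * grad_energy T v).
Proof.
move=> FM TF /andP[pv /eqP pk]; have TM := cells_at_cells TF.
have [cT iT orderF FT [w wF TE]] := cell_facetP tri FM TF.
have p0 : (0 < p.1 + p.2)%N by rewrite pk.
have bound x c (Tx : simplex T x) := (phiB p c TM FM FT Tx).1.
have := facet_coef_bound hd cT iT wF TE orderF pv p0 (reg TM) B_ge0 bound (v_poly TM) erefl.
move/le_trans; apply; rewrite grad_energyE //.
set G := LT T _; have G0 : 0 <= G by apply: gradsq_ge0.
have h0 := h_gt0 TM; have s0 := sigma_gt0 TM.
have hp : 0 <= h T ^+ d by rewrite exprn_ge0 // ltW.
have hG : h T ^+ d * G <= d`!%:R * sigma ^+ d * (sgram T * G).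
  have /andP[sg _] := sgram_cell d0 cT iT (reg TM).
  have sn : sigma ^+ d != 0 by rewrite expf_neq0 // gt_eqF.
  have fn : d`!%:R != 0 :> R by rewrite pnatr_eq0 -lt0n fact_gt0.
  have -> : h T ^+ d = d`!%:R * sigma ^+ d * (d`!%:R^-1 * (h T / sigma) ^+ d).
    by rewrite expr_div_n; field; rewrite sn fn.
  rewrite -[leLHS]mulrA ler_wpM2l //; last by rewrite ler_wpM2r.
  by rewrite mulr_ge0 // (sigma_pow_ge0 d TM).
have le1 : (trace_norm R d p.1 p.2)^-1 ^+ 2 <= inv_norms.
  by rewrite /inv_norms (bigD1 p) //= lerDl sumr_ge0 // => q _; apply: sqr_ge0.
pose C0 := d%:R * B ^+ 2 * (d`!%:R) ^+ 4 * sigma ^+ (d + d).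
have C00 : 0 <= C0.
  have s := sigma_pow_ge0 (d + d) TM; have e : 0 <= d`!%:R ^+ 4 :> R by rewrite exprn_ge0.
  by apply: mulr_ge0 s; apply: mulr_ge0 e; apply: mulr_ge0 (sqr_ge0 _).
rewrite -/C0 exprD.
rewrite (_ : C0 * _ * _ * G = C0 * (trace_norm R d p.1 p.2)^-1 ^+ 2 *
   (h T ^+ d * (h T ^+ d * G))); last by ring.
rewrite (_ : coef_const * _ = C0 * inv_norms *
   (h T ^+ d * (d`!%:R * sigma ^+ d * (sgram T * G)))); last by rewrite /coef_const -/C0; ring.
apply: ler_pM.
- by apply: mulr_ge0 (sqr_ge0 _).
- by apply: mulr_ge0 => //; apply: mulr_ge0.
- by rewrite ler_wpM2l.
- by rewrite ler_wpM2l.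
Qed.

Definition change_const : R := nI * (8 * (coef_const * sigma ^+ d)).

(** A neighbour's coefficient comes with its own diameter, which [adjacent_diameter] replaces by
    that of [T] at the price of [sigma ^ d]. *)
Lemma change_energy_le T : T \in cells M -> change_energy T / h T ^+ d <=
  change_const * \sum_(F in facets M | F \subset T) \sum_(T' in cells_at F) grad_energy T' v.
Proof.
move=> TM; have h0 := h_gt0 TM; have hp : 0 < h T ^+ d by rewrite exprn_gt0.
rewrite ler_pdivrMr // mulrAC mulr_sumr.
apply: ler_sum => F /andP[FM FT]; have TF := cell_of_facet TM FM FT.
set S := \sum_(T' in cells_at F) _.
pose C := 8 * (coef_const * (sigma ^+ d * h T ^+ d * S)).
have S0 : 0 <= S.
  by apply: sumr_ge0 => T' T'F; apply/grad_energy_ge0/cells_at_cells/T'F.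
have C0 : 0 <= C.
  apply: mulr_ge0 => //; apply: mulr_ge0; first exact: coef_const_ge0 TM.
  by rewrite mulr_ge0 // mulr_ge0 ?(sigma_pow_ge0 d TM) // ltW.
have le p : top_index d p -> coef_change T F p ^+ 2 <= C.
  move=> hp'; apply: le_trans (coef_change_le p FM TF) _.
  rewrite /C ler_wpM2l // !mulr_sumr; apply: ler_sum => T' T'F.
  have T'M := cells_at_cells T'F; apply: le_trans (facet_coef_energy FM T'F hp') _.
  rewrite ler_wpM2l ?(coef_const_ge0 TM) // ler_wpM2r ?grad_energy_ge0 //.
  rewrite -exprMn lerXn2r ?nnegrE ?(ltW (h_gt0 T'M)) //.
    by rewrite mulr_ge0 // ltW // (sigma_gt0 TM).
  exact: (adjacent_diameter hd tri reg FM T'F TF).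
apply: (@le_trans _ _ (\sum_(p : I | top_index d p) C)); first exact: ler_sum.
rewrite (_ : change_const * _ * S = nI * C); last by rewrite /change_const /C; ring.
rewrite sumr_const -[C *+ _]mulr_natl ler_wpM2r //.
by rewrite ler_nat max_card.
Qed.

(** Summation over facets first: at most two elements at a facet give the factor 2, and each element
    is then met once for each of its at most [nF] facets. *)
Let sum_cells_at (a : {set V} -> R) : (forall T, T \in cells M -> 0 <= a T) ->
  \sum_(T in cells M) \sum_(F in facets M | F \subset T) \sum_(T' in cells_at F) a T' <=
  2 * nF * \sum_(T in cells M) a T.
Proof.
move=> a0; have swap (b : {set V} -> {set V} -> R) :
    \sum_(T in cells M) \sum_(F in facets M | F \subset T) b T F =
    \sum_(F in facets M) \sum_(T in cells_at F) b T F.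
  rewrite (exchange_big_dep (mem (facets M))) /=; last by move=> T F _ /andP[].
  apply: eq_bigr => F FM; apply: eq_bigl => T.
  by rewrite FM [RHS]inE.
rewrite swap; apply: (@le_trans _ _ (\sum_(F in facets M) \sum_(T in cells_at F) 2 * a T)).
  apply: ler_sum => F FM; rewrite sumr_const -mulr_sumr -[_ *+ _]mulr_natl ler_wpM2r //.
    by apply: sumr_ge0 => T TF; apply/a0/cells_at_cells/TF.
  by rewrite ler_nat (card_cells_at hd tri).
rewrite -(swap (fun T _ => 2 * a T)) mulr_sumr; apply: ler_sum => T TM.
rewrite sumr_const -[_ *+ _]mulr_natl [2 * nF]mulrC -mulrA ler_wpM2r ?mulr_ge0 ?a0 //.
exact: card_facets_of.
Qed.

Definition stability_const : R :=
  2 + (cell_const + nF * facet_const) * change_const * (2 * nF).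

Let facet_const_ge0 : 0 <= facet_const :=
  mulr_ge0 (ler0n R 2) (mulr_ge0 (ler0n R d) (mulr_ge0 (mulr_ge0 nF0 nI0) (sqr_ge0 _))).

Let cell_const_ge0 : 0 <= cell_const :=
  mulr_ge0 (ler0n R _) (mulr_ge0 (ler0n R 2) (mulr_ge0 (ler0n R d) (mulr_ge0 (ler0n R d)
    (mulr_ge0 (mulr_ge0 nF0 nI0) (sqr_ge0 _))))).

Lemma norm1_RU : norm1 k (RU k u) <= Num.sqrt stability_const * norm1 k u.
Proof.
(* Without elements both norms are 0. An element provides [0 < sigma], from which the signs of the
   constants are derived. *)
have [e0|[T0 T0M]] := set_0Vmem (cells M).
  have z (w : discrete_field M * discrete_field M) : norm1 k w = 0.
    by rewrite /norm1 big1 ?sqrtr0 // => T TM; move: TM; rewrite e0 finset.in_set0.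
  by rewrite !z mulr0.
have nn : 0 <= cell_const + nF * facet_const := addr_ge0 cell_const_ge0 (mulr_ge0 nF0 facet_const_ge0).
have nc : 0 <= change_const.
  apply: mulr_ge0 => //; apply: mulr_ge0 => //.
  by apply: mulr_ge0 (sigma_pow_ge0 d T0M); apply: coef_const_ge0 T0M.
pose N (w : discrete_field M * discrete_field M) : R := \sum_(T in cells M) (grad_energy T w.1 +
  (h T)^-1 * \sum_(F in facets M | F \subset T) jump_energy T F w).
have NE w : norm1 k w = Num.sqrt (N w) by [].
have jump0 T : T \in cells M ->
    0 <= (h T)^-1 * \sum_(F in facets M | F \subset T) jump_energy T F u.
  move=> TM; rewrite mulr_ge0 ?invr_ge0 ?(ltW (h_gt0 TM)) //.
  by apply: sumr_ge0 => F /andP[FM _]; apply: jump_energy_ge0.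
have gradN : \sum_(T in cells M) grad_energy T v <= N u.
  by apply: ler_sum => T TM; rewrite lerDl jump0.
have N0 : 0 <= N u.
  by apply: le_trans gradN; apply: sumr_ge0 => T; apply: grad_energy_ge0.
suff le : N (RU k u) <= stability_const * N u.
  rewrite !NE -sqrtrM; first exact: ler_wsqrtr.
  exact: (addr_ge0 (ler0n R 2) (mulr_ge0 (mulr_ge0 nn nc) (mulr_ge0 (ler0n R 2) nF0))).
have cell T : T \in cells M -> grad_energy T (RU k u).1 +
    (h T)^-1 * \sum_(F in facets M | F \subset T) jump_energy T F (RU k u) <=
    2 * (grad_energy T v + (h T)^-1 * \sum_(F in facets M | F \subset T) jump_energy T F u)
    + (cell_const + nF * facet_const) * (change_energy T / h T ^+ d).
  move=> TM; set E := change_energy T / _.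
  have E0 : 0 <= E by rewrite divr_ge0 ?change_energy_ge0 // exprn_ge0 // ltW // h_gt0.
  have fc0 : 0 <= facet_const * E := mulr_ge0 facet_const_ge0 E0.
  have jumps : (h T)^-1 * \sum_(F in facets M | F \subset T) jump_energy T F (RU k u) <=
      2 * ((h T)^-1 * \sum_(F in facets M | F \subset T) jump_energy T F u) + nF * (facet_const * E).
    apply: (@le_trans _ _ (\sum_(F in facets M | F \subset T)
        (2 * ((h T)^-1 * jump_energy T F u) + facet_const * E))).
      by rewrite mulr_sumr; apply: ler_sum => F /andP[FM FT]; apply: facet_term.
    rewrite big_split /= !mulr_sumr lerD2l sumr_const -[_ *+ _]mulr_natl ler_wpM2r //.
    exact: card_facets_of.
  apply: le_trans (lerD (cell_term TM) jumps) _.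
  rewrite -/E; move: (\sum_(F in _ | _) _) => s.
  by rewrite le_eqVlt; apply/orP; left; apply/eqP; ring.
apply: le_trans; first by apply: ler_sum => T TM; exact: (cell T TM).
rewrite big_split /= -!mulr_sumr.
rewrite -/(N u) /stability_const [leRHS]mulrDl.
rewrite lerD2l -[leRHS]mulrA -[leRHS]mulrA; apply: (ler_wpM2l nn).
apply: (@le_trans _ _ (change_const * \sum_(T in cells M)
    \sum_(F in facets M | F \subset T) \sum_(T' in cells_at F) grad_energy T' v)).
  by rewrite mulr_sumr; apply: ler_sum => T TM; apply: change_energy_le.
apply: (ler_wpM2l nc).
have sc := sum_cells_at (fun T (TM : T \in cells M) => grad_energy_ge0 v TM).
apply: le_trans sc _.
exact: (ler_wpM2l (mulr_ge0 (ler0n R 2) nF0) gradN).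
Qed.

End Stability.

(** Part (2) names two elements at [F] because traces are one-sided; in part (4) the constant
    precedes the mesh, for a given regularity [sigma]. *)
Theorem lemma3p3 (R : realType) (d k : nat) (Om : set 'rV[R]_d) (sigma : R)
  (hd : d = 2%N \/ d = 3%N) (hk : (1 <= k)%N)
  (Om_open : open Om) (Om_bounded : bounded_domain Om)
  (Om_lipschitz : lipschitz_boundary Om) :
  (forall M : mesh R d, triangulation Om M -> shape_regular sigma M ->
     forall v : discrete_field M, Wminus_space k v ->
     [/\ W_space k (RW k v),
         forall F T T' (phi : mpoly.mpoly d R), F \in facets M ->
           T \in cells_at F -> T' \in cells_at F -> deg_lt k phi ->
           simplex_integral F (fun x => normal_trace F (RW k v T) x * peval phi x) =
           simplex_integral F (fun x => normal_trace F (v T') x * peval phi x) &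
         forall T (phi : 'rV[mpoly.mpoly d R]_d), T \in cells M ->
           vdeg_lt k.-1 phi ->
           simplex_integral T (fun x => dot (veval (RW k v T) x) (veval phi x)) =
           simplex_integral T (fun x => dot (veval (v T) x) (veval phi x))]) /\
  (exists c : R, forall M : mesh R d,
     triangulation Om M -> shape_regular sigma M ->
     forall u : discrete_field M * discrete_field M, U_space k u ->
     norm1 k (RU k u) <= c * norm1 k u).
Proof.
split=> [M tri reg v [v_poly v_minus]|].
  split=> [|F T T' phi FM TF T'F dphi|T phi TM dphi].
  - exact: (W_space_RW hd tri v_poly v_minus hk).
  - exact: (normal_moment_RW hd tri v_poly v_minus FM TF T'F dphi).
  - exact: (cell_moment_RW hd tri v TM dphi).
(* [B] is obtained from [d] and [k] alone, before any mesh, which makes the constant uniform. *)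
have [B B0 hB] := facet_basis_bounds R k hd.
exists (Num.sqrt (stability_const d k sigma B)) => M tri reg u uU.
exact: (norm1_RU hd hk B0 hB tri reg uU).
Qed.
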